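(* Let $\phi:\mathbb{R}^n\to\mathbb{R}^n$ be bounded and locally Lipschitz, and for every $m\in\mathbb{N}$ consider the system $$\dot x_i=\frac1m\sum_{j=1}^m\phi(x_j-x_i),\qquad x_i\in\mathbb{R}^n,\ i=1,\dots,m.$$ Let $V$ be the Probability Vector Field $V[\mu]=\mu\otimes\delta_{\int_{\mathbb{R}^n}\phi(y-x)\,d\mu(y)}$. Then $V$ is locally $\mathcal{W}$-Lipschitz, and for every $m$ and every solution $x(t)=(x_1(t),\dots,x_m(t))$ of the system, the empirical probability measure $\mu_m(t)=\frac1m\sum_{i=1}^m\delta_{x_i(t)}$ is a solution to $\dot\mu=V[\mu]$. Moreover, for every $T>0$, there exists a unique Lipschitz semigroup on $[0,T]\times\mathcal{P}_c(\mathbb{R}^n)$ for $\dot\mu=V[\mu]$ whose trajectories coincide with the empirical probability measures for finite sums of Dirac deltas, i.e. $S_t\big(\frac1m\sum_i\delta_{x_i(0)}\big)=\frac1m\sum_i\delta_{x_i(t)}$ for every $m$ and every solution $x(\cdot)$ of the system.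
   Context: $T\mathbb{R}^n=\mathbb{R}^n\times\mathbb{R}^n$ with points $(x,v)$, $\pi_1(x,v)=x$, $\pi_{13}(x,v,y,w)=(x,y)$. $\mathcal{P}(X)$: Borel probability measures; $\mathcal{P}_c(X)$: those with compact support. $P(\mu,\nu)$ is the set of couplings of $\mu,\nu$; $W$ is the 1-Wasserstein metric on $\mathbb{R}^n$ and $P^{opt}(\mu,\nu)$ the set of couplings minimizing $\int|x-y|\,d\tau$. $B(0,R)$ is the ball of radius $R$ centered at $0$. A Probability Vector Field (PVF) is a map $V:\mathcal{P}(\mathbb{R}^n)\to\mathcal{P}(T\mathbb{R}^n)$ with $\pi_1\#V[\mu]=\mu$; $\mu\otimes\nu_x$ denotes the measure with $\int\psi\,d(\mu\otimes\nu_x)=\int\int\psi(x,v)\,d\nu_x(v)\,d\mu(x)$. For $V_1,V_2\in\mathcal{P}_c(T\mathbb{R}^n)$ with $\mu_i=\pi_1\#V_i$, $$\mathcal{W}(V_1,V_2)=\inf\Big\{\int|v-w|\,dT(x,v,y,w): T\in P(V_1,V_2),\ \pi_{13}\#T\in P^{opt}(\mu_1,\mu_2)\Big\}.$$ $V$ is locally $\mathcal{W}$-Lipschitz if for every $R>0$ there is $K=K(R)>0$ with $\mathcal{W}(V[\mu],V[\nu])\le K\,W(\mu,\nu)$ whenever $\mathrm{Supp}(\mu),\mathrm{Supp}(\nu)\subset B(0,R)$. Solution: $\mu:[0,T]\to\mathcal{P}(\mathbb{R}^n)$ is a solution to $\dot\mu=V[\mu]$ if for every $f\in C_c^\infty(\mathbb{R}^n)$: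 $\int_{T\mathbb{R}^n}\nabla f(x)\cdot v\,dV[\mu(s)](x,v)$ is defined for a.e. $s$ and is $L^1$ in $s\in[0,T]$, $t\mapsto\int f\,d\mu(t)$ is absolutely continuous, and for a.e. $t$, $\frac{d}{dt}\int f\,d\mu(t)=\int_{T\mathbb{R}^n}\nabla f(x)\cdot v\,dV[\mu(t)](x,v)$. Lipschitz semigroup for $\dot\mu=V[\mu]$ (where $V$ satisfies $\sup_{(x,v)\in \mathrm{Supp}(V[\mu])}|v|\le C(1+\sup_{x\in \mathrm{Supp}(\mu)}|x|)$ for all $\mu\in\mathcal{P}_c(\mathbb{R}^n)$, for some $C>0$): a map $S:[0,T]\times\mathcal{P}_c(\mathbb{R}^n)\to\mathcal{P}_c(\mathbb{R}^n)$ such that for all $\mu,\nu\in\mathcal{P}_c(\mathbb{R}^n)$ and $t,s\in[0,T]$: (i) $S_0\mu=\mu$ and $S_tS_s\mu=S_{t+s}\mu$ (when $t+s\le T$); (ii) $t\mapsto S_t\mu$ is a solution to $\dot\mu=V[\mu]$; (iii) for every $R>0$ there is $C(R)>0$ such that if $\mathrm{Supp}(\mu),\mathrm{Supp}(\nu)\subset B(0,R)$ then $\mathrm{Supp}(S_t\mu)\subset B(0,e^{Ct}(R+1))$, $W(S_t\mu,S_t\nu)\le e^{C(R)t}W(\mu,\nu)$, and $W(S_t\mu,S_s\mu)\le C(R)|t-s|$. *)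

(* Defs.v *)
From HB Require Import structures.
From mathcomp Require Import all_boot all_order all_algebra.
From mathcomp Require Import all_classical all_reals all_analysis measurable_realfun.

Set Implicit Arguments.
Unset Strict Implicit.
Unset Printing Implicit Defensive.

Import Order.TTheory GRing.Theory Num.Theory.
Import numFieldNormedType.Exports.

Local Open Scope classical_set_scope.
Local Open Scope ring_scope.

(* The Borel sigma-algebra on matrices, hence on R^n = 'rV[R]_n.  The measurable
   structure that T R^n = R^n * R^n then inherits is the product of the Borel
   sigma-algebras, which is the Borel sigma-algebra of the product since R^n is
   second countable. *)
HB.instance Definition _ (R : realType) (m n : nat) :=
  Measurable.copy 'M[R]_(m, n) (g_sigma_algebraType (@open 'M[R]_(m, n))).

Section measurability.
Variables (R : realType) (n : nat).
Local Notation Rn := 'rV[R]_n.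

Lemma measurable_open (A : set Rn) : open A -> measurable A.
Proof. by move=> oA; apply: sub_sigma_algebra. Qed.

Lemma measurable_coord (i : 'I_n) :
  measurable_fun [set: Rn] (fun v : Rn => v ord0 i : measurableTypeR R).
Proof.
apply: (measurability _ (RGenOpens.measurableE R)) => _ [_ [a [b ->]] <-].
rewrite setTI; apply: measurable_open.
apply: open_comp => [v _|]; first exact: coord_continuous.
exact: interval_open.
Qed.

Let box (cq : 'rV[rat]_n * rat) : set Rn :=
  [set v | forall i, `|ratr (cq.1 ord0 i) - v ord0 i| < ratr cq.2].

Let open_box (A : set Rn) (v : Rn) : open A -> A v ->
  exists cq, box cq v /\ box cq `<=` A.
Proof.
rewrite openE => oA Av; have /nbhs_ballP[e /= e0 eA] := oA _ Av.
have [q] : exists q : rat, 0 < (ratr q : R) < e / 2.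
  have /rat_in_itvoo[q] : 0 < e / 2 by rewrite divr_gt0.
  by rewrite in_itv /= => qe; exists q.
move=> /andP[q0 qe].
have cP i : exists c : rat, `|ratr c - v ord0 i| < ratr q.
  have /rat_in_itvoo[c] : v ord0 i - ratr q < v ord0 i + ratr q.
    by rewrite ltrD2l (lt_trans _ q0)// oppr_lt0.
  by rewrite in_itv /= -ltr_distl => cq; exists c.
pose c := \row_i sval (cid (cP i)).
have vc : box (c, q) v by move=> i; rewrite /= mxE; case: cid.
exists (c, q); split => // w wc; apply: eA; split => // i j; rewrite ord1.
rewrite /ball/= -(subrKA (ratr (c ord0 j))) (le_lt_trans (ler_normD _ _))//.
rewrite (splitr e) ltrD//; last exact: lt_trans (wc j) qe.
by rewrite distrC; exact: lt_trans (vc j) qe.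
Qed.

Lemma measurable_fun_row d (X : measurableType d) (f : X -> Rn) :
  (forall i, measurable_fun [set: X] (fun t => f t ord0 i : measurableTypeR R)) ->
  measurable_fun [set: X] f.
Proof.
move=> mf; apply: (@measurability _ _ _ _ _ _ (@open Rn) erefl).
move=> _ [A oA <-]; rewrite setTI.
have -> : f @^-1` A =
    \bigcup_(cq : 'rV[rat]_n * rat) if `[<box cq `<=` A>] then f @^-1` box cq else set0.
  apply/seteqP; split => [t /= At|t [cq _]]; last first.
    by case: asboolP => // + ?; apply.
  have [cq [? ?]] := open_box oA At.
  by exists cq => //; case: asboolP.
apply: countable_bigcupT_measurable; first exact: countableP.
move=> cq; case: ifPn => // _.
have -> : f @^-1` box cq = \bigcap_(i in [set: 'I_n])
    ((fun t => f t ord0 i) @^-1` ball (ratr (cq.1 ord0 i) : R) (ratr cq.2)).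
  by apply/seteqP; split => [t h i _|t h i]; [exact: h|exact: (h i)].
apply: fin_bigcap_measurable => // i _.
rewrite -[X in measurable X]setTI; apply: mf => //; rewrite ball_itv; exact: measurable_itv.
Qed.

Lemma continuous_measurable_row (f : Rn -> Rn) :
  continuous f -> measurable_fun [set: Rn] f.
Proof.
move=> cf; apply: (@measurability _ _ _ _ _ _ (@open Rn) erefl).
move=> _ [A oA <-]; rewrite setTI; apply: measurable_open.
exact: open_comp.
Qed.

End measurability.

Section probability_measures.
Context d (X : measurableType d) (R : realType).

(* A library measure is a function on all subsets, of which only the values on
   measurable sets matter. *)
Definition eq_meas (mu nu : set X -> \bar R) : Prop :=
  forall A, measurable A -> mu A = nu A.

(* (1 / m.+1) \sum_i delta_(x i) *)
Definition empirical (m : nat) (x : 'I_m.+1 -> X) (A : set X) : \bar R :=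
  ((m.+1%:R^-1)%:E * \sum_(i < m.+1) \d_(x i) A)%E.

Section empirical_probability.
Variables (m : nat) (x : 'I_m.+1 -> X).

Let empiricalE : empirical x =
  mscale ((m.+1%:R^-1)%:nng : {nonneg R})
         (msum (fun k => \d_(x (inord k)) : {measure set X -> \bar R}) m.+1).
Proof.
apply/funext => A; rewrite /empirical /mscale /msum /=; congr (_ * _)%E.
by apply: eq_bigr => i _; rewrite inord_val.
Qed.

Let empirical0 : empirical x set0 = 0%E.
Proof. by rewrite empiricalE measure0. Qed.

Let empirical_ge0 A : (0 <= empirical x A)%E.
Proof. by rewrite empiricalE measure_ge0. Qed.

Let empirical_sigma_additive : semi_sigma_additive (empirical x).
Proof. by rewrite empiricalE; exact: measure_semi_sigma_additive. Qed.

HB.instance Definition _ := isMeasure.Build _ _ _ (empirical x)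
  empirical0 empirical_ge0 empirical_sigma_additive.

Let empirical_setT : empirical x setT = 1%E.
Proof.
rewrite /empirical (eq_bigr (fun=> 1%E)) => [|i _]; last by rewrite diracT.
by rewrite sumEFin big_const_ord iter_addr_0 -EFinM mulVf.
Qed.

HB.instance Definition _ := Measure_isProbability.Build _ _ _ (empirical x)
  empirical_setT.

End empirical_probability.

End probability_measures.

(* mu \otimes nu_x, given by \int psi d(mu \otimes nu_x) =
   \int \int psi(x, v) dnu_x(v) dmu(x) for psi the indicator of A. *)
Section otimes.
Context d d' (X : measurableType d) (Y : measurableType d') (R : realType).
Variables (mu : probability X R) (nu : R.-pker X ~> Y).

Definition otimes (A : set (X * Y)) : \bar R :=
  (\int[mu]_x \int[nu x]_v (\1_A (x, v))%:E)%E.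

Let muk : X -> {measure set X -> \bar R} :=
  kprobability (@measurable_cst _ _ X (pprobability X R) setT mu).

Let otimes0 : otimes set0 = 0%E.
Proof. exact: (measure0 (mkproduct muk (kernel.kernel_snd nu) point)). Qed.

Let otimes_ge0 A : (0 <= otimes A)%E.
Proof. exact: (measure_ge0 (mkproduct muk (kernel.kernel_snd nu) point)). Qed.

Let otimes_sigma_additive : semi_sigma_additive otimes.
Proof.
exact: (@measure_semi_sigma_additive _ _ _ (mkproduct muk (kernel.kernel_snd nu) point)).
Qed.

HB.instance Definition _ := isMeasure.Build _ _ _ otimes
  otimes0 otimes_ge0 otimes_sigma_additive.

Let otimes_setT : otimes setT = 1%E.
Proof.
rewrite /otimes (eq_integral (cst 1%E)) => [|x _].
  by rewrite integral_cst// mul1e; exact: probability_setT.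
rewrite (eq_integral (cst 1%E)) => [|v _]; last by rewrite indicT.
by rewrite integral_cst// mul1e prob_kernel.
Qed.

HB.instance Definition _ := Measure_isProbability.Build _ _ _ otimes otimes_setT.

End otimes.

Section euclidean.
Variables (R : realType) (n : nat).
Local Notation Rn := 'rV[R]_n.

Definition dotv (x y : Rn) : R := \sum_i x ord0 i * y ord0 i.

(* The Euclidean norm; the library norm on 'rV[R]_n is the equivalent sup norm. *)
Definition enorm (x : Rn) : R := Num.sqrt (dotv x x).

Definition eball (r : R) : set Rn := [set x | enorm x < r].

(* Stated with the library norm; equivalent norms give the same notion. *)
Definition locally_lipschitz (f : Rn -> Rn) : Prop :=
  forall x : Rn, exists U, nbhs x U /\ [lipschitz f y | y in U].

Lemma locally_lipschitz_measurable (f : Rn -> Rn) :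
  locally_lipschitz f -> measurable_fun [set: Rn] f.
Proof.
move=> lf; apply: continuous_measurable_row => x.
have [U [xU [M [_ /(_ (`|M| + 1))]]]] := lf x.
rewrite (le_lt_trans (ler_norm M)) ?ltrDl// => /(_ isT) fM.
have M0 : 0 < `|M| + 1 by rewrite ltr_wpDl.
apply/(@cvgrPdist_lt _ _ _ (nbhs x) (nbhs_filter x)) => e e0.
have xb : nbhs x (ball x (e / (`|M| + 1))).
  by apply: nbhsx_ballx; rewrite divr_gt0.
apply: filterS (filterI xU xb) => y [Uy].
rewrite -ball_normE /= ltr_pdivlMr// mulrC; apply: le_lt_trans.
by apply: (fM (x, y)); split => //=; exact: nbhs_singleton.
Qed.

Definition partial (i : 'I_n) (f : Rn -> R) : Rn -> R := 'D_(delta_mx ord0 i) f.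

Definition grad (f : Rn -> R) (x : Rn) : Rn := \row_i partial i f x.

Fixpoint Ck (k : nat) (f : Rn -> R) : Prop :=
  match k with
  | 0 => continuous f
  | j.+1 => continuous f /\ forall i,
      (forall x, derivable f x (delta_mx ord0 i)) /\ Ck j (partial i f)
  end.

Definition test_function (f : Rn -> R) : Prop :=
  (forall k, Ck k f) /\ compact (closure [set x | f x != 0]).

End euclidean.

(* The topological support. *)
Definition supp (R : realType) (X : topologicalType) (mu : set X -> \bar R) :
    set X :=
  [set x | forall U, open U -> U x -> (0 < mu U)%E].

Section wasserstein.
Variables (R : realType) (n : nat).
Local Notation Rn := 'rV[R]_n.
Local Notation TRn := (Rn * Rn)%type.

Definition coupling d1 d2 (X : measurableType d1) (Y : measurableType d2)
    (mu : set X -> \bar R) (nu : set Y -> \bar R) (tau : set (X * Y) -> \bar R) :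
    Prop :=
  eq_meas (pushforward tau fst) mu /\ eq_meas (pushforward tau snd) nu.

Definition transport_cost (tau : set (Rn * Rn) -> \bar R) : \bar R :=
  (\int[tau]_z (enorm (z.1 - z.2))%:E)%E.

Definition W (mu nu : set Rn -> \bar R) : \bar R :=
  ereal_inf [set transport_cost tau | tau in
    [set tau : probability (Rn * Rn)%type R | coupling mu nu tau]].

Definition optimal_coupling (mu nu : set Rn -> \bar R)
    (tau : set (Rn * Rn) -> \bar R) : Prop :=
  coupling mu nu tau /\
  forall tau' : probability (Rn * Rn)%type R,
    coupling mu nu tau' -> (transport_cost tau <= transport_cost tau')%E.

Definition pi13 (z : TRn * TRn) : Rn * Rn := (z.1.1, z.2.1).

Definition calW (V1 V2 : set TRn -> \bar R) : \bar R :=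
  ereal_inf [set (\int[T]_z (enorm (z.1.2 - z.2.2))%:E)%E | T in
    [set T : probability (TRn * TRn)%type R |
      coupling V1 V2 T /\
      optimal_coupling (pushforward V1 fst) (pushforward V2 fst)
        (pushforward T pi13)]].

End wasserstein.

Section measure_differential_equations.
Variables (R : realType) (n : nat).
Local Notation Rn := 'rV[R]_n.
Local Notation TRn := (Rn * Rn)%type.
Local Notation PRn := (probability Rn R).

Definition compactly_supported (mu : PRn) : Prop := compact (supp mu).

Record pvf := Pvf {
  pvf_fun :> PRn -> probability TRn R;
  pvf_ext : forall mu nu : PRn, eq_meas mu nu -> eq_meas (pvf_fun mu) (pvf_fun nu);
  pvf_proj : forall mu : PRn, eq_meas (pushforward (pvf_fun mu) fst) mu
}.

Definition locally_calW_lipschitz (V : pvf) : Prop :=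
  forall r : R, 0 < r -> exists K : R, 0 < K /\
    forall mu nu : PRn, supp mu `<=` eball r -> supp nu `<=` eball r ->
    (calW (V mu) (V nu) <= K%:E * W mu nu)%E.

Definition linear_growth (V : pvf) (C : R) : Prop :=
  forall mu : PRn, compactly_supported mu ->
  (ereal_sup [set (enorm z.2)%:E | z in supp (V mu)] <=
   C%:E * (1 + ereal_sup [set (enorm x)%:E | x in supp mu]))%E.

Definition abs_continuous (a b : R) (f : R -> R) : Prop :=
  forall e, 0 < e -> exists d, 0 < d /\
    forall (k : nat) (u v : 'I_k -> R),
    (forall i, a <= u i <= v i /\ v i <= b) ->
    trivIset setT (fun i => `]u i, v i[%classic) ->
    \sum_i (v i - u i) < d -> \sum_i `|f (v i) - f (u i)| < e.

(* The L^1 condition asks for a representative g because the library's Lebesgue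
   measure is not complete and the integral need only exist for a.e. s. *)
Definition is_solution (V : pvf) (T : R) (mu : R -> PRn) : Prop :=
  forall f : Rn -> R, test_function f ->
  let flux := fun z : TRn => dotv (grad f z.1) z.2 in
  let rate := fun s => \int[V (mu s)]_z flux z in
  let mean := fun t => \int[mu t]_x f x in
  [/\ exists g : R -> R,
        lebesgue_measure.-integrable `[0, T] (EFin \o g) /\
        {ae (@lebesgue_measure R), forall s, 0 <= s <= T ->
          (V (mu s)).-integrable setT (EFin \o flux) /\ rate s = g s},
      abs_continuous 0 T mean &
      {ae (@lebesgue_measure R), forall t, 0 <= t <= T ->
        is_derive (t : R) (1 : R) mean (rate t)}].

(* S is a map on [0, T] x P_c(R^n): its values elsewhere are irrelevant, and
   measures that agree on the Borel sets are identified.  C is the constant of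
   the linear growth condition on V. *)
Definition lipschitz_semigroup (V : pvf) (C T : R) (S : R -> PRn -> PRn) : Prop :=
  let dom := fun t : R => 0 <= t <= T in
  let Pc := compactly_supported in
  [/\ forall t mu, dom t -> Pc mu -> Pc (S t mu),
      forall t mu nu, dom t -> Pc mu -> Pc nu ->
        eq_meas mu nu -> eq_meas (S t mu) (S t nu),
      (forall mu, Pc mu -> eq_meas (S 0 mu) mu) /\
      (forall t s mu, dom t -> dom s -> t + s <= T -> Pc mu ->
        eq_meas (S t (S s mu)) (S (t + s) mu)),
      forall mu, Pc mu -> is_solution V T (S ^~ mu) &
      forall r : R, 0 < r -> exists K : R, 0 < K /\
        forall mu nu t s, Pc mu -> Pc nu -> dom t -> dom s ->
        supp mu `<=` eball r -> supp nu `<=` eball r ->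
        [/\ supp (S t mu) `<=` eball (expR (C * t) * (r + 1)),
            (W (S t mu) (S t nu) <= (expR (K * t))%:E * W mu nu)%E &
            (W (S t mu) (S s mu) <= (K * `|t - s|)%:E)%E]].

End measure_differential_equations.

Section interacting_particles.
Variables (R : realType) (n : nat) (phi : 'rV[R]_n -> 'rV[R]_n).
Local Notation Rn := 'rV[R]_n.
Local Notation PRn := (probability Rn R).

(* A system of m.+1 particles, so that the average makes sense; a solution on
   [0, T] is continuous up to the end points and satisfies the equation in the
   interior. *)
Definition particle_solution (T : R) (m : nat) (x : R -> 'I_m.+1 -> Rn) : Prop :=
  forall i, {within `[0, T], continuous (fun t => x t i)} /\
  forall t, 0 < t < T ->
    is_derive t 1 (fun s => x s i)
      ((m.+1%:R^-1 : R) *: \sum_j phi (x t j - x t i)).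

Definition follows_particles (T : R) (S : R -> PRn -> PRn) : Prop :=
  forall (m : nat) (x : R -> 'I_m.+1 -> Rn), particle_solution T x ->
  forall t, 0 <= t <= T -> eq_meas (S t (empirical R (x 0))) (empirical R (x t)).

Definition mean_velocity (mu : PRn) (x : Rn) : Rn :=
  \row_i \int[mu]_y phi (y - x) ord0 i.

Lemma measurable_mean_velocity (mu : PRn) :
  measurable_fun [set: Rn] phi -> measurable_fun [set: Rn] (mean_velocity mu).
Proof.
move=> mphi; apply: measurable_fun_row => i.
pose F (z : Rn * Rn) : \bar R := (phi (z.2 - z.1) ord0 i)%:E.
have mF : measurable_fun [set: Rn * Rn] F.
  apply/measurable_EFinP; apply: (measurableT_comp (measurable_coord i)).
  apply: (measurableT_comp mphi); apply: measurable_fun_row => j.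
  rewrite (_ : (fun _ => _) = fun z : Rn * Rn => z.2 ord0 j - z.1 ord0 j).
    by apply: measurable_funB; apply: measurableT_comp (measurable_coord j) _.
  by apply/funext => z; rewrite !mxE.
have -> : (fun x => mean_velocity mu x ord0 i) =
    fine \o (fun x => fubini_F mu (F ^\+)%E x - fubini_F mu (F ^\-)%E x)%E.
  apply/funext => x; rewrite mxE /Rintegral integralE /fubini_F /=.
  by congr (fine (_ - _)%E); apply: eq_integral => y _; rewrite ?(funeposE, funenegE).
apply: measurableT_comp; first exact: fine_measurable.
by apply: emeasurable_funB; apply: measurable_fun_fubini_tonelli_F => //;
  [exact: measurable_funepos|exact: measurable_funeneg].
Qed.

Hypothesis mphi : measurable_fun [set: Rn] phi.

Definition mean_velocity_kernel (mu : PRn) : R.-pker Rn ~> Rn :=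
  kdirac (measurable_mean_velocity mu mphi).

Definition interaction_fun (mu : PRn) : probability (Rn * Rn)%type R :=
  otimes mu (mean_velocity_kernel mu).

Let eq_meas_integral (mu nu : PRn) (f : Rn -> \bar R) : eq_meas mu nu ->
  (\int[mu]_x f x = \int[nu]_x f x)%E.
Proof. by move=> e; apply: eq_measure_integral => A mA _; exact: e. Qed.

Let interaction_ext (mu nu : PRn) : eq_meas mu nu ->
  eq_meas (interaction_fun mu) (interaction_fun nu).
Proof.
move=> e A mA; rewrite /interaction_fun /= /otimes (eq_meas_integral _ e).
apply: eq_integral => x _; rewrite /mean_velocity_kernel /= /kdirac.
suff -> : mean_velocity mu x = mean_velocity nu x by [].
by apply/rowP => i; rewrite !mxE /Rintegral (eq_meas_integral _ e).
Qed.

Let interaction_proj (mu : PRn) :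
  eq_meas (pushforward (interaction_fun mu) fst) mu.
Proof.
move=> A mA; rewrite /pushforward /interaction_fun /= /otimes.
rewrite (eq_integral (fun x => (\1_A x)%:E)) => [|x _].
  by rewrite integral_indic// setIT.
rewrite (eq_integral (cst (\1_A x)%:E)) => [|v _]; last by rewrite !indicE.
by rewrite integral_cst// [X in (_ * X)%E]prob_kernel mule1.
Qed.

(* V[mu] = mu \otimes delta_(\int phi(y - x) dmu(y)) *)
Definition interaction_pvf : pvf R n := Pvf interaction_ext interaction_proj.

End interacting_particles.

(* Main.v *)
(* A flow is a family X_t : O -> R^n over a probability space (O, P) of labels
   that solves X_t' w = \int phi(X_t w' - X_t w) dP(w').  Euler polygons converge
   to a flow because phi is bounded and locally Lipschitz; the law of X_t then
   solves the measure differential equation.  Gronwall's inequality gives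
   \int |X_t - Y_t| dP <= e^(K t) \int |X_0 - Y_0| dP for two flows over the same
   labels, whence the law of X_t depends only on the law of X_0.  Taking
   (O, P) = (R^n, mu) and X_0 = id defines S_t mu, taking m equally likely labels
   gives the particle system, and pulling two flows back to a coupling of the
   initial measures gives the Lipschitz estimate for W.  Uniqueness follows since
   empirical measures are W-dense among the measures carried by a ball.

   The Lipschitz estimate for calW uses an optimal coupling, obtained as the
   weak limit of almost optimal ones along an ultrafilter: on a coupling of mu
   and nu, |V(x) - V(y)| <= L (|x - y| + \int |x' - y'|). *)

Require Import Defs.
From HB Require Import structures.
From mathcomp Require Import all_boot all_order all_algebra.
From mathcomp Require Import all_classical all_reals all_analysis measurable_realfun.
From mathcomp Require Import finmap ring lra.
Set Implicit Arguments.
Unset Strict Implicit.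
Unset Printing Implicit Defensive.
Import Order.TTheory GRing.Theory Num.Theory.
Import numFieldNormedType.Exports.
Local Open Scope classical_set_scope.
Local Open Scope ring_scope.

(** Limits of couplings are controlled on open sets only, and from one side: the limit measure gives
    an open set at most the limit of its masses. This suffices twice. A probability measure bounded
    by another one on every open set is equal to it, which identifies the marginals; and the
    transport cost is approximated by sums of masses of the open sets [|x - y| > s], which makes it
    lower semicontinuous.

    Time enters through finite expansions with remainder [C * h ^+ 2]. Such remainders add up to
    order h over a partition of step h, so stability and the growth of supports are proved by
    iterating one step, for every label space at once.

    The semigroup is required for every admissible constant of linear growth. The spread of supports
    can therefore not be read off from the bound on phi; it has to be derived from the growth of V
    along the laws of the flow.

    Because phi is bounded, its Lipschitz constant on a ball is valid as soon as one of the two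
    points lies in the ball. *)

Section euclidean_norm.
Variables (R : realType) (n : nat).
Local Notation Rn := 'rV[R]_n.
Implicit Types x y : Rn.

Lemma coord_norm_le x i : `|x ord0 i| <= `|x|.
Proof.
rewrite [leRHS]mx_normrE.
exact: (le_bigmax _ (fun k : 'I_1 * 'I_n => `|x k.1 k.2|) (ord0, i)).
Qed.

Lemma rV_norm_le x (c : R) : 0 <= c -> (forall i, `|x ord0 i| <= c) -> `|x| <= c.
Proof.
move=> c0 xc; rewrite [leLHS]mx_normrE; apply: bigmax_le => // -[i j] _ /=.
by rewrite ord1.
Qed.

Lemma dotvDl x y z : dotv (x + y) z = dotv x z + dotv y z.
Proof. by rewrite -big_split; apply: eq_bigr => i _; rewrite mxE mulrDl. Qed.

Lemma dotvC x y : dotv x y = dotv y x.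
Proof. by apply: eq_bigr => i _; rewrite mulrC. Qed.

Lemma dotvZl (k : R) x y : dotv (k *: x) y = k * dotv x y.
Proof. by rewrite /dotv mulr_sumr; apply: eq_bigr => i _; rewrite mxE mulrA. Qed.

Lemma dotvNl x y : dotv (- x) y = - dotv x y.
Proof. by rewrite -scaleN1r dotvZl mulN1r. Qed.

Lemma dotvv_ge0 x : 0 <= dotv x x.
Proof. by apply: sumr_ge0 => i _; rewrite -expr2 sqr_ge0. Qed.

Lemma enorm_ge0 x : 0 <= enorm x.
Proof. exact: sqrtr_ge0. Qed.

Lemma sqr_enorm x : enorm x ^+ 2 = dotv x x.
Proof. by rewrite sqr_sqrtr// dotvv_ge0. Qed.

Lemma enormZ (k : R) x : enorm (k *: x) = `|k| * enorm x.
Proof.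
by rewrite /enorm dotvZl dotvC dotvZl mulrA -expr2 sqrtrM ?sqr_ge0// sqrtr_sqr.
Qed.

Lemma enorm0 : enorm (0 : Rn) = 0.
Proof. by rewrite -(scale0r 0) enormZ normr0 mul0r. Qed.

Lemma enormN x : enorm (- x) = enorm x.
Proof. by rewrite -scaleN1r enormZ normrN1 mul1r. Qed.

Lemma enorm_distC x y : enorm (x - y) = enorm (y - x).
Proof. by rewrite -opprB enormN. Qed.

Lemma coord_enorm_le x i : `|x ord0 i| <= enorm x.
Proof.
rewrite -(@ler_pXn2r _ 2)// ?nnegrE ?enorm_ge0// sqr_enorm real_normK ?num_real//.
rewrite /dotv (bigD1 i)//= -expr2 lerDl; apply: sumr_ge0 => j _.
by rewrite -expr2 sqr_ge0.
Qed.

Lemma norm_le_enorm x : `|x| <= enorm x.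
Proof. by apply: rV_norm_le (enorm_ge0 x) _ => i; exact: coord_enorm_le. Qed.

Lemma enorm_eq0 x : enorm x = 0 -> x = 0.
Proof.
by move=> x0; apply/eqP; rewrite -normr_le0 -x0 norm_le_enorm.
Qed.

Lemma enorm_le_norm x : enorm x <= n%:R * `|x|.
Proof.
rewrite -(@ler_pXn2r _ 2)// ?nnegrE ?enorm_ge0 ?mulr_ge0// sqr_enorm exprMn.
apply: (@le_trans _ _ (n%:R * `|x| ^+ 2)).
  have -> : n%:R * `|x| ^+ 2 = \sum_(i < n) `|x| ^+ 2.
    by rewrite sumr_const card_ord mulr_natl.
  apply: ler_sum => i _; rewrite -expr2 -real_normK ?num_real//.
  by rewrite lerXn2r ?nnegrE//; exact: coord_norm_le.
(* The factor n is weakened to n squared, so that the constant is n rather than its square root. *)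
rewrite ler_wpM2r ?sqr_ge0// -natrX ler_nat.
by move: (n) => [|k]//; rewrite -mulnn leq_pmulr.
Qed.

(** Cauchy-Schwarz, from the nonnegativity of the square of [enorm y *: x - enorm x *: y]. *)
Lemma dotv_le x y : dotv x y <= enorm x * enorm y.
Proof.
have [/enorm_eq0 ->|x0] := eqVneq (enorm x) 0.
  by rewrite -(scale0r 0) dotvZl mul0r mulr_ge0// enorm_ge0.
have [/enorm_eq0 ->|y0] := eqVneq (enorm y) 0.
  by rewrite dotvC -(scale0r 0) dotvZl mul0r mulr_ge0// enorm_ge0.
have xp : 0 < enorm x by rewrite lt_def x0 enorm_ge0.
have yp : 0 < enorm y by rewrite lt_def y0 enorm_ge0.
have := dotvv_ge0 (enorm y *: x - enorm x *: y).
rewrite dotvDl dotvNl !(dotvC _ (_ - _)) !dotvDl !dotvNl !dotvZl.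
rewrite !(dotvC _ (_ *: _)) !dotvZl -!sqr_enorm (dotvC y x).
have xy := mulr_gt0 xp yp; move: xy; set a := enorm x; set b := enorm y.
move=> ab h; rewrite -(ler_pM2l ab); move: h; nra.
Qed.

Lemma enormD x y : enorm (x + y) <= enorm x + enorm y.
Proof.
rewrite -(@ler_pXn2r _ 2)// ?nnegrE ?addr_ge0 ?enorm_ge0//.
rewrite sqr_enorm dotvDl !(dotvC _ (_ + _)) !dotvDl -!sqr_enorm (dotvC y x).
have := dotv_le x y; rewrite sqrrD; lra.
Qed.

Lemma enorm_continuous : continuous (fun x : Rn => enorm x).
Proof.
move=> x; apply/(@cvgrPdist_lt _ _ _ (nbhs x) (nbhs_filter x)) => e e0.
apply/nbhs_ballP; exists (e / n.+1%:R) => /=; first by rewrite divr_gt0.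
move=> y; rewrite -ball_normE /= ltr_pdivlMr// => xy.
apply: le_lt_trans xy; apply: (@le_trans _ _ (enorm (x - y))).
  have := enormD (x - y) y; have := enormD (y - x) x.
  rewrite !subrK (enorm_distC y x) ler_norml => ? ?; apply/andP; split; lra.
rewrite (le_trans (enorm_le_norm _))// mulrC ler_wpM2l// ler_nat.
exact: leqnSn.
Qed.

Lemma open_eball (r : R) : open (@eball R n r).
Proof.
rewrite (_ : eball r = (fun x : Rn => enorm x) @^-1` [set y | y < r])//.
by apply: open_comp => [x _|]; [exact: enorm_continuous|exact: open_lt].
Qed.

Lemma closed_cball (r : R) : closed [set x : Rn | enorm x <= r].
Proof.
apply: (@closed_comp _ _ (fun x : Rn => enorm x) [set y | y <= r]).
  by move=> x _; exact: enorm_continuous.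
exact: closed_le.
Qed.

Lemma measurable_closed (A : set Rn) : closed A -> measurable A.
Proof.
move=> cA; rewrite -(setCK A); apply: measurableC.
by apply: measurable_open; rewrite openC.
Qed.

End euclidean_norm.

Section law.
Context d d' (X : measurableType d) (Y : measurableType d') (R : realType).

Definition law (P : probability X R) (f : X -> Y) (mf : measurable_fun setT f) :
  probability Y R := distribution P (mfun_Sub (mem_set mf)).

Lemma lawE (P : probability X R) (f : X -> Y) (mf : measurable_fun setT f) A :
  law P mf A = P (f @^-1` A).
Proof. by []. Qed.

Lemma ge0_integral_law (P : probability X R) (f : X -> Y)
    (mf : measurable_fun setT f) (g : Y -> \bar R) : measurable_fun setT g ->
  (forall y, 0 <= g y)%E -> (\int[law P mf]_y g y = \int[P]_x g (f x))%E.
Proof.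
move=> mg g0; rewrite [LHS](@ge0_integral_distribution _ _ _ _ _ _ (mfun_Sub (mem_set mf)))//.
Qed.

End law.

(** * Weak limits of probability measures *)

Section shells.
Variables (R : realType) (n : nat).
Local Notation Rn := 'rV[R]_n.

(** The closed set obtained by shrinking O by d in the sup norm; the whole space does not shrink. *)
Definition inner (O : set Rn) (d : R) : set Rn :=
  [set x | forall y, ~ O y -> d <= `|x - y|].

Lemma closed_inner O d : closed (inner O d).
Proof.
rewrite -openC (_ : ~` inner O d = \bigcup_(y in ~` O) ball y d).
  by apply: bigcup_open => y _; exact: ball_open.
apply/seteqP; split => [x /existsNP[y /not_implyP[Oy /negP]]|x [y Oy xy]].
  by rewrite -ltNge => xy; exists y => //; rewrite -ball_normE /= distrC.
move=> /(_ _ Oy); rewrite leNgt => /negP; apply.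
by move: xy; rewrite -ball_normE /= distrC.
Qed.

Lemma inner_sub O d : 0 < d -> inner O d `<=` O.
Proof.
move=> d0 x Cx; apply: contrapT => /Cx; rewrite subrr normr0 leNgt.
by rewrite d0.
Qed.

Lemma inner_dist O d e x y : inner O (d + e) x -> `|x - y| <= e -> inner O d y.
Proof.
move=> Ox xy z Oz; have := Ox z Oz; have := ler_normD (x - y) (y - z).
by rewrite subrKA; lra.
Qed.

Lemma open_inner O : open O -> O = \bigcup_(i : nat) inner O i.+1%:R^-1.
Proof.
move=> oO; apply/seteqP; split => [x Ox|x [i _]]; last by apply: inner_sub.
have := oO; rewrite openE => /(_ _ Ox)/nbhs_ballP[d /= d0 dO].
have [i id] := ltr_add_invr d0 ; rewrite add0r in id.
exists i => // y Oy; rewrite leNgt; apply/negP => xy; apply: Oy.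
by apply: dO; rewrite -ball_normE /=; exact: lt_trans xy id.
Qed.

(** C i is the shrinking of O by 1 / (i + 1) and U i the interior of C (i + 1). The room between two
    consecutive shrinkings is the difference of their radii, which puts C i inside U i. *)
Lemma open_shells (O : set Rn) : open O -> exists C U : nat -> set Rn,
  [/\ forall i, closed (C i), forall i, open (U i), forall i, C i `<=` U i,
     forall i, U i `<=` C i.+1 & O = \bigcup_i U i].
Proof.
move=> oO; pose C (i : nat) := inner O i.+1%:R^-1.
pose U i := (C i.+1)^°.
have UC i : U i `<=` C i.+1 by exact: interior_subset.
have CU i : C i `<=` U i.
  move=> x Cx; change (nbhs x (C i.+1)); apply/nbhs_ballP.
  exists (i.+1%:R^-1 - i.+2%:R^-1) => /=.
    by rewrite subr_gt0 ltf_pV2 ?posrE// ltr_nat.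
  move=> z; rewrite -ball_normE /= => /ltW; apply: inner_dist.
  by rewrite addrC subrK.
exists C, U; split => //; first by move=> i; exact: closed_inner.
  by move=> i; exact: open_interior.
rewrite {1}(open_inner oO); apply/seteqP; split => x [i _].
  by move=> /CU ?; exists i.
by move=> /UC ?; exists i.+1.
Qed.

End shells.

Lemma le_meas d (X : measurableType d) (R : realType)
    (P : {measure set X -> \bar R}) A B :
  measurable A -> measurable B -> A `<=` B -> (P A <= P B)%E.
Proof. by move=> mA mB; apply: le_measure; exact: mem_set. Qed.

(* A limit m of measures along an ultrafilter is only finitely additive.  The
   outer measure generated by its values on open sets is a measure below m on
   open sets, and compactness of K keeps its total mass equal to 1. *)
Section measure_below_content.
Variables (R : realType) (N : nat).
Local Notation Z := 'rV[R]_N.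
Variables (m : set Z -> R) (K : set Z).
Hypothesis m_ge0 : forall A, 0 <= m A.
Hypothesis m_set0 : m set0 = 0.
Hypothesis m_setU : forall A B, measurable A -> measurable B -> A `&` B = set0 ->
  m (A `|` B) = m A + m B.
Hypothesis m_setT : m setT = 1.
Hypothesis cK : compact K.
Hypothesis mK : m K = 1.

Let le_m A B : measurable A -> measurable B -> A `<=` B -> m A <= m B.
Proof.
move=> mA mB AB; rewrite -(setDUK AB) m_setU ?lerDl//; first exact: measurableD.
by rewrite setDE setICA setICr setI0.
Qed.

Let m_setU_le A B : measurable A -> measurable B -> m (A `|` B) <= m A + m B.
Proof.
move=> mA mB; have mBA : measurable (B `\` A) by exact: measurableD.
have -> : A `|` B = A `|` (B `\` A).
  apply/seteqP; split => x [Ax|Bx]; try by left.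
    by have [Ax|Ax] := pselect (A x); [left|right].
  by right; case: Bx.
rewrite m_setU ?setDIK// lerD2l; exact: le_m.
Qed.

Let m_bigU_le (A : nat -> set Z) n : (forall k, measurable (A k)) ->
  m (\big[setU/set0]_(k < n) A k) <= \sum_(k < n) m (A k).
Proof.
move=> mA; elim: n => [|n ih]; first by rewrite !big_ord0 m_set0.
rewrite !big_ord_recr /= (le_trans (m_setU_le _ _))// ?lerD2r//.
exact: bigsetU_measurable.
Qed.

(** The value +oo off the open sets leaves only open covers to compete in the outer measure. *)
Let open_weight (A : set Z) : \bar R := if `[<open A>] then (m A)%:E else +oo%E.

Let open_weight_ge0 A : (0 <= open_weight A)%E.
Proof. by rewrite /open_weight; case: ifP => // _; rewrite ?lee_fin// leey. Qed.

Let open_weightE A : open A -> open_weight A = (m A)%:E.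
Proof. by move=> oA; rewrite /open_weight ifT//; apply/asboolP. Qed.

Let open_weight0 : open_weight set0 = 0%E.
Proof. by rewrite open_weightE ?m_set0//; exact: open0. Qed.

Let outer : set Z -> \bar R := mu_ext open_weight.

HB.instance Definition _ := isOuterMeasure.Build R Z outer
  (@mu_ext0 _ _ _ _ open_weight0 open_weight_ge0)
  (mu_ext_ge0 open_weight_ge0)
  (le_mu_ext open_weight)
  (mu_ext_sigma_subadditive open_weight_ge0).

Let outer_open_le G : open G -> (outer G <= (m G)%:E)%E.
Proof.
move=> oG; apply: ereal_inf_lbound.
exists (fun k : nat => (if k is 0 then G else set0) : set Z).
  split; first by case=> [|k]; [exact: measurable_open|exact: measurable0].
  by move=> x Gx; exists 0%N.
rewrite nneseries_recl// open_weightE// eseries0 ?adde0// => -[|i]// _ _.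
Qed.

Let outer_setT_ge1 : (1 <= outer setT)%E.
Proof.
apply: le_ereal_inf_tmp => _ [A [mA TA] <-].
have [[k nok]|] := pselect (exists k, ~ open (A k)).
  rewrite (@eseries_pinfty _ _ _ k) ?leey//.
    by move=> n _; rewrite gt_eqF// (lt_le_trans _ (open_weight_ge0 _)).
  by rewrite /open_weight; case: asboolP.
move=> /forallNP oA; have {}oA k : open (A k) by apply: contrapT (oA k).
have := cK; rewrite compact_cover => cK'.
have [x Kx|D _ KD] := cK' nat setT A (fun i _ => oA i).
  by have [k _ Akx] := TA x I; exists k.
(* Compactness of K selects finitely many members of the cover, all of index below n; finite
   subadditivity of m then applies. *)
pose n := (\max_(i <- D) i).+1.
have DA : K `<=` \big[setU/set0]_(k < n) A k.
  move=> x /KD[k /= kD Akx]; rewrite -bigcup_mkord; exists k => //=.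
  by rewrite /n ltnS; apply: leq_bigmax_seq.
apply: le_trans (nneseries_lim_ge n _) => //.
rewrite big_mkord (eq_bigr (fun k : 'I_n => (m (A k))%:E)); last first.
  by move=> i _; rewrite open_weightE.
rewrite sumEFin lee_fin; apply: le_trans (m_bigU_le _ mA).
have oU : open (\big[setU/set0]_(k < n) A k).
  by rewrite -bigcup_mkord; apply: bigcup_open => k _; exact: oA.
rewrite -mK; apply: le_m => //; last exact: measurable_open.
rewrite -(setCK K); apply: measurableC; apply: measurable_open.
by rewrite openC; exact: compact_closed.
Qed.

(** A finitely additive m could lose control of infinitely many pieces. Here O is covered by one set
    U (j + 1) and by open rings whose masses are bounded by increments of the bounded increasing
    sequence [a i = m (U i)]; together the rings weigh at most 2 (lim a - a j). *)
Lemma outer_inner_regular (O : set Z) (e : R) : open O -> 0 < e ->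
  exists C, [/\ closed C, C `<=` O & (outer O <= (m C + e)%:E)%E].
Proof.
move=> oO e0.
have [C [U [cC oU CU UC ->]]] := open_shells oO.
have mU i : measurable (U i) by exact: measurable_open.
have mC i : measurable (C i).
  by rewrite -(setCK (C i)); apply: measurableC; apply: measurable_open; rewrite openC.
pose a i := m (U i).
have aS i : a i <= a i.+1.
  by apply: le_m => //; exact: subset_trans (UC _) (CU _).
have a1 i : a i <= 1 by rewrite -m_setT; apply: le_m.
have acvg : cvgn a.
  apply: nondecreasing_is_cvgn; first by apply/nondecreasing_seqP.
  by exists 1 => _ [i _ <-].
have ale i : a i <= limn a.
  by apply: nondecreasing_cvgn_le => //; apply/nondecreasing_seqP.
have [j aj] : exists j, limn a - e / 2 < a j.
  have /cvgrPdist_lt/(_ (e / 2)) := acvg; rewrite divr_gt0// => /(_ isT)[j _ /(_ j)].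
  move=> /(_ (leqnn _)) /= h; exists j; move: h; rewrite ltr_norml; lra.
(* Consecutive rings overlap: this lets them be open and still cover what U (j + 1) misses. The
   price is a telescoping by two, hence the factor 2 below. *)
pose S i := U (i + j).+2 `\` C (i + j).+1.
have oS i : open (S i) by apply: openI => //; rewrite openC.
have mS i : m (S i) <= a (i + j).+2 - a (i + j)%N.
  have := @m_setU (C (i + j).+1) (S i) (mC _) (measurable_open (oS _)).
  rewrite setDIK => /(_ erefl); rewrite setDUK; last by move=> x /CU/UC/CU.
  have : a (i + j)%N <= m (C (i + j).+1) by apply: le_m.
  rewrite /a /=; lra.
have OS : \bigcup_i U i `<=` U j.+1 `|` \bigcup_i S i.
  move=> x [i _ Ui].
  elim: i Ui => [|i ih] Ui.
    by left; elim: (j.+1) => //k /UC/CU.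
  have [Ui'|Ui'] := pselect (U i x); first exact: ih.
  have [ij|ij] := leqP i.+1 j.+1.
    left; move: ij Ui => /subnK <-.
    by elim: (j.+1 - i.+1)%N => //k hk /hk; rewrite addSn => /UC/CU.
  right; exists (i - j.+1)%N => //; rewrite /S -addnS subnK//.
  by split => // Cx; apply: Ui'; exact: CU.
exists (C j.+2); split => //; first by move=> x /CU Ux; exists j.+2.
apply: (le_trans (le_outer_measure outer _ _ OS)).
apply: (le_trans (outer_measureU2 outer _ _)).
apply: (@le_trans _ _ ((a j.+1)%:E + (2 * (limn a - a j))%:E)%E); last first.
  rewrite -EFinD lee_fin lerD//; first exact: le_m.
  lra.
apply: leeD; first exact: outer_open_le.
apply: (le_trans (outer_measure_sigma_subadditive outer _)).
apply: (@le_trans _ _ (\sum_(0 <= i <oo) (a (i + j).+2 - a (i + j)%N)%:E)%E).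
  apply: lee_nneseries => // i _.
  by apply: le_trans (outer_open_le (oS i)) _; rewrite lee_fin.
apply: lime_le.
  apply: is_cvg_nneseries => i _ _; rewrite lee_fin subr_ge0.
  exact: le_trans (aS _) (aS _).
near=> n; rewrite sumEFin lee_fin big_mkord.
have -> : \sum_(i < n) (a (i + j).+2 - a (i + j)%N) =
   a (n + j).+1 + a (n + j)%N - a j.+1 - a j.
  elim: (n) => [|k ih]; first by rewrite big_ord0 !add0n; lra.
  by rewrite big_ord_recr /= ih !addSn; lra.
have := aS j; have := ale (n + j).+1; have := ale (n + j)%N; lra.
Unshelve. all: by end_near. Qed.

(** A closed C inside G and O carries all of the outer measure of their intersection up to e, while
    [G \ C] is open and contains [G \ O]; additivity of m on C and [G \ C] concludes. *)
Let outer_split G O : open G -> open O ->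
  (outer (G `&` O) + outer (G `\` O) <= (m G)%:E)%E.
Proof.
move=> oG oO; apply/lee_addgt0Pr => e e0.
have [C [cC CGO GOC]] := outer_inner_regular (openI oG oO) e0.
have oGC : open (G `\` C) by apply: openI => //; rewrite openC.
have mC : measurable C.
  by rewrite -(setCK C); apply: measurableC; apply: measurable_open; rewrite openC.
have <- : m C + m (G `\` C) = m G.
  rewrite -m_setU//; [|exact: measurable_open|exact: setDIK].
  by rewrite setDUK// => x /CGO[].
have GOGC : (outer (G `\` O) <= (m (G `\` C))%:E)%E.
  apply: le_trans (outer_open_le oGC); apply: (le_outer_measure outer).
  by move=> x [Gx Ox]; split => // /CGO[].
apply: le_trans (leeD GOC GOGC) _.
by rewrite -!EFinD lee_fin addrAC.
Qed.

(** An arbitrary test set is replaced by an open cover of it, each member of which is split by the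
    previous inequality. *)
Let open_caratheodory O : open O -> (outer : set Z -> \bar R).-caratheodory O.
Proof.
move=> oO; apply: le_caratheodory_measurable => X.
apply: le_ereal_inf_tmp => _ [A [mA XA] <-].
have [[k nok]|] := pselect (exists k, ~ open (A k)).
  rewrite (@eseries_pinfty _ _ _ k) ?leey//.
    by move=> n _; rewrite gt_eqF// (lt_le_trans _ (open_weight_ge0 _)).
  by rewrite /open_weight; case: asboolP.
move=> /forallNP oA; have {}oA k : open (A k) by apply: contrapT (oA k).
apply: (@le_trans _ _ (\sum_(0 <= k <oo) (outer (A k `&` O) + outer (A k `\` O)))%E).
  rewrite nneseriesD; [|by move=> *; exact: outer_measure_ge0..].
  apply: leeD.
    apply: le_trans (outer_measure_sigma_subadditive outer _).
    by apply: le_outer_measure; rewrite -setI_bigcupl; exact: setSI.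
  apply: le_trans (outer_measure_sigma_subadditive outer _).
  by apply: le_outer_measure; rewrite -setI_bigcupl; exact: setSI.
apply: lee_nneseries => [i _ _|i _].
  by apply: adde_ge0; exact: outer_measure_ge0.
by rewrite open_weightE//; exact: outer_split.
Qed.

Let measurable_caratheodory A : measurable A -> (outer : set Z -> \bar R).-caratheodory A.
Proof.
apply: (@smallest_sub _ _ open (outer.-caratheodory)) => //; split.
- exact: (caratheodory_measurable_set0 outer).
- by move=> B mB; rewrite setTD; exact: (caratheodory_measurable_setC (mu := outer)).
- by move=> B mB; exact: (caratheodory_measurable_bigcup (mu := outer)).
Qed.

Let mu (A : set Z) : \bar R := outer A.

Let mu0 : mu set0 = 0%E. Proof. exact: outer_measure0. Qed.

Let mu_ge0 A : (0 <= mu A)%E. Proof. exact: outer_measure_ge0. Qed.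

Let mu_sigma_additive : semi_sigma_additive mu.
Proof.
move=> A mA tA mUA; apply: (caratheodory_measure_sigma_additive (mu := outer)) => //.
  by move=> i; exact: measurable_caratheodory.
exact: measurable_caratheodory.
Qed.

HB.instance Definition _ := isMeasure.Build _ _ _ mu mu0 mu_ge0 mu_sigma_additive.

Let mu_setT : mu setT = 1%E.
Proof.
apply/eqP; rewrite eq_le outer_setT_ge1 andbT -m_setT.
by apply: outer_open_le; exact: openT.
Qed.

HB.instance Definition _ := Measure_isProbability.Build _ _ _ mu mu_setT.

Lemma measure_below_content :
  exists nu : probability Z R, forall G, open G -> (nu G <= (m G)%:E)%E.
Proof. by exists mu => G oG; exact: outer_open_le. Qed.

End measure_below_content.

Section ultrafilter_limit.
Variables (R : realType) (N : nat).
Local Notation Z := 'rV[R]_N.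

(** Compactness of the segment gives a limit to an ultrafilter G refining the image of F. No
    neighbourhood is lost by the refinement: F contains the preimage of a set or that of its
    complement, and G cannot contain both sets. *)
Lemma ultra_bounded_cvg (F : set_system nat) (u : nat -> R) (a b : R) :
  UltraFilter F -> (forall k, a <= u k <= b) -> exists l : R, u @ F --> l.
Proof.
move=> UF uab.
have [G [UG uG]] := ultraFilterLemma (@fmap_proper_filter _ _ u F ultra_proper).
have /= := @segment_compact R a b; rewrite compact_ultra => /(_ _ UG)[].
  apply: uG; rewrite /fmap /=.
  have PF : ProperFilter F by exact: ultra_proper.
  by apply: filterE => k /=; rewrite in_itv /= uab.
move=> l [_ Gl]; exists l => A /Gl GA.
have [//|] := in_ultra_setVsetC (u @^-1` A) UF.
rewrite preimage_setC => /uG GCA.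
have PG : ProperFilter G by exact: ultra_proper.
have G0 : G set0 by rewrite -(setICr A); exact: (@filterI R G _ A (~` A) GA GCA).
by have := filter_not_empty G G0.
Qed.

(** Along an ultrafilter the masses of all measurable sets converge simultaneously, without
    extraction. The inclusion of [\oo] in F keeps every eventual statement usable in the limit. *)
Lemma weak_limit (P : nat -> probability Z R) (K : set Z) :
  compact K -> (forall k, P k K = 1%E) ->
  exists (F : set_system nat) (nu : probability Z R), [/\ ProperFilter F,
    \oo `<=` F & forall G, open G ->
    exists l : R, fine (P k G) @[k --> F] --> l /\ (nu G <= l%:E)%E].
Proof.
move=> cK PK.
have [F [UF ooF]] := ultraFilterLemma eventually_filter.
have PF : ProperFilter F by exact: ultra_proper.
have fin k A : measurable A -> P k A = (fine (P k A))%:E.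
  by move=> mA; rewrite fineK// fin_num_measure.
have cvgP A : exists l : R, measurable A -> fine (P k A) @[k --> F] --> l.
  have [mA|nmA] := pselect (measurable A); last by exists 0.
  have [k|l Pl] := @ultra_bounded_cvg F (fun k => fine (P k A)) 0 1 UF.
    by rewrite fine_ge0//= -lee_fin -fin// probability_le1.
  by exists l.
have lim_eq (f : nat -> R) (a b : R) : f @ F --> a -> f @ F --> b -> a = b.
  by move=> fa fb; rewrite -(cvg_lim _ fa)// -(cvg_lim _ fb).
(* Nonnegativity of m is required on all sets, hence the default 0. *)
pose m A := if `[<measurable A>] then sval (cid (cvgP A)) else 0.
have mP A : measurable A -> fine (P k A) @[k --> F] --> m A.
  by move=> mA; rewrite /m ifT; [case: cid => l /= /(_ mA)|exact/asboolP].
have mK : measurable K.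
  by rewrite -(setCK K); apply: measurableC; apply: measurable_open;
    rewrite openC; exact: compact_closed.
have [||||||nu nuP] := @measure_below_content R N m K.
- move=> A; have [mA|nmA] := pselect (measurable A); last first.
    by rewrite /m ifF//; exact/asboolP.
  by apply: (cvgr_to_ge (mP _ mA)); apply: nearW => k; exact: fine_ge0.
- apply: (lim_eq _ _ _ (mP _ measurable0)).
  rewrite (_ : (fun k => _) = cst 0); first exact: cvg_cst.
  by apply/funext => k /=; rewrite measure0.
- move=> A B mA mB AB; apply: (lim_eq _ _ _ (mP _ (measurableU _ _ mA mB))).
  rewrite (_ : (fun k => _) = (fun k => fine (P k A) + fine (P k B))).
    by apply: cvgD; exact: mP.
  by apply/funext => k /=; rewrite measureU// fineD// fin_num_measure.
- apply: (lim_eq _ _ _ (mP _ measurableT)).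
  rewrite (_ : (fun k => _) = cst 1); first exact: cvg_cst.
  by apply/funext => k /=; rewrite probability_setT.
- exact: cK.
- apply: (lim_eq _ _ _ (mP _ mK)).
  rewrite (_ : (fun k => _) = cst 1); first exact: cvg_cst.
  by apply/funext => k /=; rewrite PK.
exists F, nu; split => // G oG; exists (m G); split; last exact: nuP.
by apply: mP; exact: measurable_open.
Qed.

End ultrafilter_limit.

(** * Supports, and equality of measures tested on open sets *)

Section supports.
Variables (R : realType) (n : nat).
Local Notation Rn := 'rV[R]_n.
Implicit Types P Q : probability Rn R.

Lemma rV_rat_base (A : set Rn) (x : Rn) : open A -> A x ->
  exists (c : 'rV[rat]_n) (q : rat),
    ball (map_mx ratr c : Rn) (ratr q) x /\ ball (map_mx ratr c : Rn) (ratr q) `<=` A.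
Proof.
rewrite openE => oA Ax; have /nbhs_ballP[e /= e0 eA] := oA _ Ax.
have [q /andP[q0 qe]] : exists q : rat, 0 < (ratr q : R) < e / 2.
  have /rat_in_itvoo[q] : 0 < e / 2 by rewrite divr_gt0.
  by rewrite in_itv /= => qe; exists q.
have cP i : exists c : rat, `|ratr c - x ord0 i| < ratr q.
  have /rat_in_itvoo[c] : x ord0 i - ratr q < x ord0 i + ratr q.
    by rewrite ltrD2l (lt_trans _ q0)// oppr_lt0.
  by rewrite in_itv /= -ltr_distl => cq; exists c.
pose c := \row_i sval (cid (cP i)).
have cx : ball (map_mx ratr c : Rn) (ratr q) x.
  by split => // i j; rewrite ord1 !mxE; case: cid.
exists c, q; split => // y cy; apply: eA.
apply: (@le_ball _ _ _ (ratr q + ratr q)); first lra.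
by apply: ball_triangle cy; exact: ball_sym.
Qed.

(** A point off the support has a null open neighbourhood, hence lies in a null ball with rational
    centre and radius. There are countably many such balls, so the complement of A is null. *)
Lemma supp_full P (A : set Rn) : measurable A -> supp P `<=` A -> P A = 1%E.
Proof.
move=> mA PA.
pose B (cq : 'rV[rat]_n * rat) : set Rn := ball (map_mx ratr cq.1 : Rn) (ratr cq.2).
have oB cq : open (B cq) by exact: ball_open.
pose F (k : nat) : set Rn := if (choice.unpickle k : option ('rV[rat]_n * rat)) is Some cq then
  if P (B cq) == 0%E then B cq else set0 else set0.
have mF k : measurable (F k).
  by rewrite /F; case: choice.unpickle => // cq; case: ifP => // _; exact: measurable_open.
have F0 k : P (F k) = 0%E.
  by rewrite /F; case: choice.unpickle => [cq|]; [case: ifP => [/eqP//|_]|]; rewrite measure0.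
have mbF : measurable (\bigcup_k F k) by apply: bigcup_measurable.
have PF : P (\bigcup_k F k) = 0%E.
  apply: measure_negligible => //; apply: negligible_bigcup => k.
  exact: (ex_intro _ (F k) (And3 (mF k) (F0 k) (fun x h => h))).
have AF : ~` A `<=` \bigcup_k F k.
  move=> x Ax; have /existsNP[U /not_implyP[oU /not_implyP[Ux /negP PU]]] :
    ~ supp P x by move=> /PA.
  have [c [q [cx cU]]] := rV_rat_base oU Ux.
  exists (choice.pickle (c, q)) => //; rewrite /F choice.pickleK ifT//.
  rewrite eq_le measure_ge0 andbT; rewrite -leNgt in PU.
  apply: le_trans PU.
 by apply: le_meas cU; [exact: (measurable_open (oB (c, q)))|exact: measurable_open].
have PA0 : P (~` A) = 0%E.
  apply/eqP; rewrite eq_le measure_ge0 andbT -PF.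
  by apply: le_meas AF => //; exact: measurableC.
by have := probability_setC P mA; rewrite PA0 => /esym/eqP; rewrite sube_eq ?add0e// => /eqP.
Qed.

Lemma closed_supp P : closed (supp P).
Proof.
rewrite -openC (_ : ~` supp P = \bigcup_(U in [set U | open U /\ ~ (0 < P U)%E]) U).
  by apply: bigcup_open => U [].
apply/seteqP; split => [x /existsNP[U /not_implyP[oU /not_implyP[Ux PU]]]|x [U [oU PU] Ux]].
  by exists U.
by move=> /(_ U oU Ux).
Qed.

Lemma supp_sub P (F : set Rn) : closed F -> P F = 1%E -> supp P `<=` F.
Proof.
move=> cF PF x Px; apply: contrapT => Fx.
have := Px (~` F); rewrite openC => /(_ cF Fx).
by rewrite probability_setC ?PF ?subee ?ltxx//; exact: measurable_closed.
Qed.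

(** Complementation reverses the inequality on closed sets, and the closed shells of an open set
    carry the reversed inequality back to it. Equality on open sets extends to Borel sets since they
    are stable under intersection. *)
Lemma eq_meas_open P Q : (forall G, open G -> (P G <= Q G)%E) -> eq_meas P Q.
Proof.
move=> PQ.
have cle F : closed F -> (Q F <= P F)%E.
  move=> cF; have mF := measurable_closed cF.
  have := PQ (~` F); rewrite openC => /(_ cF); rewrite !probability_setC//.
  have fP : P F \is a fin_num by exact: fin_num_measure.
  have fQ : Q F \is a fin_num by exact: fin_num_measure.
  by rewrite -(fineK fP) -(fineK fQ) -!EFinB !lee_fin lerD2l lerN2.
have oeq G : open G -> P G = Q G.
  move=> oG; apply/eqP; rewrite eq_le PQ//=.
  have [C [U [cC oU CU UC GU]]] := open_shells oG.
  have mU i : measurable (U i) by exact: measurable_open.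
  have : Q (U i) @[i --> \oo] --> Q G.
    rewrite GU; apply: nondecreasing_cvg_mu => //; first exact: bigcup_measurable.
    by apply/nondecreasing_seqP => i; apply/subsetPset => x /UC/CU.
  move=> /cvg_lim <-//; apply: lime_le.
    apply: ereal_nondecreasing_is_cvgn; apply/nondecreasing_seqP => i.
    by apply: le_meas => // x /UC/CU.
  apply: nearW => i; apply: (@le_trans _ _ (Q (C i.+1))).
    by apply: le_meas => //; exact: measurable_closed.
  apply: (le_trans (cle _ (cC _))).
  apply: le_meas; [exact: measurable_closed|exact: measurable_open|].
  by move=> x /CU Ux; rewrite GU; exists i.+1.
move=> A mA; apply: (@measure_unique _ R Rn (@open Rn) (fun=> setT)) => //.
- by move=> B C; exact: openI.
- by move=> k; exact: openT.
- by rewrite bigcup_const.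
- by move=> k; rewrite [ltLHS]probability_setT ltry.
Qed.

End supports.

(** * Integrals of bounded measurable functions *)

Section bounded_integral.
Context d (X : measurableType d) (R : realType).
Variable P : probability X R.
Implicit Types f g : X -> R.

(** A class stable under the operations used below and integrable for every probability measure, so
    that integrability never has to be rechecked when the measure changes. *)
Definition bounded_measurable f :=
  measurable_fun setT f /\ exists c : R, forall x, `|f x| <= c.

Lemma bounded_measurable_integrable f :
  bounded_measurable f -> P.-integrable setT (EFin \o f).
Proof.
move=> [mf [c fc]]; apply: (@le_integrable _ _ _ _ setT measurableT _ (EFin \o cst `|c|)) => //.
- exact/measurable_EFinP.
- move=> x _ /=; rewrite lee_fin (le_trans (fc x))// normr_id ler_norm//.
- exact: (@finite_measure_integrable_cst _ _ _ P setT `|c| measurableT).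
Qed.

Lemma bounded_measurableD f g : bounded_measurable f -> bounded_measurable g ->
  bounded_measurable (fun x => f x + g x).
Proof.
move=> [mf [c fc]] [mg [e ge]]; split; first exact: measurable_funD.
exists (c + e) => x; rewrite (le_trans (ler_normD _ _))// lerD//.
Qed.

Lemma bounded_measurableZ (k : R) f : bounded_measurable f ->
  bounded_measurable (fun x => k * f x).
Proof.
move=> [mf [c fc]]; split; first exact: measurable_funM.
by exists (`|k| * c) => x; rewrite normrM ler_wpM2l.
Qed.

Lemma bounded_measurableB f g : bounded_measurable f -> bounded_measurable g ->
  bounded_measurable (fun x => f x - g x).
Proof.
move=> bf [mg [c gc]]; apply: bounded_measurableD => //; split.
  exact: measurableT_comp.
by exists c => x; rewrite normrN.
Qed.

Lemma bounded_measurable_cst (c : R) : bounded_measurable (fun=> c).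
Proof. by split; [exact: measurable_cst|exists `|c|]. Qed.

Lemma bounded_measurable_norm f : bounded_measurable f ->
  bounded_measurable (fun x => `|f x|).
Proof.
move=> [mf [c fc]]; split; first exact: measurableT_comp.
by exists c => x; rewrite normr_id.
Qed.

Lemma bounded_measurable_sum (I : Type) (s : seq I) (F : I -> X -> R) :
  (forall i, bounded_measurable (F i)) ->
  bounded_measurable (fun x => \sum_(i <- s) F i x).
Proof.
move=> bF; elim: s => [|i s ih].
  rewrite (_ : (fun _ => _) = fun=> 0); first exact: bounded_measurable_cst.
  by apply/funext => x; rewrite big_nil.
rewrite (_ : (fun _ => _) = fun x => F i x + \sum_(i <- s) F i x).
  exact: bounded_measurableD.
by apply/funext => x; rewrite big_cons.
Qed.

Lemma bounded_RintegralD f g : bounded_measurable f -> bounded_measurable g ->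
  \int[P]_x (f x + g x) = \int[P]_x f x + \int[P]_x g x.
Proof. by move=> bf bg; rewrite RintegralD//; exact: bounded_measurable_integrable. Qed.

Lemma bounded_RintegralB f g : bounded_measurable f -> bounded_measurable g ->
  \int[P]_x (f x - g x) = \int[P]_x f x - \int[P]_x g x.
Proof. by move=> bf bg; rewrite RintegralB//; exact: bounded_measurable_integrable. Qed.

Lemma bounded_RintegralZ (k : R) f : bounded_measurable f ->
  \int[P]_x (k * f x) = k * \int[P]_x f x.
Proof. by move=> bf; rewrite RintegralZl//; exact: bounded_measurable_integrable. Qed.

Lemma Rintegral_prob_cst (c : R) : \int[P]_x c = c.
Proof.
rewrite Rintegral_cst// (_ : fine _ = 1) ?mulr1//.
exact: (congr1 fine (@probability_setT _ _ _ P)).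
Qed.

Lemma bounded_Rintegral_sum (I : Type) (s : seq I) (F : I -> X -> R) :
  (forall i, bounded_measurable (F i)) ->
  \int[P]_x (\sum_(i <- s) F i x) = \sum_(i <- s) \int[P]_x F i x.
Proof.
move=> bF; elim: s => [|i s ih].
  rewrite big_nil -[RHS]Rintegral_prob_cst.
  by apply: eq_Rintegral => x _; rewrite big_nil.
rewrite big_cons -ih -bounded_RintegralD//; last exact: bounded_measurable_sum.
by apply: eq_Rintegral => x _; rewrite big_cons.
Qed.

Lemma bounded_le_Rintegral f g : bounded_measurable f -> bounded_measurable g ->
  (forall x, f x <= g x) -> \int[P]_x f x <= \int[P]_x g x.
Proof.
move=> bf bg fg; apply: le_Rintegral => //; exact: bounded_measurable_integrable.
Qed.

Lemma bounded_norm_Rintegral f : bounded_measurable f ->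
  `|\int[P]_x f x| <= \int[P]_x `|f x|.
Proof.
by move=> bf; apply: le_normr_Rintegral => //; exact: bounded_measurable_integrable.
Qed.

Lemma norm_Rintegral_le f (c : R) : bounded_measurable f ->
  (forall x, `|f x| <= c) -> `|\int[P]_x f x| <= c.
Proof.
move=> bf fc; apply: le_trans (bounded_norm_Rintegral bf) _.
rewrite -[leRHS]Rintegral_prob_cst; apply: bounded_le_Rintegral => //.
- exact: bounded_measurable_norm.
- exact: bounded_measurable_cst.
Qed.

Lemma bounded_EFin_Rintegral f : bounded_measurable f ->
  (\int[P]_x (f x)%:E)%E = (\int[P]_x f x)%:E.
Proof.
move=> bf; rewrite fineK//; apply: integrable_fin_num => //.
exact: bounded_measurable_integrable.
Qed.

Lemma bounded_measurable_indic (A : set X) : measurable A ->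
  bounded_measurable (\1_A : X -> R).
Proof.
move=> mA; split; first exact: measurable_indic.
exists 1 => x; rewrite indicE; case: (_ \in _); rewrite ?normr1 ?normr0//.
Qed.

Lemma Rintegral_prob_indic (A : set X) : measurable A ->
  \int[P]_x \1_A x = fine (P A).
Proof. by move=> mA; rewrite /Rintegral integral_indic// setIT. Qed.

End bounded_integral.

Lemma bounded_Rintegral_law d d' (X : measurableType d) (Y : measurableType d')
    (R : realType) (P : probability X R) (f : X -> Y) (mf : measurable_fun setT f)
    (g : Y -> R) : bounded_measurable g ->
  \int[law P mf]_y g y = \int[P]_x g (f x).
Proof.
move=> bg; congr fine.
have [mg [c gc]] := bg.
rewrite [LHS](@integral_distribution _ _ _ _ _ _ (mfun_Sub (mem_set mf)))//.
  exact/measurable_EFinP.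
apply: bounded_measurable_integrable; split; last by exists c.
exact: measurableT_comp mf.
Qed.

Section row_measurability.
Context d (X : measurableType d) (R : realType).

Lemma measurable_row_coord n (f : X -> 'rV[R]_n) i : measurable_fun setT f ->
  measurable_fun setT (fun x => f x ord0 i).
Proof. by move=> mf; exact: (measurableT_comp (measurable_coord i) mf). Qed.

Lemma measurable_rowD n (f g : X -> 'rV[R]_n) : measurable_fun setT f ->
  measurable_fun setT g -> measurable_fun setT (fun x => f x + g x).
Proof.
move=> mf mg; apply: measurable_fun_row => i.
rewrite (_ : (fun _ => _) = (fun x => f x ord0 i + g x ord0 i)).
  by apply: measurable_funD; exact: measurable_row_coord.
by apply/funext => x; rewrite mxE.
Qed.

Lemma measurable_rowZ n (k : R) (f : X -> 'rV[R]_n) : measurable_fun setT f ->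
  measurable_fun setT (fun x => k *: f x).
Proof.
move=> mf; apply: measurable_fun_row => i.
rewrite (_ : (fun _ => _) = (fun x => k * f x ord0 i)).
  by apply: measurable_funM => //; exact: measurable_row_coord.
by apply/funext => x; rewrite mxE.
Qed.

Lemma measurable_rowB n (f g : X -> 'rV[R]_n) : measurable_fun setT f ->
  measurable_fun setT g -> measurable_fun setT (fun x => f x - g x).
Proof.
move=> mf mg; apply: measurable_rowD => //.
rewrite (_ : (fun _ => _) = (fun x => -1 *: g x)); first exact: measurable_rowZ.
by apply/funext => x; rewrite scaleN1r.
Qed.

Lemma continuous_measurable_real n (f : 'rV[R]_n -> R) :
  continuous f -> measurable_fun setT f.
Proof.
move=> cf; apply: (measurability _ (RGenOpens.measurableE R)) => _ [_ [a [b ->]] <-].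
rewrite setTI; apply: measurable_open.
by apply: open_comp => [v _|]; [exact: cf|exact: interval_open].
Qed.

Lemma measurable_enorm n (f : X -> 'rV[R]_n) : measurable_fun setT f ->
  measurable_fun setT (fun x => enorm (f x)).
Proof.
move=> mf; apply: (measurableT_comp _ mf); apply: continuous_measurable_real.
exact: enorm_continuous.
Qed.

End row_measurability.

Lemma lipschitz_continuous (R : realType) m n (f : 'rV[R]_m -> 'rV[R]_n) (c : R) :
  (forall x y, `|f x - f y| <= c * `|x - y|) -> continuous f.
Proof.
move=> fc x; apply/(@cvgrPdist_lt _ _ _ (nbhs x) (nbhs_filter x)) => e e0.
apply/nbhs_ballP; exists (e / (`|c| + 1)) => /=.
  by rewrite divr_gt0// ltr_wpDl.
move=> y; rewrite -ball_normE /= ltr_pdivlMr ?ltr_wpDl// => xy.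
apply: le_lt_trans (fc _ _) _; apply: le_lt_trans xy.
rewrite mulrC ler_wpM2l// (le_trans (ler_norm c))// lerDl//.
Qed.

(** * Optimal couplings *)

Section layers.
Variable R : realType.
Implicit Types c h : R.

(* Lower and upper sums of the layer-cake formula c = \int_0^oo 1_(s < c) ds:
   they express transport costs by the masses of open sets, which are what a
   weak limit controls. *)
Lemma layers_le c h M : 0 <= h -> 0 <= c ->
  h * (\sum_(i < M) (h * i.+1%:R < c)%R%:R) <= c.
Proof.
(* The second bound closes the induction: when the next layer counts, h * M + h is still below c. *)
move=> h0 c0; suff /andP[] : (h * (\sum_(i < M) (h * i.+1%:R < c)%R%:R) <= c) &&
  (h * (\sum_(i < M) (h * i.+1%:R < c)%R%:R) <= h * M%:R) by [].
elim: M => [|M /andP[ih1 ih2]]; first by rewrite big_ord0 !mulr0 c0 lexx.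
rewrite big_ord_recr /= mulrDr; case: ltP => [hc|_]; last first.
  rewrite mulr0 addr0 ih1 /= (le_trans ih2)// ler_wpM2l// ler_nat//.
have e : h * M%:R + h = h * M.+1%:R by rewrite -[M.+1]addn1 natrD mulrDr mulr1.
rewrite -e in hc *; rewrite mulr1; apply/andP; split; lra.
Qed.

Lemma layers_ge c h M : 0 <= h -> c <= h * M.+1%:R ->
  c <= h + h * (\sum_(i < M) (h * i.+1%:R < c)%R%:R).
Proof.
(* Truncating c at the top layer makes the statement inductive in M; the assumption on c removes the
   truncation. *)
move=> h0; suff : Num.min c (h * M.+1%:R) <= h + h * (\sum_(i < M) (h * i.+1%:R < c)%R%:R).
  by move=> + cM; rewrite (min_idPl cM).
elim: M => [|M ih]; first by rewrite big_ord0 mulr0 addr0 mulr1 ge_min lexx orbT.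
have e : h * M.+2%:R = h * M.+1%:R + h by rewrite -[M.+2]addn1 natrD mulrDr mulr1.
rewrite big_ord_recr /= e; move: ih; set S := \sum_(_ < _) _.
rewrite [h * (S + _)]mulrDr; case: ltP => [hc|ch] ih.
  by rewrite mulr1 ge_min; apply/orP; right; lra.
by rewrite mulr0 addr0 ge_min ih.
Qed.

End layers.

Section optimal_coupling.
Variables (R : realType) (n : nat).
Local Notation Rn := 'rV[R]_n.
Local Notation Z := 'rV[R]_(n + n).

Lemma prob_setI1 d (X : measurableType d) (P : probability X R) A B :
  measurable A -> measurable B -> P A = 1%E -> P B = 1%E -> P (A `&` B) = 1%E.
Proof.
move=> mA mB PA PB.
have P0 C : measurable C -> P C = 1%E -> P (~` C) = 0%E.
  by move=> mC PC; rewrite probability_setC// PC subee.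
have : P (~` (A `&` B)) = 0%E.
  apply/eqP; rewrite eq_le measure_ge0 andbT setCI.
  apply: (@le_trans _ _ (P (~` A) + P (~` B))%E); last by rewrite !P0// adde0.
  by apply: measureU2; exact: measurableC.
rewrite probability_setC; last exact: measurableI.
have : P (A `&` B) \is a fin_num by apply: fin_num_measure; exact: measurableI.
by case: (P (A `&` B)) => //= r _ [] /eqP; rewrite subr_eq0 => /eqP <-.
Qed.

(** Weak limits are taken on row vectors, couplings live on pairs: [join] sends a coupling to R^(2n)
    and [split] brings the limit back. *)
Let join (z : Rn * Rn) : Z := row_mx z.1 z.2.
Let split (z : Z) : Rn * Rn := (lsubmx z, rsubmx z).

Let mjoin : measurable_fun setT join.
Proof.
apply: measurable_fun_row => i; rewrite /join.
have [j ij|j ij] := splitP i.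
  have -> : i = lshift n j by exact: val_inj.
  rewrite (_ : (fun _ => _) = fun z : Rn * Rn => z.1 ord0 j).
    exact: (measurable_row_coord _ measurable_fst).
  by apply/funext => z; rewrite row_mxEl.
have -> : i = rshift n j by exact: val_inj.
rewrite (_ : (fun _ => _) = fun z : Rn * Rn => z.2 ord0 j).
  exact: (measurable_row_coord _ measurable_snd).
by apply/funext => z; rewrite row_mxEr.
Qed.

Let lsub_continuous : continuous (lsubmx : Z -> Rn).
Proof.
apply: (@lipschitz_continuous _ _ _ _ 1) => x y; rewrite mul1r.
apply: rV_norm_le => // i; rewrite !mxE.
by have := coord_norm_le (x - y) (lshift n i); rewrite !mxE.
Qed.

Let rsub_continuous : continuous (rsubmx : Z -> Rn).
Proof.
apply: (@lipschitz_continuous _ _ _ _ 1) => x y; rewrite mul1r.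
apply: rV_norm_le => // i; rewrite !mxE.
by have := coord_norm_le (x - y) (rshift n i); rewrite !mxE.
Qed.

Let msplit : measurable_fun setT split.
Proof.
apply: measurable_fun_pair; apply: measurable_fun_row => i.
  rewrite (_ : (fun _ => _) = fun z : Z => z ord0 (lshift n i)).
    exact: measurable_coord.
  by apply/funext => z; rewrite mxE.
rewrite (_ : (fun _ => _) = fun z : Z => z ord0 (rshift n i)).
  exact: measurable_coord.
by apply/funext => z; rewrite mxE.
Qed.

Let joinK z : split (join z) = z.
Proof. by case: z => x y; rewrite /split row_mxKl row_mxKr. Qed.

Lemma measurable_open_prod (U : set (Rn * Rn)) : open U -> measurable U.
Proof.
move=> oU; have -> : U = setT `&` join @^-1` (split @^-1` U).
  by rewrite setTI; apply/seteqP; split => z; rewrite /preimage /= joinK.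
apply: mjoin => //; apply: measurable_open; apply: open_comp => // z _.
apply: (@cvg_pair _ _ _ (nbhs z) (nbhs (lsubmx z)) (nbhs (rsubmx z)) _ _ _ lsubmx rsubmx).
  exact: lsub_continuous.
exact: rsub_continuous.
Qed.

Let dist (z : Z) : R := enorm (lsubmx z - rsubmx z).

Let dist_continuous : continuous dist.
Proof.
move=> z; apply: (@continuous_comp _ _ _ (fun z : Z => lsubmx z - rsubmx z)).
  by apply: continuousB; [exact: lsub_continuous|exact: rsub_continuous].
exact: enorm_continuous.
Qed.

Lemma measurable_transport_cost :
  measurable_fun setT (fun z : Rn * Rn => (enorm (z.1 - z.2))%:E).
Proof.
apply/measurable_EFinP; apply: measurable_enorm.
by apply: measurable_rowB; [exact: measurable_fst|exact: measurable_snd].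
Qed.

Let Rintegral_layers (P : probability Z R) h M :
  \int[P]_z (h * (\sum_(i < M) \1_[set z | h * i.+1%:R < dist z] z)) =
  h * (\sum_(i < M) fine (P [set z | h * i.+1%:R < dist z])).
Proof.
have mS (i : 'I_M) : measurable [set z | h * i.+1%:R < dist z].
  apply: measurable_open; rewrite (_ : mkset _ = dist @^-1` [set y | h * i.+1%:R < y])//.
  by apply: open_comp => [z _|]; [exact: dist_continuous|exact: open_gt].
rewrite bounded_RintegralZ; last first.
  by apply: bounded_measurable_sum => i; exact: bounded_measurable_indic.
rewrite bounded_Rintegral_sum; last by move=> i; exact: bounded_measurable_indic.
by congr (_ * _); apply: eq_bigr => i _; rewrite Rintegral_prob_indic.
Qed.

Lemma transport_cost_ge0 (tau : {measure set (Rn * Rn) -> \bar R}) :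
  (0 <= transport_cost tau)%E.
Proof. by apply: integral_ge0 => z _; rewrite lee_fin enorm_ge0. Qed.

Lemma W_ge0 (mu nu : set Rn -> \bar R) : (0 <= W mu nu)%E.
Proof. by apply: le_ereal_inf_tmp => _ [tau _ <-]; exact: transport_cost_ge0. Qed.

(** The masses that determine the marginals are constant along the sequence of almost optimal
    couplings, so the one-sided bound on open sets already gives the marginals of the limit. The
    cost does not increase in the limit because its layers are open sets. *)
Lemma optimal_coupling_exists (mu nu : probability Rn R) (r : R) :
  mu (@eball R n r) = 1%E -> nu (@eball R n r) = 1%E -> (W mu nu < +oo)%E ->
  exists tau : probability (Rn * Rn)%type R,
    optimal_coupling mu nu tau /\ (transport_cost tau <= W mu nu)%E.
Proof.
move=> mur nur Woo.
have Wfin : W mu nu \is a fin_num by rewrite ge0_fin_numE// W_ge0.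
have mball : measurable (@eball R n r) by apply: measurable_open; exact: open_eball.
have /choice[tau tauP] : forall k : nat, exists tau : probability (Rn * Rn)%type R,
    coupling mu nu tau /\ (transport_cost tau < W mu nu + (k.+1%:R^-1)%:E)%E.
  move=> k; have k0 : 0 < k.+1%:R^-1 :> R by rewrite invr_gt0.
  by have [_ [tau ? <-] ?] := lb_ereal_inf_adherent k0 Wfin; exists tau.
pose P k := law (tau k) mjoin.
have PE k A : P k A = tau k (join @^-1` A) by [].
pose K : set Z := [set z | `|z| <= r].
have cK : compact K.
  apply: bounded_closed_compact.
    by exists r; split => [|x rx z /=]; [exact: num_real|move/le_trans; apply; exact: ltW].
  apply: (@closed_comp _ _ (fun z : Z => `|z|) [set y | y <= r]).
    by move=> x _; exact: norm_continuous.
  exact: closed_le.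
pose B : set (Rn * Rn) := fst @^-1` eball r `&` snd @^-1` eball r.
have mB1 : measurable (fst @^-1` eball r : set (Rn * Rn)).
  by rewrite -[X in measurable X]setTI; exact: measurable_fst.
have mB2 : measurable (snd @^-1` eball r : set (Rn * Rn)).
  by rewrite -[X in measurable X]setTI; exact: measurable_snd.
have fullB (t : probability (Rn * Rn)%type R) : coupling mu nu t -> t B = 1%E.
  move=> [t1 t2]; apply: prob_setI1 => //.
    by rewrite -mur -(t1 _ mball).
  by rewrite -nur -(t2 _ mball).
have PK k : P k K = 1%E.
  apply/eqP; rewrite eq_le probability_le1/=; last first.
    by apply: measurable_closed; exact: compact_closed.
  rewrite -(fullB _ (tauP k).1) PE; apply: (@le_meas _ _ _ (tau k)).
  - exact: measurableI.
  - rewrite -[X in measurable X]setTI; apply: mjoin => //.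
    by apply: measurable_closed; exact: compact_closed.
  move=> [x y] [/= xr yr]; have r0 : 0 <= r by rewrite (le_trans (enorm_ge0 x))// ltW.
  apply: rV_norm_le => // i; rewrite mxE; case: splitP => j _.
    by rewrite (le_trans (coord_enorm_le _ _))// ltW.
  by rewrite (le_trans (coord_enorm_le _ _))// ltW.
have [F [q [PF ooF qP]]] := weak_limit cK PK.
pose sigma := law q msplit.
have open_l G : open G -> open ((lsubmx : Z -> Rn) @^-1` G).
  by move=> oG; apply: open_comp => // z _; exact: lsub_continuous.
have open_r G : open G -> open ((rsubmx : Z -> Rn) @^-1` G).
  by move=> oG; apply: open_comp => // z _; exact: rsub_continuous.
have lim_cst (u : nat -> R) (l c : R) : u @ F --> l -> (forall k, u k = c) -> l = c.
  move=> ul uc; rewrite -(cvg_lim _ ul)//.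
  rewrite (_ : u = cst c); first by rewrite lim_cst.
  by apply/funext => k /=; rewrite uc.
have sig1 : eq_meas (law sigma measurable_fst) mu.
  apply: eq_meas_open => G oG; have mG := measurable_open oG.
  have [l [Pl ql]] := qP _ (open_l _ oG).
  rewrite -(fineK (fin_num_measure mu _ mG)) (_ : fine (mu G) = l) => [//|].
  apply/esym/(lim_cst _ _ _ Pl) => k.
  rewrite -((tauP k).1.1 _ mG) PE /pushforward; congr (fine (tau k _)).
  by apply/seteqP; split => z /=; rewrite row_mxKl.
have sig2 : eq_meas (law sigma measurable_snd) nu.
  apply: eq_meas_open => G oG; have mG := measurable_open oG.
  have [l [Pl ql]] := qP _ (open_r _ oG).
  rewrite -(fineK (fin_num_measure nu _ mG)) (_ : fine (nu G) = l) => [//|].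
  apply/esym/(lim_cst _ _ _ Pl) => k.
  rewrite -((tauP k).1.2 _ mG) PE /pushforward; congr (fine (tau k _)).
  by apply/seteqP; split => z /=; rewrite row_mxKr.
have csig : coupling mu nu sigma by split; [exact: sig1|exact: sig2].
exists sigma; suff sW : (transport_cost sigma <= W mu nu)%E.
  split => //; split => // t ct; apply: le_trans sW _.
  by apply: ereal_inf_lbound; exists t.
have mdist : measurable_fun setT (fun z => (dist z)%:E).
  by apply/measurable_EFinP; exact: continuous_measurable_real.
have costE (t : probability Z R) :
    (\int[law t msplit]_z (enorm (z.1 - z.2))%:E = \int[t]_z (dist z)%:E)%E.
  rewrite ge0_integral_law//; first exact: measurable_transport_cost.
  by move=> y; rewrite lee_fin enorm_ge0.
have costP k : (\int[P k]_z (dist z)%:E = transport_cost (tau k))%E.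
  rewrite ge0_integral_law//; last by move=> y; rewrite lee_fin enorm_ge0.
  by apply: eq_integral => z _; rewrite /dist /= row_mxKl row_mxKr.
rewrite [leLHS]costE; apply/lee_addgt0Pr => e e0.
have r0 : 0 <= r.
  rewrite leNgt; apply/negP => r0; have : eball r = set0 :> set Rn.
    by rewrite -subset0 => x /= /(lt_trans)/(_ r0); rewrite ltNge enorm_ge0.
  by move=> b0; move: mur; rewrite b0 measure0 => /eqP; rewrite eq_sym onee_eq0.
(* M layers of thickness e reach, up to one more layer, the largest distance 2 * r between points of
   the ball. *)
pose M := (Num.truncn (2 * r / e)).
have rM : 2 * r <= e * M.+1%:R.
  by rewrite [leRHS]mulrC -ler_pdivrMr// ltW// truncnS_gt.
pose S (i : nat) := [set z : Z | e * i.+1%:R < dist z].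
have oS i : open (S i).
  rewrite (_ : S i = dist @^-1` [set y | e * i.+1%:R < y])//.
  by apply: open_comp => [z _|]; [exact: dist_continuous|exact: open_gt].
pose step z : R := e * (\sum_(i < M) \1_(S i) z).
have stepE z : step z = e * (\sum_(i < M) (e * i.+1%:R < dist z)%R%:R).
  congr (_ * _); apply: eq_bigr => i _; rewrite indicE; congr ((nat_of_bool _)%:R).
  by apply/idP/idP => [/set_mem//|h]; exact/mem_set.
have bstep : bounded_measurable step.
  apply: bounded_measurableZ; apply: bounded_measurable_sum => i.
  by apply: bounded_measurable_indic; exact: measurable_open.
have step0 z : 0 <= step z.
  by rewrite stepE; apply: mulr_ge0; [exact: ltW|exact: sumr_ge0].
have step_le z : step z <= dist z.
  by rewrite stepE; apply: layers_le; [exact: ltW|exact: enorm_ge0].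
have /choice[l lP] : forall i, exists l : R, fine (P k (S i)) @[k --> F] --> l /\
   (q (S i) <= l%:E)%E by move=> i; exact: qP.
have mqB : measurable (split @^-1` B).
  by rewrite -[X in measurable X]setTI; apply: msplit => //; exact: measurableI.
have qB0 : q (~` (split @^-1` B)) = 0%E.
  by rewrite probability_setC// -[q (split @^-1` B)]/(sigma B) fullB// subee.
have int_le : (\int[q]_z (dist z)%:E <= (e + e * (\sum_(i < M) l i))%:E)%E.
  apply: (@le_trans _ _ (\int[q]_z (e + step z)%:E)%E).
    apply: ae_ge0_le_integral => //.
    - by move=> z _; rewrite lee_fin enorm_ge0.
    - by move=> z _; rewrite lee_fin addr_ge0// ltW.
    - by apply/measurable_EFinP; apply: measurable_funD => //; exact: bstep.1.
    exists (~` (split @^-1` B)); split.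
    - exact: measurableC.
    - exact: qB0.
    apply: subsetC => z [/= zl zr] _; rewrite lee_fin stepE.
    apply: layers_ge; first exact: ltW.
    apply: le_trans rM; rewrite (le_trans (enormD _ _))// enormN.
    by rewrite mulr_natl mulr2n lerD// ltW.
  rewrite bounded_EFin_Rintegral; last first.
    by apply: bounded_measurableD => //; exact: bounded_measurable_cst.
  rewrite bounded_RintegralD ?Rintegral_prob_cst//; last exact: bounded_measurable_cst.
  rewrite lee_fin lerD2l Rintegral_layers ler_wpM2l ?(ltW e0)//.
  apply: ler_sum => i _; rewrite -lee_fin fineK; first exact: (lP i).2.
  by apply: fin_num_measure; exact: (measurable_open (oS i)).
apply: le_trans int_le _.
rewrite addeC EFinD leeD2l// -(fineK Wfin) lee_fin.
(* Two errors are separated: e is the thickness of a layer, d the excess cost of the k-th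
   coupling. *)
apply/ler_addgt0Pr => d d0.
have cvgS : e * (\sum_(i < M) fine (P k (S i))) @[k --> F] --> e * (\sum_(i < M) l i).
  apply: cvgMr; apply: cvg_big => [|i _]; first exact: add_continuous.
  by have [] := lP i.
apply: (cvgr_to_le cvgS).
have : \forall k \near F, k.+1%:R^-1 < d :> R.
  by apply: ooF; exact: near_infty_natSinv_lt (PosNum d0).
apply: filterS => k kd.
rewrite -lee_fin -Rintegral_layers -bounded_EFin_Rintegral//.
apply: (@le_trans _ _ (\int[P k]_z (dist z)%:E)%E).
  apply: ge0_le_integral => //.
  - by move=> z _; rewrite lee_fin step0.
  - by apply/measurable_EFinP; exact: bstep.1.
  by move=> z _; rewrite lee_fin; exact: step_le.
rewrite costP (le_trans (ltW (tauP k).2))// EFinD fineK// leeD2l// lee_fin.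
exact: ltW.
Qed.

End optimal_coupling.

(** Only x is confined. For y close to x the local constant applies; for y at distance at least e /
    2 the difference of the values is at most 2 * M, that is 4 * M / e times e / 2. Compactness of
    the ball makes the constant uniform. *)
Lemma locally_lipschitz_ball (R : realType) (n : nat) (phi : 'rV[R]_n -> 'rV[R]_n)
    (M : R) : (forall x, `|phi x| <= M) -> locally_lipschitz phi ->
  forall r : R, exists L : R, 0 < L /\
    forall x y, `|x| <= r -> `|phi x - phi y| <= L * `|x - y|.
Proof.
move=> phiM phi_lip r.
pose K : set 'rV[R]_n := [set x | `|x| <= r].
have cK : compact K.
  apply: bounded_closed_compact.
    by exists r; split => [|x rx z /=]; [exact: num_real|move/le_trans; apply; exact: ltW].
  apply: (@closed_comp _ _ (fun z : 'rV[R]_n => `|z|) [set y | y <= r]).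
    by move=> x _; exact: norm_continuous.
  exact: closed_le.
(* Letting L tend to +oo in the near-covering form of compactness replaces the maximum of the
   constants of a finite subcover. *)
have := cK; rewrite compact_near_coveringP => /(_ _ (+oo%R : set_system R)
  (fun L x => forall y, `|phi x - phi y| <= L * `|x - y|) _) [|L0 [L0r LK]]; last first.
  exists (`|L0| + 1); split; first by rewrite ltr_wpDl.
  by move=> x y xr; apply: LK => //; rewrite (le_lt_trans (ler_norm L0))// ltrDl.
move=> x Kx; have [U [xU [A [Ar]]]] := phi_lip x.
move=> /(_ (`|A| + 1)); rewrite (le_lt_trans (ler_norm A)) ?ltrDl// => /(_ isT) UA.
have /nbhs_ballP[e /= e0 eU] := xU.
exists (ball x (e / 2), [set L | `|A| + 1 + 4 * M / e < L]).
  split => /=; first by apply: nbhsx_ballx; rewrite divr_gt0.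
  by exists (`|A| + 1 + 4 * M / e); split => //; exact: num_real.
move=> [x' L] /= [xx' AL] y.
have M0 : 0 <= M by rewrite (le_trans _ (phiM 0)).
have Me : 0 <= 4 * M / e by rewrite divr_ge0 ?mulr_ge0// ltW.
have A0 : 0 <= `|A| by [].
have Ux' : U x' by apply: eU; apply: le_ball xx'; lra.
have [x'y|x'y] := ltP `|x' - y| (e / 2).
  have Uy : U y.
    apply: eU; rewrite (splitr e); apply: ball_triangle xx' _.
    by rewrite -ball_normE.
  have := UA (x', y); move=> /(_ (conj Ux' Uy)) /= /le_trans; apply.
  by rewrite ler_wpM2r//; lra.
apply: (@le_trans _ _ (2 * M)).
  by rewrite (le_trans (ler_normB _ _))//; have := phiM x'; have := phiM y; lra.
apply: (@le_trans _ _ (4 * M / e * (e / 2))).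
  rewrite (_ : 4 * M / e * (e / 2) = 2 * M)//; field; lra.
by apply: ler_pM => //; [rewrite divr_ge0// ltW|lra].
Qed.

(** * Flows *)

Section velocity.
Variables (R : realType) (n : nat) (phi : 'rV[R]_n -> 'rV[R]_n) (M : R).
Local Notation Rn := 'rV[R]_n.
Hypothesis phiM : forall x, `|phi x| <= M.
Hypothesis mphi : measurable_fun setT phi.

Let M0 : 0 <= M. Proof. by rewrite (le_trans _ (phiM 0)). Qed.

Lemma bounded_measurable_phi d (O : measurableType d) (X : O -> Rn) (x : Rn) i :
  measurable_fun setT X -> bounded_measurable (fun u => phi (X u - x) ord0 i).
Proof.
move=> mX; split; last by exists M => u; exact: le_trans (coord_norm_le _ _) (phiM _).
apply: measurable_row_coord; apply: measurableT_comp => //.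
by apply: measurable_rowB => //; exact: measurable_cst.
Qed.

Section one_space.
Context d (O : measurableType d).
Variable P : probability O R.
Implicit Types X Y : O -> Rn.

(** The integral runs over labels rather than positions, so that two configurations on the same
    labels are compared under one integral. *)
Definition velocity X (w : O) : Rn := \row_i \int[P]_u phi (X u - X w) ord0 i.

Lemma velocity_law X (mX : measurable_fun setT X) w :
  velocity X w = mean_velocity phi (law P mX) (X w).
Proof.
apply/rowP => i; rewrite !mxE bounded_Rintegral_law//.
by apply: (bounded_measurable_phi _ _ (@measurable_id _ _ _)).
Qed.

Lemma measurable_velocity X : measurable_fun setT X -> measurable_fun setT (velocity X).
Proof.
move=> mX; rewrite (_ : velocity X = mean_velocity phi (law P mX) \o X).
  by apply: measurableT_comp => //; exact: measurable_mean_velocity.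
by apply/funext => w; exact: velocity_law.
Qed.

Lemma velocity_norm X w : measurable_fun setT X -> `|velocity X w| <= M.
Proof.
move=> mX; apply: rV_norm_le => // i; rewrite mxE.
apply: norm_Rintegral_le; first exact: bounded_measurable_phi.
by move=> u; exact: le_trans (coord_norm_le _ _) (phiM _).
Qed.

Lemma measurable_norm X : measurable_fun setT X -> measurable_fun setT (fun u => `|X u|).
Proof.
move=> mX; apply: (measurableT_comp _ mX); apply: continuous_measurable_real.
by move=> x; exact: norm_continuous.
Qed.

Lemma bounded_measurable_dist X Y (r : R) : measurable_fun setT X ->
  measurable_fun setT Y -> (forall w, `|X w| <= r) -> (forall w, `|Y w| <= r) ->
  bounded_measurable (fun u => `|X u - Y u|).
Proof.
move=> mX mY Xr Yr; split; first by apply: measurable_norm; exact: measurable_rowB.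
by exists (r + r) => u; rewrite normr_id (le_trans (ler_normB _ _))// lerD.
Qed.

(** phi is evaluated at differences of positions, whence the radius r + r. The two terms of the
    bound are the displacement of the other particles, averaged, and that of the particle itself. *)
Lemma velocity_dist X Y (r L : R) : measurable_fun setT X -> measurable_fun setT Y ->
  (forall w, `|X w| <= r) -> (forall w, `|Y w| <= r) -> 0 <= L ->
  (forall x y, `|x| <= r + r -> `|phi x - phi y| <= L * `|x - y|) ->
  forall w, `|velocity X w - velocity Y w| <=
    L * (\int[P]_u `|X u - Y u| + `|X w - Y w|).
Proof.
move=> mX mY Xr Yr L0 phiL w.
have bd := bounded_measurable_dist mX mY Xr Yr.
have bd' : bounded_measurable (fun u => L * (`|X u - Y u| + `|X w - Y w|)).
  by apply: bounded_measurableZ; apply: bounded_measurableD => //; exact: bounded_measurable_cst.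
have E : L * (\int[P]_u `|X u - Y u| + `|X w - Y w|) =
    \int[P]_u (L * (`|X u - Y u| + `|X w - Y w|)).
  rewrite bounded_RintegralZ; last first.
    by apply: bounded_measurableD => //; exact: bounded_measurable_cst.
  rewrite bounded_RintegralD ?Rintegral_prob_cst//; exact: bounded_measurable_cst.
rewrite E; apply: rV_norm_le => [|i].
  by apply: Rintegral_ge0 => u _; rewrite mulr_ge0// addr_ge0.
have bX := bounded_measurable_phi (X w) i mX.
have bY := bounded_measurable_phi (Y w) i mY.
rewrite !mxE -bounded_RintegralB//.
apply: (le_trans (bounded_norm_Rintegral _ (bounded_measurableB bX bY))).
apply: bounded_le_Rintegral => //.
  exact: bounded_measurable_norm (bounded_measurableB bX bY).
move=> u; have -> : phi (X u - X w) ord0 i - phi (Y u - Y w) ord0 i =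
  (phi (X u - X w) - phi (Y u - Y w)) ord0 i by rewrite !mxE.
apply: (le_trans (coord_norm_le _ _)).
apply: (le_trans (phiL _ _ _)).
  by rewrite (le_trans (ler_normB _ _))// lerD.
rewrite ler_wpM2l//.
rewrite (_ : X u - X w - (Y u - Y w) = (X u - Y u) - (X w - Y w)).
  exact: ler_normB.
by apply/rowP => j; rewrite !mxE; ring.
Qed.

Lemma velocity_dist_sup X Y (r L e : R) : measurable_fun setT X -> measurable_fun setT Y ->
  (forall w, `|X w| <= r) -> (forall w, `|Y w| <= r) -> 0 <= L ->
  (forall x y, `|x| <= r + r -> `|phi x - phi y| <= L * `|x - y|) ->
  (forall w, `|X w - Y w| <= e) ->
  forall w, `|velocity X w - velocity Y w| <= 2 * L * e.
Proof.
move=> mX mY Xr Yr L0 phiL XYe w.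
apply: le_trans (velocity_dist mX mY Xr Yr L0 phiL w) _.
rewrite (mulrC 2) -mulrA ler_wpM2l// mulr_natl mulr2n lerD//.
rewrite -[leRHS](Rintegral_prob_cst P); apply: bounded_le_Rintegral => //.
  exact: bounded_measurable_dist Xr Yr.
exact: bounded_measurable_cst.
Qed.

End one_space.

(** The velocity depends on the labels only through the law of X, so it commutes with a measure
    preserving relabelling. *)
Lemma velocity_comp d d' (O : measurableType d) (O' : measurableType d')
    (P : probability O R) (P' : probability O' R) (g : O' -> O)
    (mg : measurable_fun setT g) (X : O -> Rn) : measurable_fun setT X ->
  eq_meas (law P' mg) P -> forall w, velocity P' (X \o g) w = velocity P X (g w).
Proof.
move=> mX gP w; apply/rowP => i; rewrite !mxE /=.
have bX := bounded_measurable_phi (X (g w)) i mX.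
rewrite -(bounded_Rintegral_law _ mg bX); congr fine.
by apply: eq_measure_integral => A mA _; exact: gP.
Qed.

End velocity.

(** * Sequences converging at a geometric rate *)

Section limits.
Variable R : realType.

Lemma le_half_pow (a b Q : R) : (forall k, a <= b + Q * 2^-1 ^+ k) -> a <= b.
Proof.
move=> ab; apply/ler_addgt0Pr => e e0.
have Q0 : 0 < `|Q| + 1 by rewrite ltr_wpDl.
have [k] := ltr_add_invr (divr_gt0 e0 Q0); rewrite add0r => ke.
apply: (le_trans (ab k)); rewrite lerD2l.
apply: (@le_trans _ _ ((`|Q| + 1) * k.+1%:R^-1)); last first.
  by rewrite mulrC -ler_pdivlMr// ltW.
apply: (@le_trans _ _ ((`|Q| + 1) * 2^-1 ^+ k)).
  by rewrite ler_wpM2r ?exprn_ge0// (le_trans (ler_norm Q))// lerDl.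
rewrite ler_wpM2l ?(ltW Q0)// exprVn lef_pV2 ?posrE ?exprn_gt0//.
by rewrite -natrX ler_nat ltn_expl.
Qed.

(** In each coordinate, u k minus the error bound increases and u k plus it decreases; the supremum
    of the lower sequence lies below all the upper terms, which gives the limit together with its
    rate. *)
Lemma geometric_limit n (u : nat -> 'rV[R]_n) (B : R) :
  (forall k, `|u k - u k.+1| <= B * 2^-1 ^+ k) ->
  exists l, forall k, `|u k - l| <= 2 * B * 2^-1 ^+ k.
Proof.
move=> uB.
have B0 : 0 <= B by have := uB 0%N; rewrite expr0 mulr1; apply: le_trans.
have cu i k : `|u k ord0 i - u k.+1 ord0 i| <= B * 2^-1 ^+ k.
  by have := le_trans (coord_norm_le _ i) (uB k); rewrite !mxE.
pose b i k := u k ord0 i - 2 * B * 2^-1 ^+ k.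
pose a i k := u k ord0 i + 2 * B * 2^-1 ^+ k.
have pS k : B * 2^-1 ^+ k = 2 * (B * 2^-1 ^+ k.+1) by rewrite exprS; field.
have bS i k : b i k <= b i k.+1.
  rewrite /b -!(mulrA 2) (pS k); have := cu i k; rewrite ler_norml (pS k); lra.
have aS i k : a i k.+1 <= a i k.
  rewrite /a -!(mulrA 2) (pS k); have := cu i k; rewrite ler_norml (pS k); lra.
have ba i k j : b i k <= a i j.
  have [kj|/ltnW jk] := leqP k j.
    apply: (@le_trans _ _ (b i j)).
      by move: k j kj; apply/nondecreasing_seqP.
    rewrite /b /a lerBlDr -addrA lerDl addr_ge0// mulr_ge0// ?exprn_ge0// mulr_ge0//.
  apply: (@le_trans _ _ (a i k)).
    rewrite /b /a lerBlDr -addrA lerDl addr_ge0// mulr_ge0// ?exprn_ge0// mulr_ge0//.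
  by have /nonincreasing_seqP := aS i; apply.
pose l : 'rV[R]_n := \row_i sup (range (b i)).
exists l => k; apply: rV_norm_le => [|i].
  by rewrite mulr_ge0 ?exprn_ge0// mulr_ge0.
have hb : has_sup (range (b i)).
  by split; [exists (b i 0%N), 0%N|exists (a i 0%N) => _ [m _ <-]; exact: ba].
have bl : b i k <= sup (range (b i)).
  by apply: sup_upper_bound; [exact: hb|exists k].
have la : sup (range (b i)) <= a i k.
  by apply: ge_sup => [|_ [m _ <-]]; [exists (b i 0%N), 0%N|exact: ba].
rewrite !mxE ler_norml; move: bl la; rewrite /a /b; lra.
Qed.

End limits.

Section flow.
Variables (R : realType) (n : nat) (phi : 'rV[R]_n -> 'rV[R]_n) (M : R).
Local Notation Rn := 'rV[R]_n.
Hypothesis phiM : forall x, `|phi x| <= M.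
Hypothesis mphi : measurable_fun setT phi.
Hypothesis phiL : forall r : R, exists L : R, 0 < L /\
  forall x y, `|x| <= r -> `|phi x - phi y| <= L * `|x - y|.

Let M0 : 0 <= M. Proof. by rewrite (le_trans _ (phiM 0)). Qed.

(* X t w is the position at time t of the particle labelled w.  The equation
   X' = velocity X is encoded by a first-order expansion, uniform in w, so that
   no measurability in time is needed. *)
Definition is_flow d (O : measurableType d) (P : probability O R) (T r C : R)
    (X : R -> O -> Rn) : Prop :=
  [/\ forall t, measurable_fun setT (X t),
      forall t w, 0 <= t <= T -> `|X t w| <= r &
      forall t h w, 0 <= t -> 0 <= h -> t + h <= T ->
        `|X (t + h) w - X t w - h *: velocity phi P (X t) w| <= C * h ^+ 2].

Section euler.
Context d (O : measurableType d).
Variables (P : probability O R) (xi : O -> Rn) (r T : R).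
Hypothesis mxi : measurable_fun setT xi.
Hypothesis xir : forall w, `|xi w| <= r.
Hypothesis T0 : 0 <= T.

Fixpoint euler (h : R) (j : nat) : O -> Rn :=
  if j is i.+1 then fun w => euler h i w + h *: velocity phi P (euler h i) w else xi.

Lemma measurable_euler h j : measurable_fun setT (euler h j).
Proof.
elim: j => //= j ih; apply: measurable_rowD => //; apply: measurable_rowZ.
exact: measurable_velocity.
Qed.

Lemma euler_dist h j i w : 0 <= h ->
  `|euler h (j + i) w - euler h j w| <= M * (i%:R * h).
Proof.
move=> h0; elim: i => [|i ih]; first by rewrite addn0 subrr normr0 mul0r mulr0.
rewrite addnS /= addrAC (le_trans (ler_normD _ _))//.
rewrite -natr1 mulrDl mul1r mulrDr lerD// normrZ ger0_norm// mulrC ler_wpM2r//.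
exact: velocity_norm (measurable_euler _ _).
Qed.

Lemma euler_norm h j w : 0 <= h -> j%:R * h <= T -> `|euler h j w| <= r + M * T.
Proof.
move=> h0 jT; rewrite -(subrK (xi w) (euler h j w)) addrC.
rewrite (le_trans (ler_normD _ _))// lerD//.
by rewrite (le_trans (euler_dist 0 j w h0))// ler_wpM2l.
Qed.

Variable L : R.
Hypothesis L0 : 0 <= L.
Hypothesis Lr : forall x y, `|x| <= (r + M * T) + (r + M * T) ->
  `|phi x - phi y| <= L * `|x - y|.

Let natr_le (i j : nat) h : 0 <= h -> (i <= j)%N -> j%:R * h <= T -> i%:R * h <= T.
Proof. by move=> h0 ij; apply: le_trans; rewrite ler_wpM2r// ler_nat. Qed.

(** After i steps every particle has moved by at most M * (i * h), so the velocity has changed by at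
    most 2 * L * M * (i * h). The error of the next step, h times this, fits into the increment of
    the square of i * h. *)
Lemma euler_expansion h j i w : 0 <= h -> (j + i)%:R * h <= T ->
  `|euler h (j + i) w - euler h j w - (i%:R * h) *: velocity phi P (euler h j) w|
  <= 2 * L * M * (i%:R * h) ^+ 2.
Proof.
move=> h0; elim: i => [|i ih] jT.
  by rewrite addn0 subrr mul0r scale0r subrr normr0 expr0n mulr0.
have jiT : (j + i)%:R * h <= T by apply: natr_le jT; rewrite ?addnS.
rewrite addnS /=; set v := velocity phi P _ w; set v' := velocity phi P _ w.
rewrite (_ : _ - _ = (euler h (j + i) w - euler h j w - (i%:R * h) *: v')
   + h *: (v - v')); last first.
  by apply/rowP => k; rewrite !mxE -natr1; ring.
rewrite (le_trans (ler_normD _ _))//.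
apply: (le_trans (lerD (ih jiT) (lexx _))).
have vv : `|v - v'| <= 2 * L * (M * (i%:R * h)).
  apply: (velocity_dist_sup phiM mphi P (r := r + M * T)) => //;
    try exact: measurable_euler.
  - by move=> w'; apply: euler_norm.
  - by move=> w'; apply: euler_norm => //; apply: natr_le jiT => //; exact: leq_addr.
  - by move=> w'; exact: euler_dist.
rewrite normrZ ger0_norm//.
apply: (le_trans (lerD (lexx _) (ler_wpM2l h0 vv))).
have LM : 0 <= L * M by exact: mulr_ge0.
have i0 : 0 <= i%:R :> R by [].
rewrite -natr1 -subr_ge0.
rewrite (_ : _ - _ = 2 * (L * M) * (i%:R + 1) * h ^+ 2); last by ring.
by rewrite mulr_ge0 ?sqr_ge0// mulr_ge0 ?addr_ge0// mulr_ge0.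
Qed.

(** [D] governs the local error of one Euler step, [A] the error accumulated on [0, T] when the step
    is halved. *)
Let D : R := 2 * L * M.
Let A : R := expR (2 * L * T) * T * D.

Let D0 : 0 <= D. Proof. by rewrite /D -mulrA mulr_ge0// mulr_ge0. Qed.
Let A0 : 0 <= A. Proof. by rewrite /A mulr_ge0// mulr_ge0// expR_ge0. Qed.

(** One coarse step differs from two fine ones by at most D times the square of 2 * h, and the
    deviation already present is multiplied by 1 + 2 * L * (2 * h), which is below the exponential.
    Since j * (2 * h) stays below T, the total is of order h. *)
Lemma euler_double h j w : 0 <= h -> j%:R * (2 * h) <= T ->
  `|euler (2 * h) j w - euler h (2 * j) w| <=
    expR (2 * L * (j%:R * (2 * h))) * (j%:R * (D * (2 * h) ^+ 2)).
Proof.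
move=> h0; elim: j w => [|j ih] w jT; first by rewrite muln0 /= subrr normr0 !mul0r !mulr0.
have hh0 : 0 <= 2 * h by rewrite mulr_ge0.
have jT' : j%:R * (2 * h) <= T by apply: natr_le jT.
rewrite (_ : (2 * j.+1)%N = (2 * j + 2)%N); last by rewrite mulnS addnC.
set e := expR (2 * L * (j%:R * (2 * h))) * _ in ih.
have jjT : (2 * j)%:R * h <= T by rewrite natrM -mulrA mulrCA.
have j2T : (2 * j + 2)%:R * h <= T by rewrite -mulnSr natrM -mulrA mulrCA.
have ex := euler_expansion w h0 j2T.
have vv : `|velocity phi P (euler (2 * h) j) w - velocity phi P (euler h (2 * j)) w|
    <= 2 * L * e.
  apply: (velocity_dist_sup phiM mphi P (r := r + M * T)) => //;
    try exact: measurable_euler.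
  - by move=> w'; apply: euler_norm.
  - by move=> w'; apply: euler_norm.
  - by move=> w'; exact: ih.
rewrite [euler (2 * h) j.+1 w]/=.
rewrite (_ : _ - _ = (euler (2 * h) j w - euler h (2 * j) w) +
  (2 * h) *: (velocity phi P (euler (2 * h) j) w - velocity phi P (euler h (2 * j)) w)
  - (euler h (2 * j + 2) w - euler h (2 * j) w - (2 * h) *: velocity phi P (euler h (2 * j)) w)).
  2: by set v1 := velocity _ _ _ w; set v2 := velocity _ _ _ w; apply/rowP => k; rewrite !mxE; ring.
apply: (le_trans (ler_normB _ _)).
apply: (le_trans (lerD (ler_normD _ _) ex)).
rewrite normrZ ger0_norm//.
apply: (le_trans (lerD (lerD (ih w jT') (ler_wpM2l hh0 vv)) (lexx _))).
have -> : e + 2 * h * (2 * L * e) + 2 * L * M * (2 * h) ^+ 2 =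
  (1 + 2 * L * (2 * h)) * e + D * (2 * h) ^+ 2 by rewrite /D; ring.
have e0 : 0 <= e.
  by rewrite /e mulr_ge0 ?expR_ge0// mulr_ge0// mulr_ge0// sqr_ge0.
have Dh : 0 <= D * (2 * h) ^+ 2 by rewrite mulr_ge0// sqr_ge0.
apply: (@le_trans _ _ (expR (2 * L * (2 * h)) * e +
    expR (2 * L * (j.+1%:R * (2 * h))) * (D * (2 * h) ^+ 2))).
  apply: lerD; first by rewrite ler_wpM2r// expR_ge1Dx.
  apply: ler_peMl => //; apply: (le_trans _ (expR_ge1Dx _)).
  by rewrite lerDl; do 2 apply: mulr_ge0 => //; apply: mulr_ge0.
have E1 : expR (2 * L * (2 * h)) * expR (2 * L * (j%:R * (2 * h))) =
    expR (2 * L * (j.+1%:R * (2 * h))).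
  by rewrite -expRD -natr1; congr expR; ring.
rewrite /e mulrA E1; set Y := expR _; rewrite -natr1 le_eqVlt; apply/orP; left.
by apply/eqP; ring.
Qed.

Let step (k : nat) : R := 2^-1 ^+ k.

Let step_ge0 k : 0 <= step k. Proof. by rewrite exprn_ge0. Qed.
Let step_gt0 k : 0 < step k. Proof. by rewrite exprn_gt0. Qed.
Let step_le1 k : step k <= 1.
Proof. by rewrite exprn_ile1// invf_le1// ler1n. Qed.
Let stepS k : step k = 2 * step k.+1. Proof. by rewrite /step exprS; field. Qed.

Let index (k : nat) (t : R) := Num.truncn (t / step k).

Let index_itv k t : 0 <= t -> (index k t)%:R * step k <= t < (index k t).+1%:R * step k.
Proof.
move=> t0; have := @truncn_itv R (t / step k); rewrite divr_ge0// => /(_ isT).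
by rewrite ler_pdivlMr// ltr_pdivrMr.
Qed.

(** Constant on each grid interval instead of affine: the jumps, of size at most M * step k, have
    the order of the Euler error. *)
Let polygon k t : O -> Rn := euler (step k) (index k t).

Let B : R := 2 * (A + M).

(** If j is the index of t for the coarse step, its index for the fine step is 2 * j or 2 * j + 1.
    Besides the halving error [A], at most one fine step has to be paid for, which costs [M]. *)
Let polygon_cauchy k t w : 0 <= t <= T ->
  `|polygon k t w - polygon k.+1 t w| <= (A + M) * step k.
Proof.
move=> /andP[t0 tT]; have /andP[jt tj] := index_itv k t0.
have /andP[it ti] := index_itv k.+1 t0.
rewrite /polygon; set j := index k t in jt tj *; set i := index k.+1 t in it ti *.
have jT : j%:R * step k <= T by exact: le_trans jt tT.
have [l [l1 il]] : exists l, (l <= 1)%N /\ i = (2 * j + l)%N.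
  have h1 : (2 * j < i.+1)%N.
    rewrite -(ltr_nat R) -(ltr_pM2r (step_gt0 k.+1)); apply: le_lt_trans ti.
    by rewrite natrM -mulrA mulrCA -stepS.
  have h2 : (i < 2 * j.+1)%N.
    rewrite -(ltr_nat R) -(ltr_pM2r (step_gt0 k.+1)); apply: le_lt_trans it _.
    by rewrite natrM -mulrA mulrCA -stepS.
  exists (i - 2 * j)%N; split; last by rewrite subnKC.
  by rewrite leq_subLR; move: h2; rewrite mulnS addnC addn2 ltnS addn1.
rewrite -(subrKA (euler (step k.+1) (2 * j) w)) (le_trans (ler_normD _ _))//.
rewrite mulrDl lerD//.
  rewrite [step k]stepS; apply: (le_trans (euler_double _ (step_ge0 _) _)).
    by rewrite -stepS.
  rewrite -stepS (_ : A * step k = expR (2 * L * T) * (T * (D * step k))); last by rewrite /A; ring.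
  apply: ler_pM.
  - exact: expR_ge0.
  - by apply: mulr_ge0 => //; apply: mulr_ge0 => //; exact: sqr_ge0.
  - by rewrite ler_expR; apply: ler_wpM2l => //; exact: mulr_ge0.
  rewrite (_ : j%:R * _ = (j%:R * step k) * (D * step k)); last by ring.
  by rewrite ler_wpM2r// mulr_ge0.
rewrite il distrC (le_trans (euler_dist _ _ _ (step_ge0 _)))// ler_wpM2l//.
rewrite [step k]stepS ler_wpM2r//; apply: (@le_trans _ _ 1); first by rewrite lern1.
by rewrite ler1n.
Qed.

Lemma euler_flow : exists X : R -> O -> Rn,
  X 0 = xi /\ is_flow P T (r + M * T) (2 * L * M) X.
Proof.
have lim_ex t w : exists l, 0 <= t <= T -> forall k, `|polygon k t w - l| <= B * step k.
  have [tT|tT] := pselect (0 <= t <= T); last by exists 0.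
  have [l lP] := geometric_limit (fun k => polygon_cauchy k w tT).
  by exists l.
have [lim limP] : exists lim : R -> O -> Rn, forall t w, 0 <= t <= T ->
    forall k, `|polygon k t w - lim t w| <= B * step k.
  by exists (fun t w => sval (cid (lim_ex t w))) => t w; case: cid.
(* A flow is measurable at every time, also outside [0, T], where the limit is not controlled; xi is
   a measurable default. *)
pose X t w := if 0 <= t <= T then lim t w else xi w.
have XB t w k : 0 <= t <= T -> `|polygon k t w - X t w| <= B * step k.
  by move=> tT; rewrite /X tT; exact: limP.
have B0 : 0 <= B by rewrite mulr_ge0// addr_ge0.
have pr k t w : 0 <= t <= T -> `|polygon k t w| <= r + M * T.
  move=> /andP[t0 tT]; apply: euler_norm => //.
  by have /andP[+ _] := index_itv k t0; move/le_trans; apply.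
have mX t : measurable_fun setT (X t).
  rewrite /X; have [tT|tT] := boolP (0 <= t <= T); last by [].
  apply: measurable_fun_row => i.
  apply: (@measurable_fun_cvg _ _ _ _ (fun k w => polygon k t w ord0 i)).
    by move=> k; apply: measurable_row_coord; exact: measurable_euler.
  move=> w _; apply/cvgrPdist_le => e e0.
  have : (fun k => B * step k) @ \oo --> B * 0.
    by apply: cvgMr; apply: cvg_expr; rewrite ger0_norm// invf_lt1// ltr1n.
  rewrite mulr0 => /cvgr0Pnorm_le/(_ _ e0); apply: filterS => k.
  apply: le_trans; rewrite [leRHS]ger0_norm ?(mulr_ge0 B0 (step_ge0 k))// distrC.
  by have := le_trans (coord_norm_le _ i) (limP t w tT k); rewrite !mxE.
have Xr t w : 0 <= t <= T -> `|X t w| <= r + M * T.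
  move=> tT; apply: (@le_half_pow _ _ _ B) => k.
  rewrite -(subrK (polygon k t w) (X t w)) addrC (le_trans (ler_normD _ _))//.
  by apply: lerD; [exact: pr|rewrite distrC; exact: XB].
exists X; split.
  apply/funext => w; have T00 : (0 : R) <= 0 <= T by rewrite lexx T0.
  apply/eqP; rewrite -subr_eq0 -normr_le0; apply: (@le_half_pow _ _ _ B) => k.
  rewrite add0r distrC; apply: le_trans (XB 0 w k T00).
  by rewrite /polygon /index mul0r truncn0.
split => // t h w t0 h0 thT.
have tT : 0 <= t <= T by rewrite t0 (le_trans _ thT)// lerDl.
have thT' : 0 <= t + h <= T by rewrite addr_ge0.
have hT : h <= T by rewrite (le_trans _ thT)// lerDr.
(* 2 * B pays for replacing the polygon by X at both ends, 2 * L * B * T for doing so inside the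
   velocity; the last two terms pay for the difference between h and the elapsed grid time. *)
apply: (@le_half_pow _ _ _ (2 * B + 2 * L * B * T + D * (2 * T + 1) + M)) => k.
rewrite -/(step k).
have /andP[jt tj] := index_itv k t0.
have /andP[th0 thT''] := thT'.
have /andP[it ti] := index_itv k th0.
have ij : (index k t <= index k (t + h))%N.
  by apply: le_truncn; rewrite ler_pM2r ?invr_gt0// lerDl.
have ex : `|polygon k (t + h) w - polygon k t w
    - ((index k (t + h) - index k t)%:R * step k) *: velocity phi P (polygon k t) w|
    <= D * ((index k (t + h) - index k t)%:R * step k) ^+ 2.
  have := @euler_expansion (step k) (index k t) (index k (t + h) - index k t) w.
  rewrite subnKC//; apply => //; exact: le_trans it thT''.
have vv : `|velocity phi P (polygon k t) w - velocity phi P (X t) w| <= 2 * L * (B * step k).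
  apply: (velocity_dist_sup phiM mphi P (r := r + M * T)) => //.
  - exact: measurable_euler.
  - by move=> w'; exact: pr.
  - by move=> w'; exact: Xr.
  - by move=> w'; exact: XB.
have vM : `|velocity phi P (polygon k t) w| <= M.
  by apply: velocity_norm => //; exact: measurable_euler.
have x1 := XB (t + h) w k thT'; have x2 := XB t w k tT.
(* [s] is the grid time elapsed between t and t + h; it differs from h by at most one step. *)
move: ex vv vM x1 x2; set s := _%:R * step k.
have [s1 s2] : h - step k <= s /\ s <= h + step k.
  rewrite /s natrB// mulrBl; move: jt tj it ti; rewrite -!natr1 !mulrDl !mul1r.
  by set a := _ * step k; set b := _ * step k => *; split; lra.
set v := velocity _ _ _ w; set v' := velocity _ _ _ w.
set p := polygon _ _ _; set q := polygon _ _ _ => ex vv vM x1 x2.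
rewrite (_ : X (t + h) w - X t w - h *: v' = (p - q - s *: v) - (p - X (t + h) w)
   + (q - X t w) + (h *: (v - v') + (s - h) *: v)).
  2: by move: (X (t + h) w) (X t w) => x y; apply/rowP => i; rewrite !mxE; ring.
have sh : `|s - h| <= step k by rewrite ler_norml; lra.
have s0 : 0 <= s by rewrite mulr_ge0.
have sq : D * s ^+ 2 <= D * h ^+ 2 + D * (2 * T + 1) * step k.
  rewrite -mulrA -mulrDr ler_wpM2l//.
  have := step_le1 k; have := step_ge0 k; nra.
have t1 : `|h *: (v - v')| <= T * (2 * L * (B * step k)).
  by rewrite normrZ ger0_norm// ler_pM.
have t2 : `|(s - h) *: v| <= M * step k.
  by rewrite normrZ mulrC ler_pM.
have n1 := ler_normD ((p - q - s *: v) - (p - X (t + h) w) + (q - X t w))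
  (h *: (v - v') + (s - h) *: v).
have n2 := ler_normD ((p - q - s *: v) - (p - X (t + h) w)) (q - X t w).
have n3 := ler_normB (p - q - s *: v) (p - X (t + h) w).
have n4 := ler_normD (h *: (v - v')) ((s - h) *: v).
rewrite /D in sq ex *; lra.
Qed.

End euler.
End flow.

(** * A discrete Gronwall inequality *)

Section gronwall.
Variable R : realType.

(* G t b stands for a bound b, valid at time t, on some quantity; a relation
   makes the lemma apply to the radius of a support as well as to a distance. *)
Lemma gronwall (G : R -> R -> Prop) (T K D a : R) :
  0 <= K -> 0 <= D -> 0 <= a ->
  (forall t b c, G t b -> b <= c -> G t c) ->
  (forall t h b, 0 <= t -> 0 <= h -> t + h <= T -> 0 <= b ->
    G t b -> G (t + h) ((1 + K * h) * b + D * h ^+ 2)) ->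
  G 0 a -> forall t e, 0 <= t <= T -> 0 < e -> G t (expR (K * t) * a + e).
Proof.
move=> K0 D0 a0 Gle Gstep Ga t e /andP[t0 tT] e0.
(* With N + 1 steps of length t / (N + 1), the remainders accumulate to at most Q / (N + 1); N is
   chosen to bring this below e. *)
pose Q := expR (K * t) * (D * t ^+ 2).
have Q0 : 0 <= Q by rewrite mulr_ge0 ?expR_ge0// mulr_ge0// sqr_ge0.
have Q1 : 0 < Q + 1 by rewrite ltr_wpDl.
have [N] := ltr_add_invr (divr_gt0 e0 Q1); rewrite add0r => Ne.
pose h := t / N.+1%:R.
have h0 : 0 <= h by rewrite divr_ge0.
have hN : N.+1%:R * h = t by rewrite /h mulrCA divff// mulr1.
have claim (j : nat) : (j <= N.+1)%N ->
    G (j%:R * h) (expR (K * (j%:R * h)) * (a + j%:R * (D * h ^+ 2))).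
  elim: j => [|j ih] jN; first by rewrite !mul0r mulr0 expR0 mul1r addr0.
  have Dh : 0 <= D * h ^+ 2 by rewrite mulr_ge0// sqr_ge0.
  have b0 : 0 <= expR (K * (j%:R * h)) * (a + j%:R * (D * h ^+ 2)).
    by rewrite mulr_ge0 ?expR_ge0// addr_ge0// mulr_ge0.
  have jS : j.+1%:R * h = j%:R * h + h by rewrite -natr1 mulrDl mul1r.
  have jh0 : 0 <= j%:R * h by rewrite mulr_ge0.
  have jT : j%:R * h + h <= T.
    by rewrite -jS (le_trans _ tT)// -hN ler_wpM2r// ler_nat.
  rewrite jS; apply: Gle (Gstep _ _ _ jh0 h0 jT b0 (ih (ltnW jN))) _.
  set E := expR (K * (j%:R * h)).
  have -> : expR (K * (j%:R * h + h)) = expR (K * h) * E.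
    by rewrite -expRD; congr expR; ring.
  have E1 : 1 <= E by rewrite -[leLHS]expR0 ler_expR mulr_ge0.
  have H1 : 1 + K * h <= expR (K * h) by exact: expR_ge1Dx.
  have Kh : 0 <= K * h by rewrite mulr_ge0.
  rewrite -/E in b0.
  have -> : a + j.+1%:R * (D * h ^+ 2) = (a + j%:R * (D * h ^+ 2)) + D * h ^+ 2.
    by rewrite -natr1; ring.
  rewrite [leRHS]mulrDr; apply: lerD.
    by rewrite -mulrA ler_wpM2r.
  rewrite ler_peMl//; apply: (le_trans E1).
  rewrite ler_peMl ?(le_trans ler01 E1)//; lra.
have := claim N.+1 (leqnn _); rewrite hN => /Gle; apply.
rewrite mulrDr lerD2l.
have -> : N.+1%:R * (D * h ^+ 2) = D * t ^+ 2 / N.+1%:R.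
  by rewrite -hN; field.
rewrite (_ : expR (K * t) * _ = Q * N.+1%:R^-1); last by rewrite /Q mulrA.
apply: (@le_trans _ _ ((Q + 1) * N.+1%:R^-1)); first by rewrite ler_wpM2r// lerDl.
by rewrite mulrC -ler_pdivlMr// ltW.
Qed.

End gronwall.

(** * The Wasserstein distance *)

Section W_lemmas.
Variables (R : realType) (n : nat).
Local Notation Rn := 'rV[R]_n.
Implicit Types al be ga : probability Rn R.

Lemma W_ext al al' be be' : eq_meas al al' -> eq_meas be be' -> W al be = W al' be'.
Proof.
move=> aa bb; rewrite /W; congr ereal_inf; congr image.
apply/seteqP; split => tau [t1 t2]; split => A mA; rewrite ?t1 ?t2//.
- exact: aa.
- exact: bb.
- by rewrite aa.
- by rewrite bb.
Qed.

Lemma W_law d (O : measurableType d) (P : probability O R) (X Y : O -> Rn)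
    (mX : measurable_fun setT X) (mY : measurable_fun setT Y) :
  (W (law P mX) (law P mY) <= \int[P]_w (enorm (X w - Y w))%:E)%E.
Proof.
have mXY : measurable_fun setT (fun w => (X w, Y w)) by exact: measurable_fun_pair.
apply: ereal_inf_lbound; exists (law P mXY) => //.
rewrite /transport_cost ge0_integral_law//; first exact: measurable_transport_cost.
by move=> y; rewrite lee_fin enorm_ge0.
Qed.

Lemma markov_cost (tau : probability (Rn * Rn)%type R) (d : R) : 0 < d ->
  (d%:E * tau [set z | d <= enorm (z.1 - z.2)]%R <= transport_cost tau)%E.
Proof.
move=> d0; set B := [set z | _].
have mB : measurable B.
  rewrite (_ : B = setT `&` (fun z : Rn * Rn => enorm (z.1 - z.2)) @^-1` `[d, +oo[%classic).
    apply: (measurable_enorm (measurable_rowB measurable_fst measurable_snd)) => //.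
  by rewrite setTI; apply/seteqP; split => z /=; rewrite in_itv/= andbT.
rewrite -(setIT B) -integral_indic// -ge0_integralZl//; last 2 first.
- by apply/measurable_EFinP; exact: measurable_indic.
- by rewrite lee_fin ltW.
apply: ge0_le_integral => //.
- by move=> z _; rewrite mule_ge0// lee_fin// ltW.
- apply/measurable_EFinP; apply: measurable_funM => //; exact: measurable_indic.
- exact: measurable_transport_cost.
move=> z _; rewrite -EFinM lee_fin indicE.
have [zB|] := boolP (z \in B); last by rewrite mulr0 enorm_ge0.
by rewrite mulr1; exact: (set_mem zB).
Qed.

(** Under a coupling of cost below e, mass starting in the deeper shrinking of G either ends in the
    shallower one or travels at least d; by Markov's inequality at most e / d of it does the
    latter. *)
Lemma W_inner al be (G : set Rn) (a d e : R) : 0 < d ->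
  (W al be < e%:E)%E -> (al (inner G (a + d)) <= be (inner G a) + (e / d)%:E)%E.
Proof.
move=> d0 /ereal_inf_lt[_ [tau [t1 t2] <-] te].
set C := inner G (a + d); set C' := inner G a.
have mC : measurable C by apply: measurable_closed; exact: closed_inner.
have mC' : measurable C' by apply: measurable_closed; exact: closed_inner.
set B : set (Rn * Rn) := [set z | d <= enorm (z.1 - z.2)].
have mB : measurable B.
  rewrite (_ : B = setT `&` (fun z : Rn * Rn => enorm (z.1 - z.2)) @^-1` `[d, +oo[%classic).
    apply: (measurable_enorm (measurable_rowB measurable_fst measurable_snd)) => //.
  by rewrite setTI; apply/seteqP; split => z /=; rewrite in_itv/= andbT.
have m1 : measurable (fst @^-1` C : set (Rn * Rn)).
  by rewrite -[X in measurable X]setTI; exact: measurable_fst.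
have m2 : measurable (snd @^-1` C' : set (Rn * Rn)).
  by rewrite -[X in measurable X]setTI; exact: measurable_snd.
rewrite -(t1 _ mC) -(t2 _ mC').
apply: (@le_trans _ _ (tau (snd @^-1` C' `|` B))).
  apply: (@le_meas _ _ _ tau) => //; first exact: measurableU.
  move=> [x y] /= Cx; have [xy|xy] := leP d (enorm (x - y)); first by right.
  by left; apply: inner_dist Cx _; rewrite ltW// (le_lt_trans (norm_le_enorm _)).
apply: (@le_trans _ _ (tau (snd @^-1` C') + tau B)%E); first exact: measureU2.
rewrite leeD2l//.
have Bfin : tau B \is a fin_num by exact: fin_num_measure.
have := le_lt_trans (markov_cost tau d0) te.
rewrite -/B -(fineK Bfin) -EFinM lte_fin lee_fin => h.
by rewrite ler_pdivlMr// mulrC ltW.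
Qed.

(** Mass is followed from al through ga to be across two nested shrinkings of an open set, which
    plays the part of a triangle inequality. First e tends to 0 with d fixed, then the shrinkings
    exhaust the set. *)
Lemma eq_meas_W al be : (forall e : R, 0 < e -> exists ga : probability Rn R,
  (W al ga < e%:E)%E /\ (W ga be < e%:E)%E) -> eq_meas al be.
Proof.
move=> H; apply: eq_meas_open => G oG.
have main d : 0 < d -> (al (inner G (d + d + d)) <= be (inner G d))%E.
  move=> d0; apply/lee_addgt0Pr => e e0.
  have ed : 0 < e * d / 2 by rewrite divr_gt0// mulr_gt0.
  have [ga [w1 w2]] := H _ ed.
  apply: (le_trans (W_inner G (d + d) d0 w1)).
  apply: (le_trans (leeD (W_inner G d d0 w2) (lexx _))).
  rewrite -addeA -EFinD leeD2l// lee_fin (_ : _ / d = e / 2); last by field; lra.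
  lra.
have mI d : measurable (inner G d) by apply: measurable_closed; exact: closed_inner.
pose C (i : nat) := inner G i.+1%:R^-1.
have CS : {homo C : i j / (i <= j)%N >-> (i <= j)%O}.
  move=> i j ij; apply/subsetPset => x Cx y Gy; apply: le_trans (Cx y Gy).
  by rewrite lef_pV2 ?posrE// ler_nat ltnS.
have : al (C i) @[i --> \oo] --> al G.
  rewrite [in X in _ --> X](open_inner oG); apply: nondecreasing_cvg_mu => //.
  - by move=> i; exact: mI.
  - by apply: bigcup_measurable => i _; exact: mI.
move=> /cvg_lim <-//; apply: lime_le.
  apply: ereal_nondecreasing_is_cvgn => i j /CS/subsetPset CC.
  by apply: le_meas CC; exact: mI.
apply: nearW => i; have i0 : 0 < i.+1%:R^-1 / 3 :> R by rewrite divr_gt0.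
rewrite /C (_ : i.+1%:R^-1 = i.+1%:R^-1 / 3 + i.+1%:R^-1 / 3 + i.+1%:R^-1 / 3).
  apply: (le_trans (main _ i0)); apply: le_meas => //; first exact: measurable_open.
  exact: inner_sub.
by field.
Qed.

End W_lemmas.

(** * Flows solve the measure differential equation *)

Section first_order_expansion.
Variable R : realType.

(** The expansion only looks forward. For negative h it is used from t + h up to t, and the
    Lipschitz bound on v replaces v (t + h) by v t at a cost of order h squared. *)
Lemma expansion_is_derive (V : normedModType R) (x v : R -> V) (T C : R) :
  (forall t h, 0 <= t -> 0 <= h -> t + h <= T ->
    `|x (t + h) - x t - h *: v t| <= C * h ^+ 2) ->
  (forall t h, 0 <= t -> 0 <= h -> t + h <= T -> `|v (t + h) - v t| <= C * h) ->
  forall t, 0 < t < T -> is_derive t (1 : R) x (v t).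
Proof.
move=> xv vC t /andP[t0 tT].
have key : h^-1 *: ((x \o shift t) (h *: (1 : R)) - x t) @[h --> 0^'] --> v t.
  apply/cvgrPdist_le => e e0.
  have C1 : 0 < 2 * `|C| + 1 by rewrite ltr_wpDl// mulr_ge0.
  pose d := Num.min (Num.min t (T - t)) (e / (2 * `|C| + 1)).
  have d0 : 0 < d by rewrite !lt_min t0 subr_gt0 tT divr_gt0.
  near=> h.
  have h0 : h != 0 by near: h; exact: nbhs_dnbhs_neq.
  have hd : `|h| < d.
    near: h; apply: dnbhs0_lt; exact: d0.
  have [[ht hT] he] : (`|h| < t /\ `|h| < T - t) /\ `|h| < e / (2 * `|C| + 1).
    by move: hd; rewrite !lt_min => /andP[/andP[-> ->] ->].
  have hn : 0 < `|h| by rewrite normr_gt0.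
  rewrite /= /shift /= (_ : h *: 1 = h); last by rewrite /GRing.scale /= mulr1.
  suff : `|v t - h^-1 *: (x (h + t) - x t)| <= 2 * `|C| * `|h|.
    move/le_trans; apply; move: he; rewrite ltr_pdivlMr// mulrC => /ltW; apply: le_trans.
    by rewrite ler_wpM2r// lerDl.
  rewrite -(ler_pM2l hn) -normrZ scalerBr scalerA divff// scale1r.
  have [h_ge0|h_lt0] := leP 0 h.
    have := xv t h (ltW t0) h_ge0; rewrite (addrC t) => xvh.
    rewrite distrC addrC; apply: (le_trans (y := C * h ^+ 2)).
      rewrite addrC; apply: xvh; move: hT; rewrite ger0_norm//; lra.
    rewrite (ger0_norm h_ge0).
    by have := ler_wpM2r (sqr_ge0 h) (ler_norm C); have := mulr_ge0 (normr_ge0 C) (sqr_ge0 h); lra.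
  have nh : `|h| = - h by rewrite ltr0_norm.
  have th : 0 <= h + t by move: ht; rewrite nh; lra.
  have nh0 : 0 <= - h by lra.
  have ht2 : h + t + - h = t by lra.
  have := xv (h + t) (- h) th nh0; rewrite ht2 => /(_ (ltW tT)) h1.
  have := vC (h + t) (- h) th nh0; rewrite ht2 => /(_ (ltW tT)) h2.
  rewrite (_ : h *: v t - (x (h + t) - x t) =
    (x t - x (h + t) - (- h) *: v (h + t)) - (- h) *: (v t - v (h + t))); last first.
    by rewrite !scaleNr !opprK scalerBr opprB [RHS]addrACA subrr addr0 addrC.
  rewrite (le_trans (ler_normB _ _))// normrZ normrN nh.
  apply: (le_trans (lerD h1 (ler_wpM2l nh0 h2))).
  by have := ler_wpM2r (sqr_ge0 h) (ler_norm C); lra.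
apply: DeriveDef; first by apply/cvg_ex; exists (v t).
exact: cvg_lim key.
Unshelve. all: by end_near. Qed.

Lemma lipschitz_abs_continuous (f : R -> R) (T K : R) : 0 <= K ->
  (forall t h, 0 <= t -> 0 <= h -> t + h <= T -> `|f (t + h) - f t| <= K * h) ->
  abs_continuous 0 T f.
Proof.
move=> K0 fK e e0; have K1 : 0 < K + 1 by rewrite ltr_wpDl.
exists (e / (K + 1)); split; first by rewrite divr_gt0.
move=> k u v uv _; rewrite ltr_pdivlMr// => s.
apply: le_lt_trans s; rewrite mulr_suml; apply: ler_sum => i _.
have [/andP[u0 uv'] vT] := uv i.
have vu0 : 0 <= v i - u i by rewrite subr_ge0.
have := fK (u i) (v i - u i) u0 vu0; rewrite addrC subrK => /(_ vT) /le_trans; apply.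
by rewrite mulrC ler_wpM2l// lerDl.
Qed.

Lemma lipschitz_itv (V : normedModType R) (f : R -> V) (T K : R) :
  (forall t h, 0 <= t -> 0 <= h -> t + h <= T -> `|f (t + h) - f t| <= K * h) ->
  forall s t, 0 <= s <= T -> 0 <= t <= T -> `|f s - f t| <= K * `|s - t|.
Proof.
move=> fK s t /andP[s0 sT] /andP[t0 tT]; wlog st : s t s0 sT t0 tT / t <= s.
  by move=> H; have [/H|/ltW/H] := leP t s; [exact|rewrite distrC (distrC s); exact].
have st0 : 0 <= s - t by rewrite subr_ge0.
by have := fK t (s - t) t0 st0; rewrite addrC subrK ger0_norm//; exact.
Qed.

Lemma lipschitz_within_continuous (V : normedModType R) (f : R -> V) (T K : R) :
  (forall t h, 0 <= t -> 0 <= h -> t + h <= T -> `|f (t + h) - f t| <= K * h) ->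
  {within `[0, T], continuous f}.
Proof.
move=> /lipschitz_itv fK; apply/subspace_continuousP => s.
rewrite /= in_itv /= => sT; apply/cvgrPdist_le => e e0.
rewrite near_withinE; near=> t; rewrite /= in_itv /= => tT.
apply: (le_trans (fK _ _ sT tT)).
apply: (@le_trans _ _ ((`|K| + 1) * `|s - t|)).
  by rewrite ler_wpM2r// (le_trans (ler_norm K))// lerDl.
have K1 : 0 < `|K| + 1 by rewrite ltr_wpDl.
rewrite mulrC -ler_pdivlMr//; apply: ltW; near: t.
by apply: nbhsx_ballx; rewrite divr_gt0.
Unshelve. all: by end_near. Qed.

Lemma lipschitz_integrable (f : R -> R) (T K : R) :
  (forall t h, 0 <= t -> 0 <= h -> t + h <= T -> `|f (t + h) - f t| <= K * h) ->
  lebesgue_measure.-integrable `[0, T] (EFin \o f).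
Proof.
move=> fK; apply: continuous_compact_integrable; first exact: segment_compact.
exact: lipschitz_within_continuous fK.
Qed.

End first_order_expansion.

(** * Mean value estimates and test functions *)

Section coordinate_mean_value.
Variables (R : realType) (n : nat).
Local Notation Rn := 'rV[R]_n.

Lemma is_derive_line (g : Rn -> R) (z e : Rn) (s : R) : derivable g (z + s *: e) e ->
  is_derive s (1 : R) (fun s => g (z + s *: e)) ('D_e g (z + s *: e)).
Proof.
move=> dg.
have E : (fun h : R => h^-1 *: (((fun s => g (z + s *: e)) \o shift s) (h *: (1 : R)) -
     g (z + s *: e))) =
  (fun h : R => h^-1 *: ((g \o shift (z + s *: e)) (h *: e) - g (z + s *: e))).
  apply/funext => h /=; congr (_ *: (g _ - _)).
  by rewrite /GRing.scale /= mulr1 -/(GRing.scale _ _) scalerDl addrCA.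
by apply: DeriveDef; rewrite /derivable /derive E.
Qed.

Lemma line_mean_value (g : Rn -> R) (z e : Rn) (d c E : R) :
  (forall x, derivable g x e) ->
  (forall s, `|s| <= `|d| -> `|'D_e g (z + s *: e) - c| <= E) ->
  `|g (z + d *: e) - g z - c * d| <= E * `|d|.
Proof.
move=> dg gE; pose f s := g (z + s *: e).
have df s : is_derive s (1 : R) f ('D_e g (z + s *: e)) by exact: is_derive_line.
have cf a b : {within `[a, b], continuous f}.
  by apply: derivable_within_continuous => x _; exact: ex_derive.
have -> : g z = f 0 by rewrite /f scale0r addr0.
rewrite -/(f d); have [d0|d0] := leP 0 d.
  have [s] := MVT_segment d0 (fun x _ => df x) (cf 0 d).
  rewrite in_itv /= => /andP[s0 sd] ->; rewrite subr0 -mulrBl normrM ler_wpM2r//.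
  by apply: gE; rewrite !ger0_norm.
have [s] := MVT_segment (ltW d0) (fun x _ => df x) (cf d 0).
rewrite in_itv /= => /andP[sd s0]; rewrite sub0r mulrN => fs.
have -> : f d - f 0 - c * d = ('D_e g (z + s *: e) - c) * d.
  by rewrite -(opprB (f 0)) fs opprK mulrBl.
by rewrite normrM ler_wpM2r//; apply: gE; rewrite !ler0_norm ?(ltW d0)// lerN2.
Qed.

(** The path from x to y changes one coordinate at a time and stays within sup distance [|y - x|] of
    x, so each move is a mean value estimate on a line. *)
Lemma coordinate_mean_value (g : Rn -> R) (x y : Rn) (c : 'I_n -> R) (E : R) :
  (forall i x, derivable g x (delta_mx ord0 i)) ->
  (forall i z, `|z - x| <= `|y - x| -> `|partial i g z - c i| <= E) ->
  `|g y - g x - \sum_i c i * (y ord0 i - x ord0 i)| <= E * (n%:R * `|y - x|).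
Proof.
move=> dg gE.
pose z k : Rn := \row_j (if (j < k)%N then y ord0 j else x ord0 j).
suff key k : (k <= n)%N ->
    `|g (z k) - g x - \sum_(i < n | (i < k)%N) c i * (y ord0 i - x ord0 i)|
    <= E * (k%:R * `|y - x|).
  have := key n (leqnn n); rewrite (_ : z n = y).
    by rewrite (eq_bigl xpredT) => [//|i]; exact: ltn_ord.
  by apply/rowP => j; rewrite mxE ltn_ord.
elim: k => [_|k ih kn].
  rewrite (_ : z 0%N = x); last by apply/rowP => j; rewrite mxE.
  by rewrite subrr big_pred0// subrr normr0 mul0r mulr0.
pose i := Ordinal kn; pose d := y ord0 i - x ord0 i.
have dxy : `|d| <= `|y - x| by have := coord_norm_le (y - x) i; rewrite !mxE.
have zS : z k.+1 = z k + d *: delta_mx ord0 i.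
  apply/rowP => j; rewrite !mxE eqxx /= ltnS leq_eqVlt.
  have [->|ji] := eqVneq j i; first by rewrite eqxx ltnn mulr1 /d subrKC.
  by rewrite mulr0 addr0 (_ : (j == k :> nat) = false)//; exact/negbTE.
have st : `|g (z k.+1) - g (z k) - c i * d| <= E * `|d|.
  rewrite zS; apply: line_mean_value => // s sd; apply: gE.
  apply: rV_norm_le => // j; rewrite !mxE eqxx /=.
  have [->|ji] := eqVneq j i.
    by rewrite ltnn mulr1 addrAC subrr add0r (le_trans sd).
  rewrite mulr0 addr0; case: ifP => _; last by rewrite subrr normr0.
  by have := coord_norm_le (y - x) j; rewrite !mxE.
rewrite (bigD1 i)//= (eq_bigl (fun j : 'I_n => (j < k)%N)); last first.
  move=> j; rewrite ltnS leq_eqVlt; have [->|ji] := eqVneq j i; first by rewrite ltnn andbF.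
  by rewrite andbT (_ : (j == k :> nat) = false)//; exact/negbTE.
rewrite (_ : _ - _ = (g (z k.+1) - g (z k) - c i * d) +
  (g (z k) - g x - \sum_(j < n | (j < k)%N) c j * (y ord0 j - x ord0 j))); last first.
  by rewrite /d; ring.
have E0 : 0 <= E by apply: le_trans (gE i x _) => //; rewrite subrr normr0.
have -> : E * (k.+1%:R * `|y - x|) = E * `|y - x| + E * (k%:R * `|y - x|).
  by rewrite -natr1; ring.
apply: (le_trans (ler_normD _ _)); apply: lerD; last exact: ih (ltnW kn).
by apply: (le_trans st); rewrite ler_wpM2l.
Qed.

End coordinate_mean_value.

Section test_functions.
Variables (R : realType) (n : nat).
Local Notation Rn := 'rV[R]_n.

Lemma test_continuous (f : Rn -> R) : test_function f -> continuous f.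
Proof. by move=> [/(_ 0%N)]. Qed.

Lemma test_derivable (f : Rn -> R) i x : test_function f ->
  derivable f x (delta_mx ord0 i).
Proof. by move=> [/(_ 1%N) [_ /(_ i)[]]]. Qed.

(** Off the closed support f vanishes in a neighbourhood, hence so do its partial derivatives. *)
Lemma test_partial (f : Rn -> R) i : test_function f -> test_function (partial i f).
Proof.
move=> [fC fK]; split; first by move=> k; have [_ /(_ i)[]] := fC k.+1.
apply: subclosed_compact fK _; first exact: closed_closure.
rewrite [X in _ `<=` X](_ : _ = closure (closure [set x | f x != 0])); last first.
  by apply/closure_id/closed_closure.
apply: closure_subset => x /=; apply: contraNP => nx; apply/eqP.
rewrite /partial -(@derive_cst _ _ _ (0 : R) (delta_mx ord0 i) x).
apply: near_eq_derive.
have : nbhs x (~` closure [set x | f x != 0]).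
  by apply: open_nbhs_nbhs; split => //; apply: closed_openC; exact: closed_closure.
apply: filterS => y ny; apply/eqP; apply: contrapT => fy; apply: ny.
by apply: subset_closure => /=; exact/negP.
Qed.

Lemma test_bounded (f : Rn -> R) : test_function f -> exists B, forall x, `|f x| <= B.
Proof.
move=> tf; have [_ fK] := tf.
have /compact_bounded[B [_ fB]] : compact [set f x | x in closure [set x | f x != 0]].
  by apply: continuous_compact fK; apply: continuous_subspaceT; exact: test_continuous.
exists (`|B| + 1) => x.
have [->|fx] := eqVneq (f x) 0; first by rewrite normr0 addr_ge0.
apply: fB; first by rewrite (le_lt_trans (ler_norm B))// ltrDl.
by exists x => //; exact: subset_closure.
Qed.

Lemma test_partial_bounded (f : Rn -> R) : test_function f ->
  exists A, 0 <= A /\ forall i x, `|partial i f x| <= A.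
Proof.
move=> tf.
have /choice[B fB] : forall i, exists B, forall x, `|partial i f x| <= B.
  by move=> i; apply: test_bounded; exact: test_partial.
exists (\sum_i `|B i|); split; first exact: sumr_ge0.
move=> i x; apply: (le_trans (fB i x)); apply: (le_trans (ler_norm _)).
by rewrite (bigD1 i)//= lerDl; exact: sumr_ge0.
Qed.

(** The mean value estimate is used twice: on the partial derivatives with c = 0, which makes them
    Lipschitz, then on f with c the gradient at x, which gives the quadratic remainder. One constant
    serves all the bounds. *)
Lemma test_estimates (f : Rn -> R) : test_function f -> exists A, [/\ 0 <= A,
  forall i x, `|partial i f x| <= A,
  forall i x y, `|partial i f y - partial i f x| <= A * `|y - x| &
  forall x y, `|f y - f x - dotv (grad f x) (y - x)| <= A * `|y - x| ^+ 2].
Proof.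
move=> tf; have [A [A0 fA]] := test_partial_bounded tf.
have /choice[B fB] : forall i, exists B, 0 <= B /\
    forall j x, `|partial j (partial i f) x| <= B.
  by move=> i; apply: test_partial_bounded; exact: test_partial.
pose C := n%:R * \sum_i B i.
have B0 i : 0 <= B i by have [] := fB i.
have C0 : 0 <= C by rewrite mulr_ge0// sumr_ge0.
have lip i x y : `|partial i f y - partial i f x| <= C * `|y - x|.
  have := @coordinate_mean_value _ _ (partial i f) x y (fun=> 0) (B i).
  rewrite big1 ?subr0 => [H|j _]; last by rewrite mul0r.
  apply: le_trans (H _ _) _.
  - by move=> j z; apply: test_derivable; exact: test_partial.
  - by move=> j z _; rewrite subr0; have [_] := fB i.
  rewrite mulrA ler_wpM2r// /C mulrC ler_wpM2l// (bigD1 i)//= lerDl.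
  exact: sumr_ge0.
exists (A + C + C * n%:R); split.
- by rewrite !addr_ge0// mulr_ge0.
- by move=> i x; rewrite (le_trans (fA i x))// -addrA lerDl addr_ge0// mulr_ge0.
- move=> i x y; rewrite (le_trans (lip i x y))// ler_wpM2r//.
  by rewrite addrAC lerDr addr_ge0// mulr_ge0.
move=> x y.
have := @coordinate_mean_value _ _ f x y (fun i => partial i f x) (C * `|y - x|).
rewrite (_ : \sum_i _ = dotv (grad f x) (y - x)); last first.
  by apply: eq_bigr => i _; rewrite !mxE.
move=> H; apply: le_trans (H _ _) _.
- by move=> i z; exact: test_derivable.
- by move=> i z zx; rewrite (le_trans (lip i x z))// ler_wpM2l.
rewrite mulrACA -expr2.
by rewrite ler_wpM2r ?sqr_ge0// lerDr addr_ge0.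
Qed.

Lemma norm_dotv_sup (x y : Rn) : `|dotv x y| <= n%:R * (`|x| * `|y|).
Proof.
rewrite (le_trans (ler_norm_sum _ _ _))//.
have -> : n%:R * (`|x| * `|y|) = \sum_(i < n) (`|x| * `|y|).
  by rewrite sumr_const card_ord mulr_natl.
by apply: ler_sum => i _; rewrite normrM ler_pM// coord_norm_le.
Qed.

Lemma measurable_grad (f : Rn -> R) : test_function f -> measurable_fun setT (grad f).
Proof.
move=> tf; apply: measurable_fun_row => i.
rewrite (_ : (fun _ => _) = partial i f); last by apply/funext => x; rewrite mxE.
by apply: continuous_measurable_real; apply: test_continuous; exact: test_partial.
Qed.

End test_functions.

Section flow_properties.
Variables (R : realType) (n : nat) (phi : 'rV[R]_n -> 'rV[R]_n) (M : R).
Local Notation Rn := 'rV[R]_n.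
Hypothesis phiM : forall x, `|phi x| <= M.
Hypothesis mphi : measurable_fun setT phi.
Hypothesis phiL : forall r : R, exists L : R, 0 < L /\
  forall x y, `|x| <= r -> `|phi x - phi y| <= L * `|x - y|.

Let M0 : 0 <= M. Proof. by rewrite (le_trans _ (phiM 0)). Qed.

(** M bounds the velocity, and the remainder C * h ^+ 2 is at most C * T * h. *)
Lemma flow_lipschitz d (O : measurableType d) (P : probability O R) T r C X :
  0 <= C -> is_flow phi P T r C X -> forall t h w, 0 <= t -> 0 <= h -> t + h <= T ->
  `|X (t + h) w - X t w| <= (M + C * T) * h.
Proof.
move=> C0 [mX _ XC] t h w t0 h0 tT.
rewrite -(subrK (h *: velocity phi P (X t) w) (X (t + h) w - X t w)).
apply: (le_trans (ler_normD _ _)).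
have v1 := velocity_norm phiM mphi P w (mX t).
have hT : h <= T by lra.
have := XC t h w t0 h0 tT; set a := `|_| => aC.
have : `|h *: velocity phi P (X t) w| <= h * M by rewrite normrZ ger0_norm// ler_wpM2l.
have : C * h ^+ 2 <= C * (T * h) by rewrite ler_wpM2l// expr2 ler_wpM2r.
lra.
Qed.

Lemma velocity_lipschitz r : exists K, 0 <= K /\
  forall d (O : measurableType d) (P : probability O R) T C X,
  0 <= C -> is_flow phi P T r C X -> forall t h w, 0 <= t -> 0 <= h -> t + h <= T ->
  `|velocity phi P (X (t + h)) w - velocity phi P (X t) w| <= K * ((M + C * T) * h).
Proof.
have [L [L0 Lr]] := phiL (r + r).
exists (2 * L); split; first by rewrite mulr_ge0// ltW.
move=> d O P T C X C0 fX t h w t0 h0 tT; have [mX Xr _] := fX.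
apply: (velocity_dist_sup phiM mphi P (r := r)) => //.
- by move=> w'; apply: Xr; rewrite tT addr_ge0.
- by move=> w'; apply: Xr; rewrite t0 (le_trans _ tT)// lerDl.
- exact: ltW.
- by move=> w'; exact: flow_lipschitz fX _ _ _ _ _ _.
Qed.

End flow_properties.

Lemma eq_meas_Rintegral d (X : measurableType d) (R : realType) (P Q : probability X R)
    (f : X -> R) : eq_meas P Q -> \int[P]_x f x = \int[Q]_x f x.
Proof. by move=> PQ; congr fine; apply: eq_measure_integral => A mA _; exact: PQ. Qed.

Lemma eq_meas_integrable d (X : measurableType d) (R : realType) (P Q : probability X R)
    (f : X -> \bar R) : eq_meas P Q -> P.-integrable setT f -> Q.-integrable setT f.
Proof.
move=> PQ /integrableP[mf fi]; apply/integrableP; split => //.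
by rewrite (@eq_measure_integral _ _ _ _ P) => [//|A mA _]; exact/esym/PQ.
Qed.

Lemma dotvBl (R : realType) n (x y z : 'rV[R]_n) : dotv (x - y) z = dotv x z - dotv y z.
Proof. by rewrite dotvDl dotvNl. Qed.

Lemma dotvBr (R : realType) n (x y z : 'rV[R]_n) : dotv z (x - y) = dotv z x - dotv z y.
Proof. by rewrite dotvC dotvBl !(dotvC z). Qed.

Lemma dotvZr (R : realType) n k (x z : 'rV[R]_n) : dotv z (k *: x) = k * dotv z x.
Proof. by rewrite dotvC dotvZl (dotvC z). Qed.

Lemma measurable_dotv d (X : measurableType d) (R : realType) n (f g : X -> 'rV[R]_n) :
  measurable_fun setT f -> measurable_fun setT g ->
  measurable_fun setT (fun x => dotv (f x) (g x)).
Proof.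
move=> mf mg; apply: measurable_sum => i.
by apply: measurable_funM; exact: measurable_row_coord.
Qed.

Section flow_is_solution.
Variables (R : realType) (n : nat) (phi : 'rV[R]_n -> 'rV[R]_n) (M : R).
Local Notation Rn := 'rV[R]_n.
Hypothesis phiM : forall x, `|phi x| <= M.
Hypothesis mphi : measurable_fun setT phi.
Hypothesis phiL : forall r : R, exists L : R, 0 < L /\
  forall x y, `|x| <= r -> `|phi x - phi y| <= L * `|x - y|.

Let M0 : 0 <= M. Proof. by rewrite (le_trans _ (phiM 0)). Qed.

Lemma mean_velocity_norm (mu : probability Rn R) x : `|mean_velocity phi mu x| <= M.
Proof.
have mid := @measurable_id _ Rn setT.
apply: rV_norm_le => // i; rewrite mxE; apply: norm_Rintegral_le.
  exact: (bounded_measurable_phi phiM mphi x i mid).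
by move=> u; exact: le_trans (coord_norm_le _ _) (phiM _).
Qed.

Lemma mean_velocity_ext (mu nu : probability Rn R) x : eq_meas mu nu ->
  mean_velocity phi mu x = mean_velocity phi nu x.
Proof. by move=> e; apply/rowP => i; rewrite !mxE (eq_meas_Rintegral _ e). Qed.

Lemma measurable_velocity_graph (mu : probability Rn R) :
  measurable_fun setT (fun x : Rn => (x, mean_velocity phi mu x)).
Proof. by apply: measurable_fun_pair => //; exact: measurable_mean_velocity. Qed.

(** V[mu] is carried by the graph of the mean velocity; integrals, couplings and supports of V[mu]
    are thereby reduced to mu. *)
Lemma interaction_law (mu : probability Rn R) :
  eq_meas (interaction_pvf mphi mu) (law mu (measurable_velocity_graph mu)).
Proof.
move=> A mA.
have mg : measurable ((fun x : Rn => (x, mean_velocity phi mu x)) @^-1` A).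
  by rewrite -[X in measurable X]setTI; exact: measurable_velocity_graph.
rewrite lawE -[X in _ = mu X]setIT -integral_indic//.
rewrite /interaction_pvf /= /interaction_fun /= /otimes; apply: eq_integral => x _.
rewrite /mean_velocity_kernel /= /kdirac integral_dirac//; first by rewrite diracT mul1e.
by apply/measurable_EFinP; apply: (measurable_comp measurableT).
Qed.

(** The bound on f is asked only for [|v| <= M], where V[mu] lives: the flux of a test function is
    linear in v. *)
Lemma interaction_integral (mu : probability Rn R) (f : Rn * Rn -> R) :
  measurable_fun setT f ->
  (exists c, forall x v, `|v| <= M -> `|f (x, v)| <= c) ->
  (interaction_pvf mphi mu).-integrable setT (EFin \o f) /\
  \int[interaction_pvf mphi mu]_z f z = \int[mu]_x f (x, mean_velocity phi mu x).
Proof.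
move=> mf [c fc]; have mg := measurable_velocity_graph mu.
have bf : bounded_measurable (fun x => f (x, mean_velocity phi mu x)).
  split; first by apply: measurableT_comp mg.
  by exists c => x; apply: fc; exact: mean_velocity_norm.
have mf' : measurable_fun setT (EFin \o f) by exact/measurable_EFinP.
have e := interaction_law mu.
split.
  apply: (@eq_meas_integrable _ _ _ (law mu mg)).
    by move=> A mA; exact/esym/e.
  exact: (integrable_pushforward mg mf' (bounded_measurable_integrable _ bf)).
rewrite (eq_meas_Rintegral _ e); congr fine.
rewrite [LHS](@integral_distribution _ _ _ _ _ _ (mfun_Sub (mem_set mg)))//.
exact: (bounded_measurable_integrable _ bf).
Qed.

(** Taylor's formula along each trajectory, integrated over the labels, is a first-order expansion
    of the mean of f whose rate is Lipschitz in time. All the analytic conditions follow from these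
    two estimates. *)
Lemma flow_is_solution d (O : measurableType d) (P : probability O R) (T r C : R)
    (X : R -> O -> Rn) (mX : forall t, measurable_fun setT (X t))
    (mu : R -> probability Rn R) :
  0 < T -> 0 <= C -> is_flow phi P T r C X ->
  (forall t, 0 <= t <= T -> eq_meas (mu t) (law P (mX t))) ->
  is_solution (interaction_pvf mphi) T mu.
Proof.
move=> T0 C0 fX muX f tf /=; have [_ Xr XC] := fX.
have [A [A0 fA fAL fT]] := test_estimates tf.
have [K [K0 vK]] := velocity_lipschitz phiM mphi phiL r.
have [B fB] := test_bounded tf.
have gA x : `|grad f x| <= A by apply: rV_norm_le => // i; rewrite mxE.
have gL x y : `|grad f y - grad f x| <= A * `|y - x|.
  by apply: rV_norm_le => [|i]; rewrite ?mulr_ge0// !mxE.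
have mf : measurable_fun setT f.
  by apply: continuous_measurable_real; exact: test_continuous.
pose v t w := velocity phi P (X t) w.
have mv t : measurable_fun setT (v t) by exact: (measurable_velocity phiM mphi).
have vM t w : `|v t w| <= M by exact: (velocity_norm phiM mphi).
pose U t w := dotv (grad f (X t w)) (v t w).
have bU t : bounded_measurable (U t).
  split.
    apply: measurable_dotv => //; apply: measurableT_comp (mX t).
    exact: measurable_grad.
  by exists (n%:R * (A * M)) => w; rewrite (le_trans (norm_dotv_sup _ _))// ler_wpM2l// ler_pM.
have bF t : bounded_measurable (fun w => f (X t w)).
  by split; [exact: measurableT_comp (mX t)|exists B].
have meanE t : 0 <= t <= T -> \int[mu t]_x f x = \int[P]_w f (X t w).
  move=> tT; rewrite (eq_meas_Rintegral _ (muX t tT)) bounded_Rintegral_law//.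
  by split => //; exists B.
pose flux (z : Rn * Rn) := dotv (grad f z.1) z.2.
have mflux : measurable_fun setT flux.
  apply: measurable_dotv; last exact: measurable_snd.
  by apply: measurableT_comp measurable_fst; exact: measurable_grad.
have fluxM : exists c, forall x v, `|v| <= M -> `|flux (x, v)| <= c.
  exists (n%:R * (A * M)) => x u uM.
  by rewrite (le_trans (norm_dotv_sup _ _))// ler_wpM2l// ler_pM.
have rateE t : 0 <= t <= T -> \int[interaction_pvf mphi (mu t)]_z flux z = \int[P]_w U t w.
  move=> tT; have [_ ->] := interaction_integral (mu t) mflux fluxM.
  rewrite (eq_meas_Rintegral _ (muX t tT)) bounded_Rintegral_law.
    apply: eq_Rintegral => w _; rewrite /flux /U /v /=; congr dotv.
    rewrite (velocity_law phiM mphi _ (mX t)).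
    exact: mean_velocity_ext (muX t tT).
  split.
    by apply: (measurableT_comp mflux); exact: measurable_velocity_graph.
  by have [c cP] := fluxM; exists c => x; apply: cP; exact: mean_velocity_norm.
(* [Q1] adds the Taylor remainder of f and the remainder of the flow; [Q2] adds the variations in
   time of the gradient and of the velocity. *)
pose Q1 := A * (M + C * T) ^+ 2 + n%:R * (A * C).
pose Q2 := n%:R * (A * (M + C * T) * M + A * (K * (M + C * T))).
have T0' := ltW T0.
have MC0 : 0 <= M + C * T by rewrite addr_ge0// mulr_ge0.
have Q10 : 0 <= Q1 by rewrite addr_ge0// mulr_ge0// ?sqr_ge0// mulr_ge0.
have Q20 : 0 <= Q2 by rewrite mulr_ge0// addr_ge0// mulr_ge0// mulr_ge0.
have H1 t h : 0 <= t -> 0 <= h -> t + h <= T ->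
    `|\int[P]_w f (X (t + h) w) - \int[P]_w f (X t w) - h * \int[P]_w U t w| <= Q1 * h ^+ 2.
  move=> t0 h0 tT.
  rewrite -bounded_RintegralB// -bounded_RintegralZ// -bounded_RintegralB//; last 2 first.
  - exact: bounded_measurableB.
  - exact: bounded_measurableZ.
  apply: norm_Rintegral_le.
    by apply: bounded_measurableB; [exact: bounded_measurableB|exact: bounded_measurableZ].
  move=> w; have Xl := flow_lipschitz phiM mphi C0 fX w t0 h0 tT.
  have Xe := XC t h w t0 h0 tT.
  set y := X (t + h) w in Xl Xe *; set x := X t w in Xl Xe *.
  rewrite (_ : _ - _ = (f y - f x - dotv (grad f x) (y - x)) +
    dotv (grad f x) (y - x - h *: v t w)); last first.
    by rewrite /U !dotvBr dotvZr -/x; ring.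
  rewrite (le_trans (ler_normD _ _))// mulrDl lerD//.
    rewrite (le_trans (fT _ _))// -mulrA ler_wpM2l// -exprMn.
    by rewrite lerXn2r ?nnegrE// mulr_ge0.
  rewrite (le_trans (norm_dotv_sup _ _))// -mulrA ler_wpM2l// -mulrA.
  by rewrite ler_pM.
have H2 t h : 0 <= t -> 0 <= h -> t + h <= T ->
    `|\int[P]_w U (t + h) w - \int[P]_w U t w| <= Q2 * h.
  move=> t0 h0 tT; rewrite -bounded_RintegralB//.
  apply: norm_Rintegral_le; first exact: bounded_measurableB.
  move=> w; have Xl := flow_lipschitz phiM mphi C0 fX w t0 h0 tT.
  have vl := vK _ _ P T C X C0 fX t h w t0 h0 tT.
  rewrite -/(v _ _) -/(v _ _) in vl.
  rewrite (_ : _ - _ = dotv (grad f (X (t + h) w) - grad f (X t w)) (v (t + h) w) +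
    dotv (grad f (X t w)) (v (t + h) w - v t w)); last first.
    by rewrite dotvBl dotvBr /U; ring.
  rewrite (le_trans (ler_normD _ _))// /Q2 -mulrA mulrDl mulrDr lerD//.
    rewrite (le_trans (norm_dotv_sup _ _))// ler_wpM2l//.
    rewrite (_ : _ * M * h = (A * ((M + C * T) * h)) * M); last by ring.
    by rewrite ler_pM// (le_trans (gL _ _))// ler_wpM2l.
  rewrite (le_trans (norm_dotv_sup _ _))// ler_wpM2l//.
  by rewrite -!mulrA ler_pM// mulrA.
have in0 t h : 0 <= t -> 0 <= h -> t + h <= T -> 0 <= t <= T /\ 0 <= t + h <= T.
  by move=> t0 h0 tT; split; apply/andP; split => //; lra.
split.
- exists (fun t => \int[P]_w U t w); split; first exact: lipschitz_integrable H2.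
  apply: aeW => s sT; split; first by have [] := interaction_integral (mu s) mflux fluxM.
  exact: rateE.
- apply: (@lipschitz_abs_continuous _ _ _ (Q1 * T + n%:R * (A * M))).
    by rewrite addr_ge0// mulr_ge0// mulr_ge0.
  move=> t h t0 h0 tT; have [tt tth] := in0 t h t0 h0 tT.
  rewrite !meanE//; have := H1 t h t0 h0 tT.
  set a := \int[P]_w _; set b := \int[P]_w _; set c := \int[P]_w _ => h1.
  have h2 : `|h * c| <= h * (n%:R * (A * M)).
    rewrite normrM ger0_norm// ler_wpM2l// norm_Rintegral_le// => w.
    by rewrite (le_trans (norm_dotv_sup _ _))// ler_wpM2l// ler_pM.
  have h3 : Q1 * h ^+ 2 <= Q1 * (T * h) by rewrite ler_wpM2l// expr2 ler_wpM2r//; lra.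
  have := ler_normD (a - b - h * c) (h * c); rewrite subrK; lra.
(* The derivative exists at every interior time. At the end points it would depend on the values of
   mu outside [0, T]. *)
have N0 : (@lebesgue_measure R).-negligible [set 0; T].
  have neg1 (a : R) : (@lebesgue_measure R).-negligible [set a].
    by exists [set a]; split => //; exact: lebesgue_measure_set1.
  exact: negligibleU (neg1 0) (neg1 T).
apply: negligibleS N0 => t /= /not_implyP[/andP[t0 tT] nd].
apply: contrapT => /not_orP[/eqP t0' /eqP tT']; apply: nd.
apply: (@expansion_is_derive R _ (fun t => \int[mu t]_x f x)
  (fun t => \int[interaction_pvf mphi (mu t)]_z flux z) T (Q1 + Q2)).
- move=> s h s0 h0 sT; have [ss ssh] := in0 s h s0 h0 sT.
  rewrite !meanE// rateE// /GRing.scale /= (le_trans (H1 s h s0 h0 sT))//.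
  by rewrite ler_wpM2r ?sqr_ge0// lerDl.
- move=> s h s0 h0 sT; have [ss ssh] := in0 s h s0 h0 sT.
  by rewrite !rateE// (le_trans (H2 s h s0 h0 sT))// ler_wpM2r// lerDr.
by rewrite lt_def t0' t0 /= lt_def eq_sym tT' tT.
Qed.

End flow_is_solution.

(** * Regularity of the interaction field *)

Section full_measure.
Context d (X : measurableType d) (R : realType).
Variable P : probability X R.

Lemma prob1_sub A B : measurable A -> measurable B -> A `<=` B -> P A = 1%E -> P B = 1%E.
Proof.
move=> mA mB AB PA; apply/eqP; rewrite eq_le probability_le1//= -PA.
exact: (@le_meas _ _ _ P).
Qed.

Lemma prob1_setI A B : measurable A -> measurable B -> P B = 1%E -> P A = P (A `&` B).
Proof.
move=> mA mB PB; apply/eqP; rewrite eq_le; apply/andP; split; last first.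
  by apply: (@le_meas _ _ _ P) => //; exact: measurableI.
have PB0 : P (~` B) = 0%E by rewrite probability_setC// PB subee.
have mC : measurable (~` B) by exact: measurableC.
apply: (@le_trans _ _ (P (A `&` B) + P (~` B))%E); last by rewrite PB0 adde0.
apply: le_trans (measureU2 P (measurableI _ _ mA mB) mC).
apply: (@le_meas _ _ _ P) => //; first by apply: measurableU => //; exact: measurableI.
by move=> x Ax; have [Bx|Bx] := pselect (B x); [left|right].
Qed.

Lemma prob1_ae (A : set X) (Q : X -> Prop) : measurable A -> P A = 1%E ->
  (forall x, A x -> Q x) -> {ae P, forall x, Q x}.
Proof.
move=> mA PA AQ; exists (~` A); split; first exact: measurableC.
  by have := probability_setC P mA; rewrite PA subee// => <-.
by move=> x /= nQ Ax; apply: nQ; exact: AQ.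
Qed.

End full_measure.

Section truncation.
Variables (R : realType) (n : nat).
Local Notation Rn := 'rV[R]_n.

(* The identity of R^n, made bounded without changing it mu-almost everywhere
   when mu is carried by the ball. *)
Definition trunc (r : R) (x : Rn) : Rn := if enorm x < r then x else 0.

Lemma truncE r x : @eball R n r x -> trunc r x = x.
Proof. by rewrite /trunc /eball /= => ->. Qed.

Lemma trunc_norm r x : 0 <= r -> `|trunc r x| <= r.
Proof.
move=> r0; rewrite /trunc; case: ifPn => [xr|]; last by rewrite normr0.
by rewrite (le_trans (norm_le_enorm _))// ltW.
Qed.

Lemma measurable_eball r : measurable (@eball R n r).
Proof. by apply: measurable_open; exact: open_eball. Qed.

Lemma measurable_trunc r : measurable_fun setT (trunc r).
Proof.
rewrite (_ : trunc r = fun x => (\1_(@eball R n r) x : R) *: x).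
  apply: measurable_fun_row => i.
  rewrite (_ : (fun _ => _) = fun x : Rn => (\1_(@eball R n r) x : R) * x ord0 i).
    apply: measurable_funM; last exact: measurable_coord.
    by apply: measurable_indic; exact: measurable_eball.
  by apply/funext => x; rewrite mxE.
apply/funext => x; rewrite indicE /trunc; case: ifPn => xr.
  by rewrite mem_set// scale1r.
by rewrite memNset ?scale0r//; exact/negP.
Qed.

Lemma law_trunc (mu : probability Rn R) r : mu (@eball R n r) = 1%E ->
  eq_meas (law mu (measurable_trunc r)) mu.
Proof.
move=> mur A mA; have mb := measurable_eball r.
have mtA : measurable (trunc r @^-1` A).
  by rewrite -[X in measurable X]setTI; exact: measurable_trunc.
rewrite lawE (prob1_setI mtA mb mur) [RHS](prob1_setI mA mb mur).
congr (mu _); apply/seteqP; split => x [/= Ax xr]; split => //.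
  by move: Ax; rewrite truncE.
by rewrite /preimage /= truncE.
Qed.

Lemma coupling_eball (mu nu : probability Rn R) (tau : probability (Rn * Rn)%type R) r :
  coupling mu nu tau -> mu (@eball R n r) = 1%E -> nu (@eball R n r) = 1%E ->
  tau [set z | eball r z.1 /\ eball r z.2] = 1%E.
Proof.
move=> [t1 t2] mur nur; have mb := measurable_eball r.
apply: (@prob_setI1 _ _ _ tau (fst @^-1` eball r) (snd @^-1` eball r)).
- by rewrite -[X in measurable X]setTI; exact: measurable_fst.
- by rewrite -[X in measurable X]setTI; exact: measurable_snd.
- by rewrite -mur -(t1 _ mb).
- by rewrite -nur -(t2 _ mb).
Qed.

Lemma measurable_eball2 r : measurable [set z : Rn * Rn | eball r z.1 /\ eball r z.2].
Proof.
apply: measurableI.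
- by rewrite -[X in measurable X]setTI; apply: measurable_fst => //; exact: measurable_eball.
- by rewrite -[X in measurable X]setTI; apply: measurable_snd => //; exact: measurable_eball.
Qed.

Lemma bounded_measurable_enorm d (O : measurableType d) (X Y : O -> Rn) (r : R) :
  measurable_fun setT X -> measurable_fun setT Y ->
  (forall w, `|X w| <= r) -> (forall w, `|Y w| <= r) ->
  bounded_measurable (fun w => enorm (X w - Y w)).
Proof.
move=> mX mY Xr Yr; split; first by apply: measurable_enorm; exact: measurable_rowB.
exists (n%:R * (r + r)) => w; rewrite ger0_norm ?enorm_ge0//.
rewrite (le_trans (enorm_le_norm _))// ler_wpM2l//.
by rewrite (le_trans (ler_normB _ _))// lerD.
Qed.

Lemma trunc_cost (mu nu : probability Rn R) (tau : probability (Rn * Rn)%type R) r :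
  0 <= r -> coupling mu nu tau -> mu (@eball R n r) = 1%E -> nu (@eball R n r) = 1%E ->
  (\int[tau]_z enorm (trunc r z.1 - trunc r z.2))%:E = transport_cost tau.
Proof.
move=> r0 ct mur nur.
have m1 : measurable_fun setT (fun z : Rn * Rn => trunc r z.1).
  by apply: (measurableT_comp _ measurable_fst); exact: measurable_trunc.
have m2 : measurable_fun setT (fun z : Rn * Rn => trunc r z.2).
  by apply: (measurableT_comp _ measurable_snd); exact: measurable_trunc.
have b12 : bounded_measurable (fun z : Rn * Rn => enorm (trunc r z.1 - trunc r z.2)).
  by apply: bounded_measurable_enorm (r) _ _ _ _ => // w; exact: trunc_norm.
rewrite -bounded_EFin_Rintegral//.
apply: ae_eq_integral => //.
- by apply/measurable_EFinP; exact: b12.1.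
- exact: measurable_transport_cost.
apply: (prob1_ae (measurable_eball2 r) (coupling_eball ct mur nur)).
by move=> z [z1 z2] _; rewrite !truncE.
Qed.

End truncation.

Section interaction_regularity.
Variables (R : realType) (n : nat) (phi : 'rV[R]_n -> 'rV[R]_n) (M : R).
Local Notation Rn := 'rV[R]_n.
Hypothesis phiM : forall x, `|phi x| <= M.
Hypothesis mphi : measurable_fun setT phi.
Hypothesis phiL : forall r : R, exists L : R, 0 < L /\
  forall x y, `|x| <= r -> `|phi x - phi y| <= L * `|x - y|.

Let M0 : 0 <= M. Proof. by rewrite (le_trans _ (phiM 0)). Qed.

Lemma interaction_calW_lipschitz : locally_calW_lipschitz (interaction_pvf mphi).
Proof.
move=> r r0; have [L [L0 Lr]] := phiL (r + r).
have r0' := ltW r0; have L0' := ltW L0.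
(* n compares the norms, 2 counts the averaged and the own displacement, 1 makes K positive. *)
pose K := n%:R * L * 2 + 1.
have K0 : 0 < K by rewrite ltr_wpDl// mulr_ge0// mulr_ge0.
exists K; split => // mu nu mur nur.
have mb := measurable_eball (n := n) r.
have {}mur := supp_full mb mur; have {}nur := supp_full mb nur.
have [Woo|Woo] := ltP (W mu nu) +oo%E; last first.
  by move: Woo; rewrite leye_eq => /eqP ->; rewrite gt0_muley ?lte_fin// leey.
have [tau [otau tauW]] := optimal_coupling_exists mur nur Woo.
have ct := otau.1.
apply: (@le_trans _ _ (K%:E * transport_cost tau)%E); last first.
  by rewrite lee_pmul2l// ?lte_fin.
pose g (z : Rn * Rn) := ((z.1, mean_velocity phi mu z.1), (z.2, mean_velocity phi nu z.2)).
have m1 : measurable_fun setT (fun z : Rn * Rn => (z.1, mean_velocity phi mu z.1)).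
  exact: (measurableT_comp (measurable_velocity_graph mphi mu) measurable_fst).
have m2 : measurable_fun setT (fun z : Rn * Rn => (z.2, mean_velocity phi nu z.2)).
  exact: (measurableT_comp (measurable_velocity_graph mphi nu) measurable_snd).
have mg : measurable_fun setT g by exact: measurable_fun_pair.
apply: (@le_trans _ _ (\int[law tau mg]_z (enorm (z.1.2 - z.2.2))%:E)%E).
  (* The optimal coupling is lifted along the graphs of the two mean velocities; its projection by
     [pi13] is [tau] itself, hence optimal. *)
  apply: ereal_inf_lbound; exists (law tau mg) => //; split.
    split => A mA; rewrite /pushforward lawE.
      rewrite (interaction_law mphi mu mA) lawE -ct.1//.
      by rewrite -[X in measurable X]setTI; exact: measurable_velocity_graph.
    rewrite (interaction_law mphi nu mA) lawE -ct.2//.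
    by rewrite -[X in measurable X]setTI; exact: measurable_velocity_graph.
  have -> : pushforward (law tau mg) (@pi13 R n) = tau :> (set _ -> \bar R).
    apply/funext => A; rewrite /pushforward lawE; congr (tau _).
    by apply/seteqP; split => -[].
  split; first by split => A mA; rewrite pvf_proj//; [exact: ct.1|exact: ct.2].
  move=> t' [c1 c2]; apply: otau.2; split => A mA.
    by rewrite c1// pvf_proj.
  by rewrite c2// pvf_proj.
have mdiff : measurable_fun setT (fun z : (Rn * Rn) * (Rn * Rn) => (enorm (z.1.2 - z.2.2))%:E).
  apply/measurable_EFinP; apply: measurable_enorm; apply: measurable_rowB.
    exact: (measurableT_comp measurable_snd measurable_fst).
  exact: (measurableT_comp measurable_snd measurable_snd).
rewrite ge0_integral_law//; last by move=> y; rewrite lee_fin enorm_ge0.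
pose X (z : Rn * Rn) := trunc r z.1; pose Y (z : Rn * Rn) := trunc r z.2.
have mX : measurable_fun setT X.
  by apply: (measurableT_comp _ measurable_fst); exact: measurable_trunc.
have mY : measurable_fun setT Y.
  by apply: (measurableT_comp _ measurable_snd); exact: measurable_trunc.
have Xr z : `|X z| <= r by exact: trunc_norm.
have Yr z : `|Y z| <= r by exact: trunc_norm.
have bXY := bounded_measurable_enorm mX mY Xr Yr.
pose I := \int[tau]_z enorm (X z - Y z).
have IE : I%:E = transport_cost tau by exact: (trunc_cost r0' ct mur nur).
have I0 : 0 <= I by apply: Rintegral_ge0 => z _; exact: enorm_ge0.
have lX : eq_meas (law tau mX) mu.
  move=> A mA; have mtA : measurable (trunc r @^-1` A : set Rn).
    by rewrite -[X in measurable X]setTI; exact: measurable_trunc.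
  by rewrite lawE -(law_trunc mur mA) lawE -(ct.1 _ mtA).
have lY : eq_meas (law tau mY) nu.
  move=> A mA; have mtA : measurable (trunc r @^-1` A : set Rn).
    by rewrite -[X in measurable X]setTI; exact: measurable_trunc.
  by rewrite lawE -(law_trunc nur mA) lawE -(ct.2 _ mtA).
have bnd : bounded_measurable (fun z => n%:R * L * (I + enorm (X z - Y z))).
  apply: bounded_measurableZ; apply: bounded_measurableD => //.
  exact: bounded_measurable_cst.
apply: (@le_trans _ _ (\int[tau]_z (n%:R * L * (I + enorm (X z - Y z)))%:E)%E).
  apply: ae_ge0_le_integral => //.
  - by move=> z _; rewrite lee_fin enorm_ge0.
  - exact: (measurableT_comp mdiff mg).
  - by move=> z _; rewrite lee_fin mulr_ge0 ?mulr_ge0// addr_ge0// enorm_ge0.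
  - by apply/measurable_EFinP; exact: bnd.1.
  apply: (prob1_ae (measurable_eball2 r) (coupling_eball ct mur nur)).
  move=> z [z1 z2] _; rewrite lee_fin /=.
  have := velocity_dist phiM mphi tau mX mY Xr Yr L0' Lr z.
  rewrite (velocity_law phiM mphi tau mX) (velocity_law phiM mphi tau mY).
  rewrite (mean_velocity_ext phi _ lX) (mean_velocity_ext phi _ lY) {1}/X {1}/Y !truncE// => H.
  rewrite (le_trans (enorm_le_norm _))// -mulrA ler_wpM2l//.
  apply: (le_trans H); rewrite ler_wpM2l// lerD ?norm_le_enorm//.
  apply: bounded_le_Rintegral => //.
    exact: bounded_measurable_dist Xr Yr.
  by move=> w; exact: norm_le_enorm.
rewrite bounded_EFin_Rintegral// bounded_RintegralZ; last first.
  by apply: bounded_measurableD => //; exact: bounded_measurable_cst.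
rewrite bounded_RintegralD//; last exact: bounded_measurable_cst.
rewrite Rintegral_prob_cst -/I -IE -EFinM lee_fin /K; lra.
Qed.

Lemma supp_nonempty (mu : probability Rn R) : exists x, supp mu x.
Proof.
apply: contrapT => /forallNP e; have := @supp_full _ _ mu set0 measurable0.
by rewrite measure0 => /(_ (fun x sx => e x sx))/eqP; rewrite eq_sym onee_eq0.
Qed.

(** All velocities have Euclidean norm at most n * M. The support of mu is nonempty, which keeps the
    supremum on the right from being -oo. *)
Lemma interaction_linear_growth :
  exists C : R, 0 < C /\ linear_growth (interaction_pvf mphi) C.
Proof.
pose C := n%:R * M + 1; have C0 : 0 < C by rewrite ltr_wpDl// mulr_ge0.
exists C; split => // mu _.
apply: (@le_trans _ _ C%:E); last first.
  rewrite -[leLHS]mule1 lee_pmul2l ?lte_fin// -[leLHS]adde0 leeD2l//.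
  have [x sx] := supp_nonempty mu.
  apply: (@le_trans _ _ (enorm x)%:E); first by rewrite lee_fin enorm_ge0.
  by apply: ereal_sup_ubound; exists x.
apply: ge_ereal_sup => _ [[x v] sv <-] /=; rewrite lee_fin leNgt; apply/negP => Cv.
pose U : set (Rn * Rn) := snd @^-1` [set v | C < enorm v].
have oU' : open [set v : Rn | C < enorm v].
  rewrite (_ : mkset _ = (fun x : Rn => enorm x) @^-1` [set y | C < y])//.
  by apply: open_comp => [y _|]; [exact: enorm_continuous|exact: open_gt].
have oU : open U by apply: open_comp => // y _; exact: cvg_snd.
have := sv U oU Cv; rewrite (interaction_law mphi mu); last exact: measurable_open_prod.
rewrite lawE (_ : _ @^-1` _ = set0) ?measure0 ?ltxx//.
rewrite -subset0 => y /=; apply/negP; rewrite -leNgt.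
rewrite (le_trans (enorm_le_norm _))// /C ler_wpDr// ler_wpM2l//.
exact: mean_velocity_norm.
Qed.

End interaction_regularity.

(** * Dependence on the initial data *)

Section flow_dependence.
Variables (R : realType) (n : nat) (phi : 'rV[R]_n -> 'rV[R]_n) (M : R).
Local Notation Rn := 'rV[R]_n.
Hypothesis phiM : forall x, `|phi x| <= M.
Hypothesis mphi : measurable_fun setT phi.
Hypothesis phiL : forall r : R, exists L : R, 0 < L /\
  forall x y, `|x| <= r -> `|phi x - phi y| <= L * `|x - y|.

Let M0 : 0 <= M. Proof. by rewrite (le_trans _ (phiM 0)). Qed.

Lemma flow_weaken d (O : measurableType d) (P : probability O R) T r r' C C' X :
  r <= r' -> C <= C' -> is_flow phi P T r C X -> is_flow phi P T r' C' X.
Proof.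
move=> rr' CC' [mX Xr XC]; split => // [t w tT|t h w t0 h0 tT].
  exact: le_trans (Xr t w tT) rr'.
by rewrite (le_trans (XC t h w t0 h0 tT))// ler_wpM2r// sqr_ge0.
Qed.

Lemma flow_comp d d' (O : measurableType d) (O' : measurableType d')
    (P : probability O R) (P' : probability O' R) (g : O' -> O)
    (mg : measurable_fun setT g) T r C (X : R -> O -> Rn) :
  eq_meas (law P' mg) P -> is_flow phi P T r C X ->
  is_flow phi P' T r C (fun t => X t \o g).
Proof.
move=> gP [mX Xr XC]; split => [t|t w tT|t h w t0 h0 tT].
- exact: measurableT_comp (mX t) mg.
- exact: Xr.
- by rewrite (velocity_comp phiM mphi (mX t) gP) /=; exact: XC.
Qed.

Lemma flow_shift d (O : measurableType d) (P : probability O R) T r C X s :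
  0 <= s -> is_flow phi P T r C X -> is_flow phi P (T - s) r C (fun t => X (s + t)).
Proof.
move=> s0 [mX Xr XC]; split => [t|t w /andP[t0 tT]|t h w t0 h0 tT].
- exact: mX.
- by apply: Xr; rewrite addr_ge0//=; lra.
- by rewrite addrA; apply: XC => //; [exact: addr_ge0|lra].
Qed.

Lemma flow_shorten d (O : measurableType d) (P : probability O R) T T' r C X :
  T' <= T -> is_flow phi P T r C X -> is_flow phi P T' r C X.
Proof.
move=> TT [mX Xr XC]; split => // [t w /andP[t0 tT]|t h w t0 h0 tT].
  by apply: Xr; rewrite t0 (le_trans tT).
by apply: XC => //; exact: le_trans tT TT.
Qed.

(** Averaging the velocity comparison counts the mean distance twice, whence the rate 2 * n * L. The
    constant is chosen before the label space, so it can be used on every coupling of two initial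
    measures. *)
Lemma flow_stability r : exists K, 0 < K /\
  forall d (O : measurableType d) (P : probability O R) T C X Y,
  0 <= C -> is_flow phi P T r C X -> is_flow phi P T r C Y ->
  forall t, 0 <= t <= T ->
  \int[P]_w enorm (X t w - Y t w) <= expR (K * t) * \int[P]_w enorm (X 0 w - Y 0 w).
Proof.
have [L [L0 Lr]] := phiL (r + r); have L0' := ltW L0.
have nL0 : 0 <= n%:R * L by rewrite mulr_ge0.
pose K := 2 * (n%:R * L) + 1.
have K0 : 0 < K by rewrite ltr_wpDl// mulr_ge0.
exists K; split => // d O P T C X Y C0 fX fY t tT.
have [mX Xr XC] := fX; have [mY Yr YC] := fY.
pose g t := \int[P]_w enorm (X t w - Y t w).
have bg t' : 0 <= t' <= T -> bounded_measurable (fun w => enorm (X t' w - Y t' w)).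
  by move=> t'T; apply: bounded_measurable_enorm (r) _ _ _ _ => // w; [exact: Xr|exact: Yr].
have g0 t' : 0 <= g t' by apply: Rintegral_ge0 => w _; exact: enorm_ge0.
(* The remainders of the two flows, converted to the Euclidean norm. *)
pose D := 2 * (n%:R * C).
have D0 : 0 <= D by rewrite mulr_ge0// mulr_ge0.
apply/ler_addgt0Pr => e e0.
apply: (@gronwall _ (fun t b => g t <= b) T K D) => //.
- exact: ltW.
- exact: (g0 0).
- by move=> s b c; exact: le_trans.
move=> s h b s0 h0 sT b0 gb.
have ss : 0 <= s <= T by apply/andP; split=> //; lra.
have ssh : 0 <= s + h <= T by apply/andP; split=> //; lra.
have bd := bg s ss.
apply: (@le_trans _ _ (\int[P]_w ((1 + h * (n%:R * L)) * enorm (X s w - Y s w) +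
    (h * (n%:R * L) * b + D * h ^+ 2)))); last first.
  rewrite bounded_RintegralD; [|exact: bounded_measurableZ|exact: bounded_measurable_cst].
  rewrite bounded_RintegralZ// Rintegral_prob_cst -/(g s).
  apply: (@le_trans _ _ ((1 + h * (n%:R * L)) * b + (h * (n%:R * L) * b + D * h ^+ 2))).
    by rewrite lerD2r ler_wpM2l// addr_ge0// mulr_ge0.
  rewrite /K; have := mulr_ge0 h0 b0; lra.
apply: bounded_le_Rintegral; first exact: bg.
  apply: bounded_measurableD; last exact: bounded_measurable_cst.
  exact: bounded_measurableZ.
move=> w; set vX := velocity phi P (X s) w; set vY := velocity phi P (Y s) w.
have Xe := XC s h w s0 h0 sT; have Ye := YC s h w s0 h0 sT.
have vv : enorm (vX - vY) <= n%:R * L * (b + enorm (X s w - Y s w)).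
  rewrite (le_trans (enorm_le_norm _))// -mulrA ler_wpM2l//.
  apply: (le_trans (velocity_dist phiM mphi P (mX s) (mY s) _ _ L0' Lr w)).
  - by move=> w'; exact: Xr.
  - by move=> w'; exact: Yr.
  rewrite ler_wpM2l// lerD ?norm_le_enorm//; apply: le_trans gb.
  apply: bounded_le_Rintegral => //; last by move=> w'; exact: norm_le_enorm.
  by apply: (bounded_measurable_dist (r := r)) => // w'; [exact: Xr|exact: Yr].
rewrite -/vX in Xe; rewrite -/vY in Ye.
have Xe' := le_trans (enorm_le_norm _) (ler_wpM2l (ler0n R n) Xe).
have Ye' := le_trans (enorm_le_norm _) (ler_wpM2l (ler0n R n) Ye).
rewrite (_ : X (s + h) w - Y (s + h) w = (X s w - Y s w) + h *: (vX - vY) +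
  ((X (s + h) w - X s w - h *: vX) - (Y (s + h) w - Y s w - h *: vY))).
  2: by move: (vX) (vY) (X s w) (Y s w) (X (s + h) w) (Y (s + h) w) => a1 a2 a3 a4 a5 a6;
     apply/rowP => i; rewrite !mxE; ring.
have t1 := enormD ((X s w - Y s w) + h *: (vX - vY))
  ((X (s + h) w - X s w - h *: vX) - (Y (s + h) w - Y s w - h *: vY)).
have t2 := enormD (X s w - Y s w) (h *: (vX - vY)).
have t3 := enormD (X (s + h) w - X s w - h *: vX) (- (Y (s + h) w - Y s w - h *: vY)).
rewrite enormN in t3; rewrite enormZ ger0_norm// in t2.
have t4 := ler_wpM2l h0 vv.
apply: (le_trans t1).
apply: (le_trans (lerD (le_trans t2 (lerD (lexx _) t4)) (le_trans t3 (lerD Xe' Ye')))).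
rewrite le_eqVlt; apply/orP; left; apply/eqP; rewrite /D.
by move: (enorm _) => q; ring.
Qed.

(* Two flows transported from the same initial law have the same laws, because
   the flow of one can be pulled back to the label space of the other. *)
Lemma flow_law_unique d d' (O : measurableType d) (O' : measurableType d')
    (P : probability O R) (P' : probability O' R) (g : O' -> O)
    (mg : measurable_fun setT g) T r r' C C' (X : R -> O -> Rn) (Y : R -> O' -> Rn)
    (mX : forall t, measurable_fun setT (X t)) (mY : forall t, measurable_fun setT (Y t)) :
  0 <= C -> eq_meas (law P' mg) P -> is_flow phi P T r C X -> is_flow phi P' T r' C' Y ->
  {ae P', forall w, X 0 (g w) = Y 0 w} ->
  forall t, 0 <= t <= T -> eq_meas (law P (mX t)) (law P' (mY t)).
Proof.
move=> C0 gP fX fY XY t tT.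
have fXg := flow_comp gP fX.
pose rr := Num.max r r'; pose CC := Num.max C C'.
have CC0 : 0 <= CC by rewrite le_max C0.
have fX' : is_flow phi P' T rr CC (fun t => X t \o g).
  by apply: flow_weaken fXg; rewrite le_max lexx.
have fY' : is_flow phi P' T rr CC Y by apply: flow_weaken fY; rewrite le_max lexx orbT.
have [K [K0 KP]] := flow_stability rr.
have T00 : (0 : R) <= 0 <= T by rewrite lexx /=; case/andP: tT => t0; exact: le_trans.
have mXg s : measurable_fun setT (X s \o g) by exact: measurableT_comp (mX s) mg.
have b s : 0 <= s <= T -> bounded_measurable (fun w => enorm ((X s \o g) w - Y s w)).
  have [_ Xr _] := fX'; have [_ Yr _] := fY'.
  by move=> sT; apply: bounded_measurable_enorm (rr) _ _ _ _ => // w; [exact: Xr|exact: Yr].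
(* The flows start at the same point for almost every label; stability keeps their mean distance
   zero. *)
have I0 : \int[P']_w enorm ((X 0 \o g) w - Y 0 w) = 0.
  have IE : (\int[P']_w (enorm ((X 0 \o g) w - Y 0 w))%:E = \int[P']_w (cst 0 w))%E.
    apply: ae_eq_integral => //.
      by apply/measurable_EFinP; exact: (b 0 T00).1.
    by apply: filterS XY => w /= -> _; rewrite subrr enorm0.
  by rewrite /Rintegral IE integral0.
have It : \int[P']_w enorm ((X t \o g) w - Y t w) <= 0.
  by have := KP _ _ P' T CC _ _ CC0 fX' fY' t tT; rewrite /= I0 mulr0.
have eg : eq_meas (law P (mX t)) (law P' (mXg t)).
  move=> A mA; have mXA : measurable (X t @^-1` A).
    by rewrite -[X in measurable X]setTI; exact: mX.
  exact: esym (gP _ mXA).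
have H : eq_meas (law P' (mXg t)) (law P' (mY t)).
  apply: eq_meas_W => e e0; exists (law P' (mY t)).
  split; apply: le_lt_trans (W_law _ _ _) _.
    by rewrite bounded_EFin_Rintegral ?lte_fin ?(le_lt_trans It)//; exact: b.
  rewrite (eq_integral (cst 0%E)) ?integral0 ?lte_fin// => w _.
  by rewrite subrr enorm0.
by move=> A mA; rewrite eg// H.
Qed.

End flow_dependence.

(** * Spread of the support *)

Section flow_support.
Variables (R : realType) (n : nat) (phi : 'rV[R]_n -> 'rV[R]_n) (M : R).
Local Notation Rn := 'rV[R]_n.
Hypothesis phiM : forall x, `|phi x| <= M.
Hypothesis mphi : measurable_fun setT phi.
Hypothesis phiL : forall r : R, exists L : R, 0 < L /\
  forall x y, `|x| <= r -> `|phi x - phi y| <= L * `|x - y|.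

Lemma mean_velocity_continuous d (O : measurableType d) (P : probability O R)
    (X : O -> Rn) (mX : measurable_fun setT X) (r : R) :
  (forall w, `|X w| <= r) -> continuous (mean_velocity phi (law P mX)).
Proof.
move=> Xr x; have [L [L0 Lr]] := phiL (r + `|x|).
have mid := @measurable_id _ Rn setT.
have mvL y : `|mean_velocity phi (law P mX) x - mean_velocity phi (law P mX) y| <= L * `|x - y|.
  apply: rV_norm_le => [|i]; first by rewrite mulr_ge0// ltW.
  have bx := bounded_measurable_phi phiM mphi x i mX.
  have by_ := bounded_measurable_phi phiM mphi y i mX.
  rewrite !mxE !bounded_Rintegral_law//; last 2 first.
  - exact: (bounded_measurable_phi phiM mphi y i mid).
  - exact: (bounded_measurable_phi phiM mphi x i mid).
  rewrite -bounded_RintegralB//; apply: norm_Rintegral_le; first exact: bounded_measurableB.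
  move=> u; have := coord_norm_le (phi (X u - x) - phi (X u - y)) i; rewrite !mxE.
  move=> /le_trans; apply; have xr : `|X u - x| <= r + `|x|.
    by rewrite (le_trans (ler_normB _ _))// lerD2r.
  apply: (le_trans (Lr _ (X u - y) xr)); rewrite ler_wpM2l// ?(ltW L0)//.
  rewrite (_ : X u - x - (X u - y) = - (x - y)) ?normrN//.
  by apply/rowP => j; rewrite !mxE; ring.
apply/(@cvgrPdist_lt _ _ _ (nbhs x) (nbhs_filter x)) => e e0.
apply/nbhs_ballP; exists (e / L) => /=; first by rewrite divr_gt0.
move=> y; rewrite -ball_normE /= ltr_pdivlMr// mulrC; exact: le_lt_trans.
Qed.

(** Continuity of the mean velocity pulls a neighbourhood of the graph point back to a neighbourhood
    of y, which mu charges. *)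
Lemma supp_interaction (mu : probability Rn R) (y : Rn) :
  continuous (mean_velocity phi mu) -> supp mu y ->
  supp (interaction_pvf mphi mu) (y, mean_velocity phi mu y).
Proof.
move=> cmv sy U oU Uy.
have /= : nbhs (y, mean_velocity phi mu y) U by exact: open_nbhs_nbhs.
move=> [[A B] /= [Ay By] ABU].
pose G := A `&` (mean_velocity phi mu) @^-1` B.
have yG : nbhs y G by apply: filterI => //; exact: cmv.
have Gy : (0 < mu (G^°)%classic)%E.
  by apply: sy; [exact: open_interior|exact: yG].
rewrite (interaction_law mphi mu (measurable_open_prod oU)) lawE.
apply: (lt_le_trans Gy); apply: le_meas.
- by apply: measurable_open; exact: open_interior.
- rewrite -[X in measurable X]setTI; apply: measurable_velocity_graph => //.
  exact: measurable_open_prod.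
by move=> x /interior_subset[Ax Bx]; exact: (ABU (x, mean_velocity phi mu x)).
Qed.

Lemma bounded_closed_compact_enorm (F : set Rn) (r : R) : closed F ->
  (forall x, F x -> enorm x <= r) -> compact F.
Proof.
move=> cF Fr; apply: bounded_closed_compact => //.
exists r; split => [|y ry x Fx /=]; first exact: num_real.
by rewrite (le_trans (norm_le_enorm _))// (le_trans (Fr _ Fx))// ltW.
Qed.

(* Growth is tested on the law of X s, whose support contains almost every
   position, so that the given constant G is the rate at which the support
   spreads. *)
Lemma flow_growth (G : R) : 0 < G -> linear_growth (interaction_pvf mphi) G ->
  forall d (O : measurableType d) (P : probability O R) T r C X (r0 : R)
    (mX : forall t, measurable_fun setT (X t)),
  0 <= r0 -> 0 <= C -> is_flow phi P T r C X ->
  P [set w | enorm (X 0 w) <= r0] = 1%E ->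
  forall t, 0 <= t <= T -> supp (law P (mX t)) `<=` eball (expR (G * t) * (r0 + 1)).
Proof.
move=> G0 lG d O P T r C X r0 mX r00 C0 fX X0r t tT.
have [_ Xr XC] := fX.
(* The added 1 makes the growth homogeneous: positions of norm at most b - 1 have velocity at most G
   * (1 + (b - 1)) = G * b. *)
pose B (s b : R) := [set w | enorm (X s w) + 1 <= b].
have mB s b : measurable (B s b).
  rewrite (_ : B s b = setT `&` X s @^-1` [set x | enorm x <= b - 1]).
    by apply: (mX s) => //; apply: measurable_closed; exact: closed_cball.
  by rewrite setTI; apply/seteqP; split => w; rewrite /B /= lerBrDr.
have H e' : 0 < e' -> P (B t (expR (G * t) * (r0 + 1) + e')) = 1%E.
  move=> e0; apply: (@gronwall _ (fun s b => P (B s b) = 1%E) T G (n%:R * C)) => //.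
  - exact: ltW.
  - exact: mulr_ge0.
  - exact: addr_ge0.
  - move=> s b c Pb bc; apply: prob1_sub Pb => // w /= /le_trans; exact.
  - move=> s h b s0 h0 sT b0 Pb.
    have ss : 0 <= s <= T by apply/andP; split=> //; lra.
    pose mu := law P (mX s).
    have cmv : continuous (mean_velocity phi mu).
      by apply: mean_velocity_continuous => w; exact: Xr.
    have mu1 : mu [set x | enorm x <= b - 1] = 1%E.
      rewrite lawE -Pb; congr (P _); apply/seteqP.
      by split => w; rewrite /B /= lerBrDr.
    have smu := supp_sub (@closed_cball _ _ _) mu1.
    have csupp : compactly_supported mu.
      exact: bounded_closed_compact_enorm (@closed_supp _ _ mu) smu.
    have vb y : supp mu y -> enorm (mean_velocity phi mu y) <= G * b.
      move=> sy; rewrite -lee_fin.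
      apply: (@le_trans _ _ (ereal_sup [set (enorm z.2)%:E | z in supp (interaction_pvf mphi mu)])).
        apply: ereal_sup_ubound; exists (y, mean_velocity phi mu y) => //.
        exact: supp_interaction.
      apply: (le_trans (lG mu csupp)); rewrite EFinM lee_pmul2l// ?lte_fin//.
      apply: (@le_trans _ _ (1 + (b - 1)%:E)%E); last by rewrite -EFinD subrKC.
      rewrite leeD2l//; apply: ge_ereal_sup => _ [x sx <-].
      by rewrite lee_fin; exact: smu.
    have mS : measurable (X s @^-1` supp mu).
      rewrite -[X in measurable X]setTI; apply: (mX s) => //.
      by apply: measurable_closed; exact: closed_supp.
    have PS : P (X s @^-1` supp mu) = 1%E.
      by apply: (@supp_full _ _ mu) => //; apply: measurable_closed; exact: closed_supp.
    apply: (prob1_sub _ _ _ (prob_setI1 (mB s b) mS Pb PS)) => //.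
      exact: measurableI.
    move=> w [/= Xb Xs]; have Xe := XC s h w s0 h0 sT.
    have Xe' := le_trans (enorm_le_norm _) (ler_wpM2l (ler0n R n) Xe).
    rewrite (velocity_law phiM mphi P (mX s)) in Xe'.
    have v1 := ler_wpM2l h0 (vb _ Xs).
    have t1 := enormD (X (s + h) w - X s w - h *: mean_velocity phi mu (X s w))
      (h *: mean_velocity phi mu (X s w) + X s w).
    rewrite addrA subrK subrK in t1.
    have t2 := enormD (h *: mean_velocity phi mu (X s w)) (X s w).
    rewrite enormZ ger0_norm// in t2.
    by move: Xb Xe' v1 t1 t2; rewrite /B /=; lra.
  - rewrite -X0r; congr (P _); apply/seteqP.
    by split => w; rewrite /B /= lerD2r.
(* The 1 in [B] absorbs the Gronwall error e' = 1 / 2 and leaves the strict inequality of the open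
   ball. *)
have mu1 : law P (mX t) [set x | enorm x <= expR (G * t) * (r0 + 1) - 2^-1] = 1%E.
  rewrite lawE -(H 2^-1)//; congr (P _); apply/seteqP.
  by split => w; rewrite /B /=; lra.
move=> x /(supp_sub (@closed_cball _ _ _) mu1); rewrite /eball /=; lra.
Qed.

End flow_support.

(** * Particle systems *)

Section empirical_integral.
Context d (X : measurableType d) (R : realType).

Lemma ge0_integral_empirical m (x : 'I_m.+1 -> X) (f : X -> \bar R) :
  measurable_fun setT f -> (forall y, 0 <= f y)%E ->
  (\int[empirical R x]_y f y = (m.+1%:R^-1)%:E * \sum_(i < m.+1) f (x i))%E.
Proof.
move=> mf f0.
pose D := fun k : nat => \d_(x (inord k)) : {measure set X -> \bar R}.
rewrite (@eq_measure_integral _ _ _ _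
  (mscale ((m.+1%:R^-1)%:nng : {nonneg R}) (msum D m.+1))); last first.
  move=> A mA _; rewrite /mscale /msum /= /empirical; congr (_ * _)%E.
  by apply: eq_bigr => i _; rewrite /D inord_val.
rewrite ge0_integral_mscale//; congr (_ * _)%E.
rewrite ge0_integral_measure_sum//; apply: eq_bigr => i _.
by rewrite /D integral_dirac// diracT mul1e inord_val.
Qed.

Lemma Rintegral_empirical m (x : 'I_m.+1 -> X) (f : X -> R) : bounded_measurable f ->
  \int[empirical R x]_y f y = m.+1%:R^-1 * \sum_(i < m.+1) f (x i).
Proof.
move=> bf; have [mf [c fc]] := bf.
have bc := bounded_measurable_cst X c.
have bfc := bounded_measurableD bf bc.
have fc0 y : 0 <= f y + c by have := fc y; rewrite ler_norml; lra.
(* Adding the bound c reduces to a nonnegative integrand. *)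
have -> : \int[empirical R x]_y f y = \int[empirical R x]_y (f y + c) - c.
  by rewrite bounded_RintegralD// Rintegral_prob_cst addrK.
rewrite /Rintegral ge0_integral_empirical//; last first.
  by apply/measurable_EFinP; exact: bfc.1.
rewrite sumEFin -EFinM /= big_split /= sumr_const card_ord mulrDr -[c *+ _]mulr_natl.
by rewrite mulrA mulVf ?pnatr_eq0// mul1r addrK.
Qed.

Lemma law_empirical d' (Y : measurableType d') m (x : 'I_m.+1 -> X) (f : X -> Y)
  (mf : measurable_fun setT f) : eq_meas (law (empirical R x) mf) (empirical R (f \o x)).
Proof.
move=> A mA; rewrite [LHS]/(empirical R x (f @^-1` A)) /empirical; congr (_ * _)%E.
Qed.

End empirical_integral.

Section particles.
Variables (R : realType) (n : nat) (phi : 'rV[R]_n -> 'rV[R]_n) (M : R).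
Local Notation Rn := 'rV[R]_n.
Hypothesis phiM : forall x, `|phi x| <= M.
Hypothesis mphi : measurable_fun setT phi.
Hypothesis phiL : forall r : R, exists L : R, 0 < L /\
  forall x y, `|x| <= r -> `|phi x - phi y| <= L * `|x - y|.

Let M0 : 0 <= M. Proof. by rewrite (le_trans _ (phiM 0)). Qed.

(* Ordinals carry no sigma-algebra in the library, hence labels in nat. *)
Definition labels m : probability nat R := empirical R (fun i : 'I_m.+1 => nat_of_ord i).

Definition by_label m (x : 'I_m.+1 -> Rn) (k : nat) : Rn := x (inord k).

Lemma measurable_by_label m (x : 'I_m.+1 -> Rn) : measurable_fun setT (by_label x).
Proof. by []. Qed.

Lemma law_by_label m (x : 'I_m.+1 -> Rn) :
  eq_meas (law (labels m) (measurable_by_label x)) (empirical R x).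
Proof.
move=> A mA; rewrite (law_empirical (X := nat))//; congr (empirical R _ A).
by apply/funext => i; rewrite /by_label /= inord_val.
Qed.

Lemma velocity_labels m (X : nat -> Rn) k : velocity phi (labels m) X k =
  (m.+1%:R^-1 : R) *: \sum_(j < m.+1) phi (X j - X k).
Proof.
apply/rowP => i; rewrite !mxE Rintegral_empirical; last first.
  exact: (bounded_measurable_phi phiM mphi).
by rewrite summxE.
Qed.

(** The mean value theorem in each coordinate bounds the displacement by M * h, which yields the
    radius r and with it a constant L; the velocity at the intermediate time then differs from that
    at t by at most 2 * L * M * h. *)
Lemma particle_is_flow T m (x : R -> 'I_m.+1 -> Rn) : 0 < T -> particle_solution phi T x ->
  exists r C, 0 <= C /\ is_flow phi (labels m) T r C (fun t => by_label (x t)).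
Proof.
move=> T0 px; have T0' := ltW T0.
pose v t i := (m.+1%:R^-1 : R) *: \sum_j phi (x t j - x t i).
have vE t k : velocity phi (labels m) (by_label (x t)) k = v t (inord k).
  by rewrite velocity_labels /v; congr (_ *: _); apply: eq_bigr => j _; rewrite /by_label inord_val.
have mvt i j t h : 0 <= t -> 0 <= h -> t + h <= T ->
    exists2 s, t <= s <= t + h & x (t + h) i ord0 j - x t i ord0 j = v s i ord0 j * h.
  move=> t0 h0 tT; have [cx dx] := px i; have th : t <= t + h by rewrite lerDl.
  have [||s] := @MVT_segment _ (fun s => x s i ord0 j) (fun s => v s i ord0 j) _ _ th.
  - move=> s; rewrite in_itv /= => /andP[ts sth].
    have sT : 0 < s < T by rewrite (le_lt_trans t0 ts) (lt_le_trans sth tT).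
    have [dxs dxv] := dx s (sT); apply: DeriveDef; first exact: (derivable_mxP _ _ _).1 dxs ord0 j.
    by have := derive_mx dxs; rewrite dxv => /matrixP/(_ ord0 j); rewrite [RHS]mxE => <-.
  - have sub : `[t, t + h]%classic `<=` `[0, T]%classic.
      move=> s; rewrite /= !in_itv /= => /andP[ts sth].
      by apply/andP; split; [exact: le_trans t0 ts|exact: le_trans sth tT].
    have := continuous_subspaceW sub cx; move/subspace_continuousP => cx'.
    apply/subspace_continuousP => s si.
    apply: (@cvg_comp _ _ _ (fun s => x s i) (fun A : Rn => A ord0 j)
      _ (nbhs (x s i)) _ (cx' s si)).
    exact: coord_continuous.
  - by rewrite in_itv /= => st e; exists s => //; rewrite e addrAC subrr add0r.
have vM t i : `|v t i| <= M.
  by rewrite -(inord_val i) -vE; exact: (velocity_norm phiM mphi).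
have lip i t h : 0 <= t -> 0 <= h -> t + h <= T -> `|x (t + h) i - x t i| <= M * h.
  move=> t0 h0 tT; apply: rV_norm_le => [|j]; first exact: mulr_ge0.
  rewrite !mxE; have [s _ ->] := mvt i j t h t0 h0 tT.
  by rewrite normrM (ger0_norm h0) ler_wpM2r// (le_trans (coord_norm_le _ _)).
pose r := \sum_i `|x 0 i| + M * T.
have xr t i : 0 <= t <= T -> `|x t i| <= r.
  move=> /andP[t0 tT]; rewrite -(subrK (x 0 i) (x t i)) addrC (le_trans (ler_normD _ _))//.
  apply: lerD; first by rewrite (bigD1 i)//= lerDl sumr_ge0.
  have := lip i 0 t (lexx _) t0; rewrite add0r => /(_ tT)/le_trans; apply.
  by rewrite ler_wpM2l.
have [L [L0 Lr]] := phiL (r + r).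
exists r, (2 * L * M); split; first by rewrite !mulr_ge0// ltW.
split => [t|t k tT|t h k t0 h0 tT]; first by [].
  exact: xr.
rewrite vE /by_label; move: (inord k) => i.
apply: rV_norm_le => [|j]; first by rewrite !mulr_ge0 ?sqr_ge0// ltW.
rewrite !mxE; have [s /andP[ts sth] ->] := mvt i j t h t0 h0 tT.
rewrite [X in _ - X]mulrC -mulrBl normrM (ger0_norm h0) expr2 mulrA ler_wpM2r//.
have vv : `|v s i - v t i| <= 2 * L * (M * h).
  rewrite -(inord_val i) -!vE.
  apply: (velocity_dist_sup phiM mphi (labels m) (r := r)) => //.
  - by move=> w; apply: xr; rewrite (le_trans t0 ts) (le_trans sth tT).
  - by move=> w; apply: xr; rewrite t0 (le_trans _ tT)// lerDl.
  - exact: ltW.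
  move=> w; rewrite /by_label.
  have st0 : 0 <= s - t by rewrite subr_ge0.
  have := lip (inord w) t (s - t) t0 st0; rewrite subrKC => /(_ (le_trans sth tT)).
  by move=> /le_trans; apply; rewrite ler_wpM2l// lerBlDl.
rewrite -mulrA; apply: le_trans vv.
by have := coord_norm_le (v s i - v t i) j; rewrite !mxE.
Qed.

Lemma flow_particle T m r C (X : R -> nat -> Rn) : 0 <= T -> 0 <= C ->
  is_flow phi (labels m) T r C X ->
  particle_solution phi T (fun t (i : 'I_m.+1) => X t i).
Proof.
move=> T0 C0 fX i; have [_ _ XC] := fX.
have lip t h : 0 <= t -> 0 <= h -> t + h <= T -> `|X (t + h) i - X t i| <= (M + C * T) * h.
  exact: (flow_lipschitz phiM mphi C0 fX).
split; first exact: lipschitz_within_continuous lip.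
move=> t tT; have [K [K0 KP]] := velocity_lipschitz phiM mphi phiL r.
rewrite -velocity_labels.
apply: (@expansion_is_derive _ _ (fun t => X t i) (fun t => velocity phi (labels m) (X t) i)
  T (C + K * (M + C * T))) => //.
- move=> s h s0 h0 sT; rewrite (le_trans (XC s h i s0 h0 sT))// ler_wpM2r ?sqr_ge0//.
  by rewrite lerDl mulr_ge0// addr_ge0// mulr_ge0.
- move=> s h s0 h0 sT; rewrite (le_trans (KP _ _ _ _ _ _ C0 fX s h i s0 h0 sT))//.
  by rewrite mulrA ler_wpM2r// lerDr.
Qed.

End particles.

(** * Density of the empirical measures *)

Section probability_of_measure.
Context d (Y : measurableType d) (R : realType) (nu : {measure set Y -> \bar R}).
Hypothesis nuT : nu setT = 1%E.

Let p : set Y -> \bar R := nu.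

HB.instance Definition _ := isMeasure.Build _ _ _ p
  (measure0 nu) (measure_ge0 nu) (@measure_semi_sigma_additive _ _ _ nu).
HB.instance Definition _ := Measure_isProbability.Build _ _ _ p nuT.

Lemma probability_of_measure : exists P : probability Y R, forall S, P S = nu S.
Proof. by exists p. Qed.

End probability_of_measure.

(** The weighted sum of the images under g i of mu restricted to A i: a way of building a coupling
    cell by cell. *)
Lemma mixture_exists d d' (X : measurableType d) (Y : measurableType d') (R : realType)
    (mu : {measure set X -> \bar R}) (I : Type) (s : seq I) (w : I -> R)
    (A : I -> set X) (g : I -> X -> Y) :
  (forall i, 0 <= w i) -> (forall i, measurable (A i)) ->
  (forall i, measurable_fun setT (g i)) ->
  exists nu : {measure set Y -> \bar R},
    forall S, nu S = (\sum_(i <- s) (w i)%:E * mu (g i @^-1` S `&` A i))%E.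
Proof.
move=> w0 mA mg; elim: s => [|i s [nu nuE]].
  by exists mzero => S; rewrite big_nil.
pose nui : {measure set Y -> \bar R} :=
  measure_function_pushforward__canonical__measure_function_Measure (mrestr mu (mA i)) (mg i).
exists (measure_add (mscale (NngNum (w0 i)) nui) nu) => S.
rewrite -[LHS]/(measure_add (mscale (NngNum (w0 i)) nui) nu S).
by rewrite measure_addE big_cons nuE.
Qed.

Section density.
Variables (R : realType) (n : nat).
Local Notation Rn := 'rV[R]_n.
Variables (mu : probability Rn R) (r : R).
Hypothesis mur : mu (@eball R n r) = 1%E.
Hypothesis r0 : 0 < r.
Variables (I : finType) (A : I -> set Rn) (eta : R).
Hypothesis mA : forall i, measurable (A i).
Hypothesis Ar : forall i, A i `<=` eball r.
Hypothesis tA : forall i j, i != j -> A i `&` A j = set0.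
Hypothesis cA : eball r `<=` \bigcup_(i in setT) A i.
Hypothesis dA : forall i x y, A i x -> A i y -> enorm (x - y) <= eta.
Hypothesis eta0 : 0 <= eta.

Let measure_split B : measurable B -> mu B = (\sum_i mu (B `&` A i))%E.
Proof.
move=> mB; have mb := @measurable_eball R n r.
pose F (k : nat) : set Rn := if (k < #|I|)%N =P true is ReflectT h
  then B `&` A (enum_val (Ordinal h)) else set0.
have FE (i : 'I_#|I|) : F i = B `&` A (enum_val i).
  rewrite /F; case: eqP => [h|]; last by rewrite ltn_ord.
  by congr (_ `&` A (enum_val _)); exact: val_inj.
have mF k : measurable (F k).
  by rewrite /F; case: eqP => [h|_] //; exact: measurableI.
have tF : trivIset setT F.
  apply/trivIsetP => i j _ _ ij; rewrite /F; case: eqP => [hi|_]; last by rewrite set0I.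
  case: eqP => [hj|_]; last by rewrite setI0.
  rewrite setIACA tA ?setI0//; apply: contra_neq ij => /enum_val_inj.
  by move=> /(congr1 (@nat_of_ord _)).
have -> : (\sum_i mu (B `&` A i) = \sum_(k < #|I|) mu (F k))%E.
  rewrite (reindex (fun k : 'I_#|I| => enum_val k)) /=; last first.
    by exists enum_rank => i _; [exact: enum_valK|exact: enum_rankK].
  by apply: eq_bigr => k _; rewrite FE.
rewrite -measure_bigsetU// (prob1_setI mB mb mur).
have -> : B `&` eball r = \big[setU/set0]_(k < #|I|) F k.
  rewrite -bigcup_mkord; apply/seteqP; split => [x [Bx /cA[i _ Ai]]|x [k /= kI]].
    exists (enum_rank i) => /=; first exact: ltn_ord.
    by rewrite FE enum_rankK.
  by rewrite (FE (Ordinal kI)) => -[Bx /Ar].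
by [].
Qed.

Let p i : R := fine (mu (A i)).

Let pE i : mu (A i) = (p i)%:E.
Proof. by rewrite fineK// fin_num_measure. Qed.

Let p0 i : 0 <= p i. Proof. exact: fine_ge0. Qed.

Let sum_p : \sum_i p i = 1.
Proof.
have := measure_split measurableT; rewrite [X in X = _]probability_setT.
rewrite (eq_bigr (fun i => (p i)%:E)); first by rewrite sumEFin => -[].
by move=> i _; rewrite setTI pE.
Qed.

(** For an empty cell the default 0 still lies in the ball. *)
Let rep i : Rn := xget 0 (A i).

Let rep_in i : p i != 0 -> A i (rep i).
Proof.
move=> pi0; rewrite /rep; case: xgetP => [x -> //|nA].
have A0 : A i = set0 by rewrite -subset0 => x /nA.
by move: pi0; rewrite /p A0 measure0 eqxx.
Qed.

Let rep_ball i : eball r (rep i).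
Proof.
rewrite /rep; case: xgetP => [x -> /Ar//|_].
by rewrite /eball /= enorm0.
Qed.

Variable m : nat.

(* Among the m.+1 points, k i are put in the cell A i and the remaining ones at
   0; the coupling sends the fraction c i of the mass of A i to rep i and the
   rest to 0. *)
Let k i : nat := Num.truncn (m.+1%:R * p i).

Let k_itv i : (k i)%:R <= m.+1%:R * p i < (k i).+1%:R.
Proof. by apply: truncn_itv; rewrite mulr_ge0. Qed.

(** For a null cell, division by 0 gives c i = 0, in accordance with k i = 0. *)
Let c i : R := (k i)%:R / (m.+1%:R * p i).

Let m0 : 0 < m.+1%:R :> R. Proof. by []. Qed.

Let c_p i : c i * p i = (k i)%:R / m.+1%:R.
Proof.
have [pi0|pi0] := eqVneq (p i) 0.
  by rewrite pi0 mulr0 /k pi0 mulr0 truncn0 mul0r.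
by rewrite /c; field; rewrite pi0 gt_eqF.
Qed.

Let c0 i : 0 <= c i. Proof. by rewrite divr_ge0// mulr_ge0. Qed.

Let c1 i : c i <= 1.
Proof.
have [pi0|pi0] := eqVneq (p i) 0; first by rewrite /c pi0 mulr0 invr0 mulr0.
rewrite ler_pdivrMr ?mul1r; first by have /andP[] := k_itv i.
by rewrite mulr_gt0// lt_def pi0 p0.
Qed.

Let sum_k : (\sum_i k i <= m.+1)%N.
Proof.
have e : m.+1%:R = \sum_i m.+1%:R * p i by rewrite -mulr_sumr sum_p mulr1.
rewrite -(ler_nat R) natr_sum [leRHS]e.
by apply: ler_sum => i _; have /andP[] := k_itv i.
Qed.

Let rest : nat := (m.+1 - \sum_i k i)%N.

Let pts : seq Rn := flatten [seq nseq (k i) (rep i) | i <- index_enum I] ++ nseq rest 0.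

Let size_pts : size pts = m.+1.
Proof.
rewrite size_cat size_nseq size_flatten /shape -map_comp sumnE big_map.
rewrite (eq_bigr k) => [|i _]; last by rewrite /= size_nseq.
by rewrite subnKC.
Qed.

Let x (i : 'I_m.+1) : Rn := nth 0 pts i.

Let sum_pts (F : Rn -> \bar R) : (\sum_(i < m.+1) F (x i) =
  \sum_i (k i)%:R%:E * F (rep i) + rest%:R%:E * F 0%R)%E.
Proof.
have -> : (\sum_(i < m.+1) F (x i) = \sum_(y <- pts) F y)%E.
  by rewrite [RHS](big_nth (0 : Rn)) size_pts big_mkord.
have bn (a : nat) y : (\sum_(z <- nseq a y) F z = a%:R%:E * F y)%E.
  by rewrite big_nseq iter_addr_0 mule_natl.
rewrite big_cat bn big_flatten big_map; congr (_ + _)%E.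
by apply: eq_bigr => i _; rewrite bn.
Qed.

Let x_ball i : eball r (x i).
Proof.
have xi : x i \in pts by rewrite mem_nth// size_pts.
move: xi; rewrite mem_cat => /orP[/flattenP[s /mapP[j _ ->]]|].
  by rewrite mem_nseq => /andP[_ /eqP ->].
by rewrite mem_nseq => /andP[_ /eqP ->]; rewrite /eball /= enorm0.
Qed.

(** Mass sent to the representative of its cell travels at most eta. Rounding leaves at most 1 / (m
    + 1) per cell to be sent to 0, over a distance of at most 2 * r. *)
Lemma partition_empirical : exists x : 'I_m.+1 -> Rn, (forall i, eball r (x i)) /\
  (W mu (empirical R x) <= (eta + 2 * r * (#|I|%:R / m.+1%:R))%:E)%E.
Proof.
exists x; split => //.
(* The boolean tells the part of a cell sent to its representative from the part sent to 0. *)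
pose w (j : I * bool) := if j.2 then c j.1 else 1 - c j.1.
pose g (j : I * bool) (y : Rn) := (y, if j.2 then rep j.1 else 0).
have w0 j : 0 <= w j by rewrite /w; case: ifP => _ //; rewrite subr_ge0.
have mg j : measurable_fun setT (g j).
  by apply: measurable_fun_pair => //; exact: measurable_cst.
have [nu nuE] := mixture_exists mu (index_enum _) w0 (fun j : I * bool => mA j.1) mg.
have {}nuE S : nu S = (\sum_i ((c i)%:E * mu ((fun y => (y, rep i)) @^-1` S `&` A i) +
    (1 - c i)%:E * mu ((fun y => (y, 0%R)) @^-1` S `&` A i)))%E.
  rewrite nuE (eq_bigr (fun j : I * bool =>
      ((w (j.1, j.2))%:E * mu (g (j.1, j.2) @^-1` S `&` A j.1))%E)).
    rewrite -(pair_bigA _ (fun i b => ((w (i, b))%:E * mu (g (i, b) @^-1` S `&` A i))%E)) /=.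
    by apply: eq_bigr => i _; rewrite big_bool.
  by move=> [i b] _.
have fst_nu B : measurable B -> nu (fst @^-1` B) = mu B.
  move=> mB; rewrite nuE (measure_split mB); apply: eq_bigr => i _.
  rewrite -ge0_muleDl ?lee_fin ?subr_ge0//.
  by rewrite -EFinD subrKC mul1e.
have nuT : nu setT = 1%E.
  have := fst_nu setT measurableT; rewrite preimage_setT => ->.
  exact: probability_setT.
have [tau tauE] := probability_of_measure nuT.
have snd_nu B : nu (snd @^-1` B) = empirical R x B.
  rewrite nuE /empirical (sum_pts (fun y => \d_y B)).
  have cst_pre (y : Rn) (i : I) : mu ((fun z : Rn => (z, y)) @^-1` (snd @^-1` B) `&` A i) =
      ((p i)%:E * \d_y B)%E.
    rewrite diracE; have [yB|yB] := boolP (y \in B).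
      rewrite mule1 -pE; congr (mu _); apply/seteqP; split => [z []//|z Az]; split => //=.
      exact: set_mem yB.
    rewrite mule0 (_ : _ `&` _ = set0) ?measure0// -subset0 => z [/= By _].
    by move: yB; rewrite mem_set.
  under eq_bigr do rewrite !cst_pre.
  have dB (y : Rn) : exists b : R, (\d_y B : \bar R) = b%:E.
    by rewrite diracE; exists (y \in B)%:R.
  have /choice[b bE] : forall i, exists b : R, (\d_(rep i) B : \bar R) = b%:E.
    by move=> i; exact: dB.
  have [b' ->] := dB 0.
  under eq_bigr do rewrite bE -!EFinM -EFinD.
  under [in RHS]eq_bigr do rewrite bE -!EFinM.
  rewrite !sumEFin.
  rewrite -[RHS]/((m.+1%:R^-1 * (\sum_i ((k i)%:R * b i) + rest%:R * b'))%:E); congr EFin.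
  rewrite big_split /= mulrDr mulr_sumr; congr (_ + _).
    by apply: eq_bigr => i _; rewrite mulrA c_p [_%:R / _]mulrC -mulrA.
  transitivity (\sum_i (p i - m.+1%:R^-1 * (k i)%:R) * b').
    by apply: eq_bigr => i _; rewrite mulrA mulrBl mul1r c_p [_%:R / _]mulrC.
  rewrite -mulr_suml sumrB sum_p -mulr_sumr -natr_sum.
  by rewrite /rest natrB// [RHS]mulrA mulrBr mulVf ?pnatr_eq0.
have ct : coupling mu (empirical R x) tau.
  split => B mB; rewrite /pushforward tauE; first exact: fst_nu.
  exact: snd_nu.
apply: (@le_trans _ _ (transport_cost tau)).
  by apply: ereal_inf_lbound; exists tau.
pose E : set (Rn * Rn) := [set z | enorm (z.1 - z.2) <= eta].
have mE : measurable E.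
  rewrite (_ : E = setT `&` (fun z : Rn * Rn => enorm (z.1 - z.2)) @^-1` `]-oo, eta]%classic).
    exact: (measurable_enorm (measurable_rowB measurable_fst measurable_snd)).
  by rewrite setTI; apply/seteqP; split => z /=; rewrite in_itv.
have tauE' : fine (tau (~` E)) <= #|I|%:R / m.+1%:R.
  have : (\sum_i (c i * p i)%:E <= tau E)%E.
    rewrite tauE nuE; apply: lee_sum => i _.
    apply: (@le_trans _ _ ((c i)%:E * mu ((fun y => (y, rep i)) @^-1` E `&` A i))%E); last first.
      by rewrite leeDl// mule_ge0// lee_fin subr_ge0.
    rewrite EFinM -pE; have [pi0|pi0] := eqVneq (p i) 0.
      by rewrite pE pi0 mule0 mule_ge0// lee_fin.
    rewrite (_ : _ `&` A i = A i)//; apply/setIidPr => y Ay /=.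
    by apply: (dA Ay); exact: rep_in.
  rewrite probability_setC// sumEFin.
  have fE : tau E \is a fin_num by exact: fin_num_measure.
  rewrite -(fineK fE) lee_fin /= => h.
  have : \sum_i (p i - c i * p i) <= #|I|%:R / m.+1%:R.
    have -> : #|I|%:R / m.+1%:R = \sum_(i : I) m.+1%:R^-1 :> R.
      by rewrite sumr_const -[RHS]mulr_natl.
    apply: ler_sum => i _; rewrite c_p lerBlDr -(ler_pM2l m0).
    rewrite mulrDr mulfV ?pnatr_eq0// mulrCA mulfV ?pnatr_eq0// mulr1.
    by have /andP[_ /ltW] := k_itv i; rewrite -[(k i).+1%:R]natr1 addrC.
  rewrite big_split /= sumrN sum_p => h2.
  by apply: le_trans h2; rewrite lerD2l lerN2.
have er : empirical R x (@eball R n r) = 1%E.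
  rewrite /empirical (eq_bigr (fun=> 1%E)) => [|i _]; last first.
    by rewrite diracE mem_set.
  by rewrite sumEFin big_const_ord iter_addr_0 -EFinM mulVf.
have bC : bounded_measurable (\1_(~` E) : Rn * Rn -> R).
  by apply: bounded_measurable_indic; exact: measurableC.
have bD : bounded_measurable (fun z : Rn * Rn => eta + 2 * r * \1_(~` E) z).
  apply: bounded_measurableD; first exact: bounded_measurable_cst.
  exact: bounded_measurableZ.
have r00 := ltW r0.
apply: (@le_trans _ _ (\int[tau]_z (eta + 2 * r * \1_(~` E) z)%:E)%E).
  apply: ae_ge0_le_integral => //.
  - by move=> z _; rewrite lee_fin enorm_ge0.
  - exact: measurable_transport_cost.
  - by move=> z _; rewrite lee_fin addr_ge0// mulr_ge0// mulr_ge0.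
  - by apply/measurable_EFinP; exact: bD.1.
  apply: (prob1_ae (measurable_eball2 r) (coupling_eball ct mur er)).
  move=> z [z1 z2] _; rewrite lee_fin indicE.
  have [zE|zE] := boolP (z \in ~` E).
    rewrite mulr1 (le_trans (enormD _ _))// enormN ler_wpDl//.
    by rewrite mulr_natl mulr2n lerD// ltW.
  rewrite mulr0 addr0; apply: contrapT => h; move/negP: zE; apply.
  exact: mem_set.
rewrite bounded_EFin_Rintegral// lee_fin bounded_RintegralD//.
  2: exact: bounded_measurable_cst.
  2: exact: bounded_measurableZ.
rewrite Rintegral_prob_cst bounded_RintegralZ// lerD2l ler_wpM2l ?mulr_ge0//.
by rewrite Rintegral_prob_indic//; exact: measurableC.
Qed.

End density.

Section approximation.
Variables (R : realType) (n : nat).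
Local Notation Rn := 'rV[R]_n.
Implicit Types mu nu : probability Rn R.

Lemma empirical_dense mu (r e : R) : mu (@eball R n r) = 1%E -> 0 < r -> 0 < e ->
  exists (m : nat) (x : 'I_m.+1 -> Rn), (forall i, eball r (x i)) /\
    (W mu (empirical R x) < e%:E)%E.
Proof.
move=> mur r0 e0.
(* Grid cells of side h have Euclidean diameter at most n * h <= e / 2; n + 1 keeps the denominator
   nonzero in dimension 0. *)
pose h := e / (2 * n.+1%:R).
have h0 : 0 < h by rewrite divr_gt0// mulr_gt0.
pose Q := (Num.truncn (2 * r / h)).+1.
pose cell (k : nat) : set R := [set` `[k%:R * h - r, k.+1%:R * h - r[].
pose A (j : {ffun 'I_n -> 'I_Q}) : set Rn :=
  eball r `&` \bigcap_(i in [set: 'I_n]) ((fun x => x ord0 i) @^-1` cell (j i)).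
have mA j : measurable (A j).
  apply: measurableI; first exact: measurable_eball.
  apply: fin_bigcap_measurable => // i _.
  by rewrite -[X in measurable X]setTI; apply: measurable_coord => //; exact: measurable_itv.
have AE j x i : A j x -> (j i)%:R * h - r <= x ord0 i < (j i).+1%:R * h - r.
  by move=> [_ /(_ i Logic.I)]; rewrite /preimage /cell /= in_itv /=.
have tA j k : j != k -> A j `&` A k = set0.
  move=> jk; rewrite -subset0 => x [Aj Ak]; move/eqP: jk; apply; apply/ffunP => i.
  have /andP[j1 j2] := AE j x i Aj; have /andP[k1 k2] := AE k x i Ak.
  apply: val_inj; apply/eqP; rewrite eqn_leq; apply/andP; split.
    rewrite -ltnS -(ltr_nat R) -(ltr_pM2r h0); lra.
  rewrite -ltnS -(ltr_nat R) -(ltr_pM2r h0); lra.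
have cA : eball r `<=` \bigcup_(j in setT) A j.
  move=> x xr; have xi i : `|x ord0 i| < r by exact: le_lt_trans (coord_enorm_le _ _) xr.
  pose t i := (x ord0 i + r) / h.
  have t0 i : 0 <= t i by rewrite divr_ge0 ?ltW//; have := xi i; rewrite ltr_norml; lra.
  have tQ i : (Num.truncn (t i) < Q)%N.
    rewrite ltnS; apply: le_truncn; rewrite ler_pM2r ?invr_gt0//.
    by have := xi i; rewrite ltr_norml; lra.
  exists [ffun i => Ordinal (tQ i)] => //; split=> // i _.
  rewrite /cell /= in_itv /= ffunE /=.
  have := truncn_itv (t0 i); rewrite ler_pdivlMr// ltr_pdivrMr//; lra.
have dA j x y : A j x -> A j y -> enorm (x - y) <= n%:R * h.
  move=> Ax Ay; rewrite (le_trans (enorm_le_norm _))// ler_wpM2l//.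
  apply: rV_norm_le => [|i]; first exact: ltW.
  rewrite !mxE ler_norml.
  have := AE j x i Ax; have := AE j y i Ay; rewrite -!natr1 !mulrDl !mul1r; lra.
have eta0 : 0 <= n%:R * h by rewrite mulr_ge0// ltW.
(* m is so large that the rounding cost, 2 * r times the number of cells over m + 1, is below e /
   2. *)
have [m] := ltr_add_invr (divr_gt0 e0 (ltr_wpDl (mulr_ge0 (mulr_ge0 (ler0n R 4) (ltW r0))
  (ler0n R #|{ffun 'I_n -> 'I_Q}|)) ltr01)).
rewrite add0r => me.
have [x [xr Wx]] := partition_empirical mur r0 mA (fun j x => @proj1 _ _) tA cA dA eta0 m.
exists m, x; split => //; apply: le_lt_trans Wx _; rewrite lte_fin.
set c := #|_|%:R in me *.
have c0 : 0 <= c by [].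
have h1 : n%:R * h <= e / 2.
  rewrite /h (_ : n%:R * (e / (2 * n.+1%:R)) = (n%:R / n.+1%:R) * (e / 2)).
    by rewrite ler_piMl ?divr_ge0 ?ltW// ltr_pdivrMr// mul1r ltr_nat.
  by field; rewrite nat1r pnatr_eq0.
have Y0 : 0 < 4 * r * c + 1 by rewrite ltr_wpDl// mulr_ge0// mulr_ge0// ltW.
rewrite ltr_pdivlMr// in me.
have i0 : 0 < m.+1%:R^-1 :> R by rewrite invr_gt0.
move: me i0; set i := m.+1%:R^-1 => me i0.
have : i * (4 * r * c + 1) = 2 * (2 * r * (c * i)) + i by ring.
lra.
Qed.

Lemma W_sym mu nu : W mu nu = W nu mu.
Proof.
suff le_W (al be : probability Rn R) : (W al be <= W be al)%E.
  by apply/eqP; rewrite eq_le !le_W.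
apply: le_ereal_inf_tmp => _ [tau [t1 t2] <-].
have ms : measurable_fun setT (fun z : Rn * Rn => (z.2, z.1)).
  by apply: measurable_fun_pair; [exact: measurable_snd|exact: measurable_fst].
apply: ereal_inf_lbound; exists (law tau ms).
  by split => A mA; [exact: t2|exact: t1].
rewrite /transport_cost ge0_integral_law//; first last.
- by move=> y; rewrite lee_fin enorm_ge0.
- exact: measurable_transport_cost.
by apply: eq_integral => z _; rewrite /= enorm_distC.
Qed.

Lemma supp_ext mu nu : eq_meas mu nu -> supp mu = supp nu.
Proof.
move=> e; apply/seteqP; split => x sx U oU Ux.
  by rewrite -e ?(sx _ oU)//; exact: measurable_open.
by rewrite e ?(sx _ oU)//; exact: measurable_open.
Qed.

Lemma compactly_supported_ball mu : compactly_supported mu ->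
  exists r, [/\ 0 < r, supp mu `<=` eball r & mu (@eball R n r) = 1%E].
Proof.
move=> /compact_bounded[B [_ BP]].
pose r := n%:R * (`|B| + 1) + 1.
have r0 : 0 < r by rewrite ltr_wpDl// mulr_ge0// addr_ge0.
have sr : supp mu `<=` eball r.
  move=> x sx; rewrite /eball /= /r (le_lt_trans (enorm_le_norm _))//.
  apply: (@le_lt_trans _ _ (n%:R * (`|B| + 1))); last by rewrite ltrDl.
  by rewrite ler_wpM2l//; apply: BP => //; rewrite (le_lt_trans (ler_norm B))// ltrDl.
by exists r; split => //; apply: supp_full sr; exact: measurable_eball.
Qed.

Lemma cball_compactly_supported mu (r : R) :
  mu [set x : Rn | enorm x <= r] = 1%E -> compactly_supported mu.
Proof.
move=> mur; apply: (@bounded_closed_compact_enorm _ _ _ r); first exact: closed_supp.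
exact: supp_sub (@closed_cball _ _ _) mur.
Qed.

Lemma empirical_full m (x : 'I_m.+1 -> Rn) (A : set Rn) :
  (forall i, A (x i)) -> empirical R x A = 1%E.
Proof.
move=> Ax; rewrite /empirical (eq_bigr (fun=> 1%E)) => [|i _]; last first.
  by rewrite diracE mem_set.
by rewrite sumEFin big_const_ord iter_addr_0 -EFinM mulVf.
Qed.

End approximation.

(** * The semigroup *)

Section semigroup.
Variables (R : realType) (n : nat) (phi : 'rV[R]_n -> 'rV[R]_n) (M : R).
Local Notation Rn := 'rV[R]_n.
Local Notation PRn := (probability Rn R).
Hypothesis phiM : forall x, `|phi x| <= M.
Hypothesis mphi : measurable_fun setT phi.
Hypothesis phiL : forall r : R, exists L : R, 0 < L /\
  forall x y, `|x| <= r -> `|phi x - phi y| <= L * `|x - y|.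
Variable T : R.
Hypothesis T0 : 0 < T.
Implicit Types mu nu : PRn.

Let M0 : 0 <= M. Proof. by rewrite (le_trans _ (phiM 0)). Qed.

(** The constants rho and C are chosen before the label space and the initial data, so that all
    flows starting in the ball share them. *)
Lemma flow_exists (r : R) : exists rho C, 0 <= C /\
  forall d (O : measurableType d) (P : probability O R) (xi : O -> Rn),
  measurable_fun setT xi -> (forall w, `|xi w| <= r) ->
  exists X : R -> O -> Rn, X 0 = xi /\ is_flow phi P T rho C X.
Proof.
have [L [L0 Lr]] := phiL (r + M * T + (r + M * T)).
exists (r + M * T), (2 * L * M); split; first by rewrite !mulr_ge0// ltW.
by move=> d O P xi mxi xir; apply: euler_flow => //; exact: ltW.
Qed.

(* The initial measure may be realised on any label space: shifted flows then
   give the semigroup property, labelled particles the empirical trajectories,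
   and couplings the contraction estimate. *)
Definition transports (S : R -> PRn -> PRn) : Prop :=
  forall mu d (O : measurableType d) (P : probability O R) (T' r C : R)
    (Y : R -> O -> Rn) (mY : forall t, measurable_fun setT (Y t)),
  compactly_supported mu -> T' <= T -> is_flow phi P T' r C Y ->
  eq_meas (law P (mY 0)) mu ->
  forall t, 0 <= t <= T' -> eq_meas (S t mu) (law P (mY t)).

Lemma transports_exists : exists S, transports S.
Proof.
have flow mu : exists X : R -> Rn -> Rn, (forall t, measurable_fun setT (X t)) /\
    (compactly_supported mu -> exists r rho C, [/\ 0 <= C, mu (@eball R n r) = 1%E,
       X 0 = trunc r & is_flow phi mu T rho C X]).
  have [cmu|cmu] := pselect (compactly_supported mu); last first.
    by exists (fun _ _ => 0); split => // t; exact: measurable_cst.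
  have [r [r0 _ mur]] := compactly_supported_ball cmu.
  have [rho [C [C0 H]]] := flow_exists r.
  have [X [X0 fX]] := H _ _ mu _ (measurable_trunc r) (fun w => trunc_norm w (ltW r0)).
  by exists X; split; [case: fX|move=> _; exists r, rho, C].
have [X XP] := choice flow.
exists (fun t mu => law mu ((XP mu).1 t)).
move=> mu d O P T' r' C' Y mY cmu TT fY Y0 t tT.
have [r [rho [C [C0 mur X0 fX]]]] := (XP mu).2 cmu.
(* The relabelling is [Y 0]: a label of the given flow is sent to its initial position, which labels
   the flow defining S. *)
apply: (flow_law_unique phiM mphi phiL (g := Y 0) (mg := mY 0) _ _ C0 Y0
  (flow_shorten TT fX) fY) => //.
rewrite X0; apply: (@prob1_ae _ _ _ _ (Y 0 @^-1` eball r)).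
- by rewrite -[X in measurable X]setTI; apply: (mY 0) => //; exact: measurable_eball.
- by rewrite -mur -Y0//; exact: measurable_eball.
- by move=> w; exact: truncE.
Qed.

Section properties.
Variables (S : R -> PRn -> PRn) (SP : transports S).
Let V := interaction_pvf mphi.

Lemma transports_flow (r : R) : 0 <= r -> exists rho C, 0 <= C /\
  forall mu, compactly_supported mu -> mu (@eball R n r) = 1%E ->
  exists (X : R -> Rn -> Rn) (mX : forall t, measurable_fun setT (X t)),
    [/\ X 0 = trunc r, is_flow phi mu T rho C X &
        forall t, 0 <= t <= T -> eq_meas (S t mu) (law mu (mX t))].
Proof.
move=> r0; have [rho [C [C0 H]]] := flow_exists r.
exists rho, C; split => // mu cmu mur.
have [X [X0 fX]] := H _ _ mu _ (measurable_trunc r) (fun w => trunc_norm w r0).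
have [mX _ _] := fX; exists X, mX; split => //.
apply: (SP (mY := mX) cmu (lexx T) fX) => A mA.
by rewrite -(law_trunc mur mA) lawE X0.
Qed.

Lemma transports_compact t mu : 0 <= t <= T -> compactly_supported mu ->
  compactly_supported (S t mu).
Proof.
move=> tT cmu; have [r [r0 _ mur]] := compactly_supported_ball cmu.
have [rho [C [_ H]]] := transports_flow (ltW r0).
have [X [mX [_ [_ Xr _] SX]]] := H mu cmu mur.
apply: (@cball_compactly_supported _ _ _ (n%:R * rho)).
rewrite SX//; last by apply: measurable_closed; exact: closed_cball.
rewrite lawE (_ : _ @^-1` _ = setT); first exact: probability_setT.
apply/seteqP; split => // w _ /=; rewrite (le_trans (enorm_le_norm _))//.
by rewrite ler_wpM2l//; exact: Xr.
Qed.

Lemma transports_ext t mu nu : 0 <= t <= T -> compactly_supported mu ->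
  compactly_supported nu -> eq_meas mu nu -> eq_meas (S t mu) (S t nu).
Proof.
move=> tT cmu cnu e; have [r [r0 _ mur]] := compactly_supported_ball cmu.
have [rho [C [_ H]]] := transports_flow (ltW r0).
have [X [mX [X0 fX SX]]] := H mu cmu mur.
have nuX : eq_meas (S t nu) (law mu (mX t)).
  apply: (SP (mY := mX) cnu (lexx T) fX _ tT) => A mA.
  by rewrite -e// -(law_trunc mur mA) lawE X0.
by move=> A mA; rewrite SX// nuX.
Qed.

Lemma transports0 mu : compactly_supported mu -> eq_meas (S 0 mu) mu.
Proof.
move=> cmu; have [r [r0 _ mur]] := compactly_supported_ball cmu.
have [rho [C [_ H]]] := transports_flow (ltW r0).
have [X [mX [X0 fX SX]]] := H mu cmu mur.
have T00 : (0 : R) <= 0 <= T by rewrite lexx ltW.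
by move=> A mA; rewrite SX// -[RHS](law_trunc mur mA) lawE X0.
Qed.

Lemma transportsD t s mu : 0 <= t <= T -> 0 <= s <= T -> t + s <= T ->
  compactly_supported mu -> eq_meas (S t (S s mu)) (S (t + s) mu).
Proof.
move=> tT sT tsT cmu; have [r [r0 _ mur]] := compactly_supported_ball cmu.
have [rho [C [_ H]]] := transports_flow (ltW r0).
have [X [mX [X0 fX SX]]] := H mu cmu mur.
have /andP[t0 _] := tT; have /andP[s0 _] := sT.
have fXs := flow_shift s0 fX.
have SSX : eq_meas (S t (S s mu)) (law mu (mX (s + t))).
  apply: (SP (mY := fun t => mX (s + t)) _ _ fXs).
  - exact: transports_compact.
  - by rewrite lerBlDr lerDl.
  - by move=> A mA; rewrite SX// [LHS]lawE [RHS]lawE addr0.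
  - by rewrite t0 lerBrDr.
by move=> A mA; rewrite SSX// SX ?addr_ge0// [LHS]lawE [RHS]lawE addrC.
Qed.

Lemma transports_solution mu : compactly_supported mu -> is_solution V T (S ^~ mu).
Proof.
move=> cmu; have [r [r0 _ mur]] := compactly_supported_ball cmu.
have [rho [C [C0 H]]] := transports_flow (ltW r0).
have [X [mX [X0 fX SX]]] := H mu cmu mur.
exact: (flow_is_solution phiM mphi phiL T0 C0 fX SX).
Qed.

Lemma transports_support G (r t : R) mu : 0 < G -> linear_growth V G -> 0 < r ->
  0 <= t <= T -> compactly_supported mu -> supp mu `<=` eball r ->
  supp (S t mu) `<=` eball (expR (G * t) * (r + 1)).
Proof.
move=> G0 VG r0 tT cmu smu; have mur := supp_full (measurable_eball r) smu.
have [rho [C [C0 H]]] := transports_flow (ltW r0).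
have [X [mX [X0 fX SX]]] := H mu cmu mur.
rewrite (supp_ext (SX t tT)).
apply: (flow_growth phiM phiL G0 VG (ltW r0) C0 fX) => //.
apply: (prob1_sub (A := eball r)) mur.
- exact: measurable_eball.
- rewrite (_ : [set _ | _] = setT `&` X 0 @^-1` [set x | enorm x <= r]).
    by apply: (mX 0) => //; apply: measurable_closed; exact: closed_cball.
  by rewrite setTI.
- by move=> w wr; rewrite /= X0 truncE//; exact: ltW.
Qed.

Lemma transports_lipschitz (r : R) : 0 < r -> exists K, 0 < K /\
  forall mu nu t s, compactly_supported mu -> compactly_supported nu ->
  0 <= t <= T -> 0 <= s <= T -> supp mu `<=` eball r -> supp nu `<=` eball r ->
  (W (S t mu) (S t nu) <= (expR (K * t))%:E * W mu nu)%E /\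
  (W (S t mu) (S s mu) <= (K * `|t - s|)%:E)%E.
Proof.
move=> r0; have [rho [C [C0 H]]] := transports_flow (ltW r0).
have [K0 [K00 KP]] := flow_stability phiM mphi phiL rho.
have MC0 : 0 <= n%:R * (M + C * T) by rewrite mulr_ge0// addr_ge0// mulr_ge0// ltW.
(* One constant for both estimates: [K0] from stability in the initial data, the rest from the speed
   of the flow. *)
exists (K0 + n%:R * (M + C * T)); split; first by rewrite ltr_wpDr.
move=> mu nu t s cmu cnu tT sT smu snu.
have mur := supp_full (measurable_eball r) smu.
have nur := supp_full (measurable_eball r) snu.
have [X [mX [X0 fX SX]]] := H mu cmu mur.
have [Y [mY [Y0 fY SY]]] := H nu cnu nur.
have [_ Xr _] := fX; have [_ Yr _] := fY.
have /andP[t0 _] := tT.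
split.
  rewrite (W_ext (SX t tT) (SY t tT)).
  rewrite -lee_pdivrMl ?expR_gt0//.
  apply: le_ereal_inf_tmp => _ [tau ctau <-].
  rewrite lee_pdivrMl ?expR_gt0//.
  have mf := @measurable_fst _ _ Rn Rn; have ms := @measurable_snd _ _ Rn Rn.
  have [tau1 tau2] := ctau.
  have f1 : is_flow phi tau T rho C (fun t => X t \o fst).
    by apply: (flow_comp phiM mphi (mg := mf)) fX => A mA; exact: tau1.
  have f2 : is_flow phi tau T rho C (fun t => Y t \o snd).
    by apply: (flow_comp phiM mphi (mg := ms)) fY => A mA; exact: tau2.
  have [mXf Xfr _] := f1; have [mYs Ysr _] := f2.
  have e1 : eq_meas (law mu (mX t)) (law tau (mXf t)).
    move=> A mA; have mA' : measurable (X t @^-1` A).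
      by rewrite -[X in measurable X]setTI; exact: (mX t).
    exact: esym (tau1 _ mA').
  have e2 : eq_meas (law nu (mY t)) (law tau (mYs t)).
    move=> A mA; have mA' : measurable (Y t @^-1` A).
      by rewrite -[X in measurable X]setTI; exact: (mY t).
    exact: esym (tau2 _ mA').
  rewrite (W_ext e1 e2); apply: (le_trans (W_law _ _ _)).
  rewrite bounded_EFin_Rintegral; last first.
    by apply: bounded_measurable_enorm (rho) _ _ _ _ => // w; [exact: Xfr|exact: Ysr].
  rewrite -(trunc_cost (ltW r0) ctau mur nur) -EFinM lee_fin.
  apply: (le_trans (KP _ _ tau T C _ _ C0 f1 f2 t tT)).
  rewrite /= X0 Y0 ler_wpM2r//; first by apply: Rintegral_ge0 => z _; exact: enorm_ge0.
  by rewrite ler_expR ler_wpM2r// lerDl.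
rewrite (W_ext (SX t tT) (SX s sT)); apply: (le_trans (W_law _ _ _)).
have XL w : enorm (X t w - X s w) <= (K0 + n%:R * (M + C * T)) * `|t - s|.
  have h := @lipschitz_itv _ _ (X ^~ w) _ _ (fun t h => flow_lipschitz phiM mphi C0 fX w) _ _ tT sT.
  rewrite (le_trans (enorm_le_norm _))//.
  apply: (@le_trans _ _ (n%:R * (M + C * T) * `|t - s|)).
    by rewrite -mulrA ler_wpM2l.
  by rewrite ler_wpM2r// lerDr ltW.
rewrite bounded_EFin_Rintegral; last first.
  by apply: bounded_measurable_enorm (rho) _ _ _ _ => // w; exact: Xr.
rewrite lee_fin -[leRHS](Rintegral_prob_cst mu).
apply: bounded_le_Rintegral => //; last exact: bounded_measurable_cst.
by apply: bounded_measurable_enorm (rho) _ _ _ _ => // w; exact: Xr.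
Qed.

Lemma transports_semigroup G : 0 < G -> linear_growth V G -> lipschitz_semigroup V G T S.
Proof.
move=> G0 VG; split.
- exact: transports_compact.
- exact: transports_ext.
- split; first exact: transports0.
  exact: transportsD.
- exact: transports_solution.
- move=> r r0; have [K [K0 KP]] := transports_lipschitz r0.
  exists K; split => // mu nu t s cmu cnu tT sT smu snu.
  by have [? ?] := KP mu nu t s cmu cnu tT sT smu snu; split => //; exact: transports_support.
Qed.

Lemma empirical_compactly_supported m (x : 'I_m.+1 -> Rn) :
  compactly_supported (empirical R x).
Proof.
apply: (@cball_compactly_supported _ _ _ (\sum_i enorm (x i))).
apply: empirical_full => i /=; rewrite (bigD1 i)//= lerDl.
by apply: sumr_ge0 => j _; exact: enorm_ge0.
Qed.

Lemma transports_particles : follows_particles phi T S.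
Proof.
move=> m x px t tT; have [r [C [_ fx]]] := particle_is_flow phiM mphi phiL T0 px.
have := SP (mY := fun t => measurable_by_label (x t))
  (@empirical_compactly_supported m (x 0)) (lexx T) fx (law_by_label (x 0)) tT.
by move=> h A mA; rewrite h// law_by_label.
Qed.

End properties.

(** Two semigroups that follow the particles can be compared at an empirical measure only if some
    particle solution starts there; the flow over equally likely labels provides it. *)
Lemma particle_solution_exists m (x0 : 'I_m.+1 -> Rn) : exists x,
  x 0 = x0 /\ particle_solution phi T x.
Proof.
have [rho [C [C0 H]]] := flow_exists (\sum_i `|x0 i|).
have [|X [X0 fX]] := H _ _ (labels R m) (by_label x0) (measurable_by_label x0).
  by move=> k; rewrite /by_label (bigD1 (inord k))//= lerDl sumr_ge0.
exists (fun t (i : 'I_m.+1) => X t i); split; last first.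
  exact: (flow_particle phiM mphi phiL (ltW T0) C0 fX).
by apply/funext => i; rewrite X0 /by_label inord_val.
Qed.

(* Both semigroups are Lipschitz for W and agree on the empirical measures,
   which are dense. *)
Lemma lipschitz_semigroup_unique G S S' :
  lipschitz_semigroup (interaction_pvf mphi) G T S -> follows_particles phi T S ->
  lipschitz_semigroup (interaction_pvf mphi) G T S' -> follows_particles phi T S' ->
  forall t mu, 0 <= t <= T -> compactly_supported mu -> eq_meas (S' t mu) (S t mu).
Proof.
move=> [_ _ _ _ SL] Sp [_ _ _ _ SL'] Sp' t mu tT cmu; have /andP[t0 _] := tT.
have [r [r0 smu mur]] := compactly_supported_ball cmu.
(* The support of the approximating empirical measure is placed in the closed ball of radius r,
   hence the larger open ball. *)
have r10 : 0 < r + 1 by rewrite addr_gt0.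
have [K [K0 KP]] := SL _ r10; have [K' [K0' KP']] := SL' _ r10.
apply: eq_meas_W => e e0.
(* The denominator dominates both Lipschitz factors, so a single approximation serves S and S'. *)
pose e' := e / (expR (K * t) + expR (K' * t)).
have X0 : 0 < expR (K * t) + expR (K' * t) by rewrite addr_gt0// expR_gt0.
have e'0 : 0 < e' by rewrite divr_gt0.
have [m [x0 [x0r Wx]]] := empirical_dense mur r0 e'0.
have [x [xE px]] := particle_solution_exists x0.
have cx : compactly_supported (empirical R x0) by exact: empirical_compactly_supported.
have sub : eball r `<=` @eball R n (r + 1).
  by move=> y; rewrite /eball /= => /lt_trans; apply; rewrite ltrDl.
have smu1 := subset_trans smu sub.
have sx1 : supp (empirical R x0) `<=` eball (r + 1).
  have : supp (empirical R x0) `<=` [set y | enorm y <= r].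
    apply: supp_sub (@closed_cball _ _ _) _; apply: empirical_full => i; exact: ltW (x0r i).
  by move=> h y /h /= yr; rewrite /eball /= (le_lt_trans yr)// ltrDl.
have mid (al : PRn) : eq_meas al al by [].
have dom a : a <= expR (K * t) + expR (K' * t) -> 0 < a ->
    (a%:E * W mu (empirical R x0) < e%:E)%E.
  move=> aK a0; apply: (@lt_le_trans _ _ (a%:E * e'%:E)%E).
    by rewrite lte_pmul2l// lte_fin.
  by rewrite -EFinM lee_fin /e' mulrA ler_pdivrMr// mulrC ler_wpM2l// ltW.
have Sx := Sp m x px t tT; have Sx' := Sp' m x px t tT; rewrite xE in Sx Sx'.
exists (empirical R (x t)); split.
  rewrite -(W_ext (mid (S' t mu)) Sx').
  have [_ h _] := KP' mu (empirical R x0) t t cmu cx tT tT smu1 sx1.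
  by apply: (le_lt_trans h); apply: dom; rewrite ?lerDr ?expR_ge0 ?expR_gt0.
rewrite W_sym -(W_ext (mid (S t mu)) Sx).
have [_ h _] := KP mu (empirical R x0) t t cmu cx tT tT smu1 sx1.
by apply: (le_lt_trans h); apply: dom; rewrite ?lerDl ?expR_ge0 ?expR_gt0.
Qed.

End semigroup.

Theorem corollary8p1 (R : realType) (n : nat) (phi : 'rV[R]_n -> 'rV[R]_n)
    (phi_bounded : [bounded phi x | x in [set: 'rV[R]_n]])
    (phi_lip : locally_lipschitz phi) :
  let V := interaction_pvf (locally_lipschitz_measurable phi_lip) in
  [/\ locally_calW_lipschitz V,
      forall (m : nat) (T : R) (x : R -> 'I_m.+1 -> 'rV[R]_n), 0 < T ->
        particle_solution phi T x ->
        is_solution V T (fun t => empirical R (x t)),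
      exists C : R, 0 < C /\ linear_growth V C &
      forall C : R, 0 < C -> linear_growth V C ->
      forall T : R, 0 < T ->
      exists S : R -> probability 'rV[R]_n R -> probability 'rV[R]_n R,
        [/\ lipschitz_semigroup V C T S,
            follows_particles phi T S &
            forall S' : R -> probability 'rV[R]_n R -> probability 'rV[R]_n R,
              lipschitz_semigroup V C T S' -> follows_particles phi T S' ->
              forall t mu, 0 <= t <= T -> compactly_supported mu ->
                eq_meas (S' t mu) (S t mu)]].

Proof.
set mphi := locally_lipschitz_measurable phi_lip => V.
have [M phiM] : exists M, forall x, `|phi x| <= M.
  have [B [_ BP]] := phi_bounded; exists (B + 1) => x.
  by apply: BP => //; rewrite ltrDl.
have phiL := locally_lipschitz_ball phiM phi_lip.
split.
- exact: interaction_calW_lipschitz phiM mphi phiL.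
- move=> m T x T0 px; have [r [C [C0 fx]]] := particle_is_flow phiM mphi phiL T0 px.
  apply: (flow_is_solution (mX := fun t => measurable_by_label (x t)) phiM mphi phiL T0 C0 fx).
  by move=> t _ A mA; rewrite law_by_label.
- exact: interaction_linear_growth phiM mphi.
move=> C C0 VC T T0.
have [S ST] := transports_exists phiM mphi phiL T0.
have SV : lipschitz_semigroup V C T S by exact: transports_semigroup.
have Sp : follows_particles phi T S by exact: transports_particles phiM mphi phiL _ T0 _ ST.
exists S; split => // S' SV' Sp'.
move=> t mu tT cmu.
exact: (lipschitz_semigroup_unique phiM phiL T0 SV Sp SV' Sp' tT cmu).
Qed.
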